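(* Let $d\ge 2$. The continuous cohomology $H^i_c(N_d,\mathbb{R})$ of Neretin's group $N_d$ vanishes for every $i>0$.
   Context: Neretin's group $N_d$ is the group of almost automorphisms of the non-rooted $(d+1)$-regular tree $T$: its elements are represented by forest isomorphisms $T\setminus F\to T\setminus F'$, where $F,F'$ are nonempty finite subtrees of $T$ and $T\setminus F$ denotes the forest obtained by deleting the vertices of $F$; two such isomorphisms represent the same element if they agree on $T\setminus F''$ for some finite subtree $F''$ containing both of their deleted subtrees in the source. Composition is defined after enlarging the deleted finite subtrees. $N_d$ carries the unique group topology for which the natural inclusion $\mathrm{Aut}(T)\hookrightarrow N_d$ is continuous and open, where $\mathrm{Aut}(T)$ has the topology of pointwise convergence on vertices; with this topology $N_d$ is a totally disconnected locally compact Hausdorff group. The continuous cohomology $H^\ast_c(G,\mathbb{R})$ of a locally compact group $G$ (trivial coefficients) is the cohomology of the complex $C(G^{\ast+1},\mathbb{R})^G$ of $G$-invariant continuous functions $G^{n+1}\to\mathbb{R}$ (diagonal left action) with the standard homogeneous differential. *)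

(* Defs.v *)
From HB Require Import structures.
From mathcomp Require Import all_boot all_order all_algebra finmap.
From mathcomp Require Import ring_quotient.
From mathcomp Require Import all_classical all_reals topology normedtype.
From mathcomp Require Import zify ring lra.
Import GRing.Theory numFieldNormedType.Exports.

Set Implicit Arguments.
Unset Strict Implicit.
Unset Printing Implicit Defensive.

Local Open Scope fset_scope.

Record regular_tree (d : nat) := RegularTree {
  vertex :> choiceType;
  adj : rel vertex;
  adj_sym : symmetric adj;
  adj_irr : irreflexive adj;
  tree_inhabited : inhabited vertex;
  tree_regular : forall x : vertex, exists N : {fset vertex},
    #|` N| = d.+1 /\ forall y, (y \in N) = adj x y;
  tree_connected : forall x y : vertex, exists2 p : seq vertex,
    path adj x p & last x p = y;
  (* adjacent x and y form a cycle [:: x; y] in the sense of [path.cycle] *)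
  tree_acyclic : forall c : seq vertex, ucycle adj c -> size c <= 2
}.
Arguments adj {d r}.

Section Subtrees.
Variables (d : nat) (T : regular_tree d).
Implicit Types (F H K S : {fset T}) (x y z : T).

Definition connected_in F x y := exists p : seq T,
  [/\ path adj x p, last x p = y & {subset p <= F}].

(* A subtree of T is determined by its vertex set. *)
Definition subtree F :=
  F != fset0 /\ {in F &, forall x y, connected_in F x y}.

Lemma connected_in_refl F x : connected_in F x x.
Proof. by exists [::]. Qed.

Lemma connected_in_trans F y x z :
  connected_in F x y -> connected_in F y z -> connected_in F x z.
Proof.
move=> [p [pp <- pF]] [q [pq <- qF]]; exists (p ++ q).
rewrite cat_path pp last_cat; split=> // u.
by rewrite mem_cat => /orP[/pF|/qF].
Qed.

Lemma connected_in_adj F x y : y \in F -> adj x y -> connected_in F x y.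
Proof.
move=> yF xy; exists [:: y]; rewrite /= andbT; split=> // u.
by rewrite inE => /eqP ->.
Qed.

Lemma connected_in_sub F H x y :
  {subset F <= H} -> connected_in F x y -> connected_in H x y.
Proof. by move=> FH [p [? ? pF]]; exists p; split=> // u /pF /FH. Qed.

Lemma connected_in_sym F x y :
  x \in F -> connected_in F x y -> connected_in F y x.
Proof.
move=> xF [p [pp <- pF]] {y}; elim: p x xF pp pF => [|y p IHp] x xF /=.
  by move=> _ _; exact: connected_in_refl.
move=> /andP[xy pp] pF.
have yF : y \in F by rewrite pF ?mem_head.
apply: (connected_in_trans (y := y)).
  by apply: IHp => // u up; rewrite pF // in_cons up orbT.
by apply: connected_in_adj => //; rewrite adj_sym.
Qed.

Lemma subtree_from F x : x \in F ->
  (forall y, y \in F -> connected_in F x y) -> subtree F.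
Proof.
move=> xF Fx; split; first by apply/fset0Pn; exists x.
move=> y z yF zF; apply: (connected_in_trans (y := x)); last exact: Fx.
by apply: connected_in_sym => //; exact: Fx.
Qed.

Lemma subtree1 x : subtree [fset x].
Proof.
apply: (@subtree_from _ x); first by rewrite inE.
by move=> y; rewrite inE => /eqP ->; exact: connected_in_refl.
Qed.

Lemma subtree_add_path F x (p : seq T) : subtree F -> x \in F ->
  path adj x p -> subtree (F `|` [fset y in p]).
Proof.
move=> [_ tF] xF pp; apply: (@subtree_from _ x); first by rewrite inE xF.
move=> y; rewrite inE => /orP[yF|].
  apply: connected_in_sub (tF x y xF yF) => u uF.
  by rewrite inE uF.
rewrite !inE => /= yp; case/splitPr: yp pp => p1 p2.
rewrite -cat_rcons cat_path => /andP[pp _].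
exists (rcons p1 y); split=> //; first by rewrite last_rcons.
by move=> u up; rewrite !inE up orbT.
Qed.

Lemma exists_hull S : exists H, subtree H /\ {subset S <= H}.
Proof.
have [r] := tree_inhabited T.
suff [H [tH rH SH]] : exists H, [/\ subtree H, r \in H & {subset S <= H}].
  by exists H.
suff: forall s : seq T,
    exists H, [/\ subtree H, r \in H & {subset s <= H}].
  by move=> /(_ S).
elim=> [|x s [H [tH rH sH]]].
  by exists [fset r]; split=> //; [exact: subtree1|rewrite inE].
have [p pp px] := tree_connected r x.
exists (r |` (H `|` [fset y in p])); split.
- have -> : r |` (H `|` [fset y in p]) = H `|` [fset y in p].
    by apply/fsetUidPr; rewrite fsub1set inE rH.
  exact: subtree_add_path pp.
- by rewrite !inE eqxx.
- move=> y; rewrite inE => /orP[/eqP ->|/sH yH]; last by rewrite !inE yH orbT.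
  by case: (lastP p) px => [<-|q z]; rewrite ?last_rcons ?inE ?eqxx //= => ->;
    rewrite mem_rcons !inE eqxx !orbT.
Qed.

Definition hull S : {fset T} := projT1 (cid (exists_hull S)).

Lemma hull_subtree S : subtree (hull S).
Proof. by rewrite /hull; case: cid => H []. Qed.

Lemma sub_hull S : {subset S <= hull S}.
Proof. by rewrite /hull; case: cid => H []. Qed.

Definition nbrs x : {fset T} := projT1 (cid (tree_regular x)).

Lemma card_nbrs x : #|` nbrs x| = d.+1.
Proof. by rewrite /nbrs; case: cid => N []. Qed.

Lemma in_nbrs x y : (y \in nbrs x) = adj x y.
Proof. by rewrite /nbrs; case: cid => N []. Qed.

End Subtrees.

Section AlmostAutomorphisms.
Variables (d : nat) (T : regular_tree d).

(* A forest isomorphism T \ F -> T \ F', given together with its inverse.  Both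
   maps are total on T; their values on F and F' are irrelevant. *)
Record forest_iso := ForestIso {
  fi_dom : {fset T};
  fi_cod : {fset T};
  fi_fun :> T -> T;
  fi_inv : T -> T;
  fi_domP : subtree fi_dom;
  fi_codP : subtree fi_cod;
  fi_funP : forall x, x \notin fi_dom -> fi_fun x \notin fi_cod;
  fi_invP : forall y, y \notin fi_cod -> fi_inv y \notin fi_dom;
  fi_funK : forall x, x \notin fi_dom -> fi_inv (fi_fun x) = x;
  fi_invK : forall y, y \notin fi_cod -> fi_fun (fi_inv y) = y;
  fi_adj : forall x y, x \notin fi_dom -> y \notin fi_dom ->
    adj (fi_fun x) (fi_fun y) = adj x y
}.

HB.instance Definition _ := gen_eqMixin forest_iso.
HB.instance Definition _ := gen_choiceMixin forest_iso.

Definition agree (f g : forest_iso) := exists F : {fset T},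
  [/\ subtree F, fi_dom f `<=` F, fi_dom g `<=` F &
      forall x, x \notin F -> f x = g x].

Lemma agree_fin (f g : forest_iso) (S : {fset T}) :
  (forall x, x \notin S -> f x = g x) -> agree f g.
Proof.
move=> fg; have := @sub_hull d T (S `|` (fi_dom f `|` fi_dom g)) => sub.
exists (hull (S `|` (fi_dom f `|` fi_dom g))); split.
- exact: hull_subtree.
- by apply/fsubsetP => x xf; apply: sub; rewrite !inE xf orbT.
- by apply/fsubsetP => x xf; apply: sub; rewrite !inE xf !orbT.
- by move=> x xS; apply: fg; apply: contra xS => xS; rewrite sub // inE xS.
Qed.

Lemma agree_refl f : agree f f.
Proof. exact: (@agree_fin _ _ fset0). Qed.

Lemma agree_sym f g : agree f g -> agree g f.
Proof.
by move=> [F [_ _ _ fg]]; apply: (@agree_fin _ _ F) => x /fg.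
Qed.

Lemma agree_trans g f h : agree f g -> agree g h -> agree f h.
Proof.
move=> [F [_ _ _ fg]] [F' [_ _ _ gh]]; apply: (@agree_fin _ _ (F `|` F')) => x.
by rewrite inE negb_or => /andP[/fg -> /gh].
Qed.

Definition agreeb (f g : forest_iso) : bool := `[< agree f g >].

Lemma agreeb_equiv : equiv_class_of agreeb.
Proof.
split=> [f|f g|g f h].
- by apply/asboolP; exact: agree_refl.
- by apply/asboolP/asboolP; exact: agree_sym.
- move=> /asboolP fg /asboolP gh; apply/asboolP; exact: agree_trans fg gh.
Qed.

Canonical agreeb_equivRel := EquivRelPack agreeb_equiv.

Local Open Scope quotient_scope.

Definition neretin := {eq_quot agreeb}.
HB.instance Definition _ : EqQuotient _ agreeb neretin :=
  EqQuotient.on neretin.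
HB.instance Definition _ := Choice.on neretin.

Lemma neretinP (f g : forest_iso) :
  \pi_neretin f = \pi_neretin g <-> agree f g.
Proof.
split=> [/eqP|fg]; first by rewrite piE => /asboolP.
by apply/eqP; rewrite piE; apply/asboolP.
Qed.

Lemma fi_adj_inv (f : forest_iso) x y : x \notin fi_cod f -> y \notin fi_cod f ->
  adj (fi_inv f x) (fi_inv f y) = adj x y.
Proof.
move=> xF yF; rewrite -(fi_adj (f := f)) ?fi_invP //.
by rewrite !fi_invK.
Qed.

Lemma fi_boundary (f : forest_iso) x y : x \notin fi_dom f -> y \in fi_dom f ->
  adj x y -> exists2 z, z \in fi_cod f & adj (f x) z.
Proof.
move=> xF yF xy; apply: contrapT => /forall2NP noz.
have Nout z : z \in nbrs (f x) -> z \notin fi_cod f.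
  by rewrite in_nbrs => fxz; apply/negP => zF; case: (noz z).
have sub : fi_inv f @` nbrs (f x) `<=` nbrs x `\ y.
  apply/fsubsetP => _ /imfsetP[/= z zN ->].
  have zF := Nout _ zN; rewrite !inE in_nbrs; apply/andP; split.
    by apply: contraTneq yF => <-; exact: fi_invP.
  rewrite -[X in adj X _](fi_funK xF) fi_adj_inv ?fi_funP //.
  by rewrite -in_nbrs.
have := fsubset_leq_card sub; rewrite card_in_imfset /=; last first.
  move=> u v /Nout uF /Nout vF uv.
  by rewrite -(fi_invK uF) -(fi_invK vF) uv.
have := cardfsD1 y (nbrs x); rewrite in_nbrs xy !card_nbrs add1n => -[<-].
by rewrite ltnn.
Qed.

Section Restrict.
Variables (f : forest_iso) (H : {fset T}).
Hypotheses (tH : subtree H) (fH : {subset fi_dom f <= H}).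

Definition restrict_cod : {fset T} := fi_cod f `|` f @` (H `\` fi_dom f).

Lemma restrict_codE x : x \notin fi_dom f ->
  (f x \in restrict_cod) = (x \in H).
Proof.
move=> xF; rewrite !inE (negPf (fi_funP xF)) /=; apply/imfsetP/idP => /=.
  move=> [y]; rewrite inE => /andP[yF yH] fxy.
  by rewrite -(fi_funK xF) fxy fi_funK.
by move=> xH; exists x => //; rewrite inE xF.
Qed.

Lemma restrict_cod_subtree : subtree restrict_cod.
Proof.
have [/fset0Pn[c cF] tF] := fi_codP f.
have [/fset0Pn[b bF] _] := fi_domP f.
have subF : {subset fi_cod f <= restrict_cod} by move=> z zF; rewrite inE zF.
apply: (@subtree_from _ _ _ c); first exact: subF.
move=> z; rewrite inE => /orP[zF|].
  by apply: connected_in_sub (tF c z cF zF).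
move=> /imfsetP[/= x]; rewrite inE => /andP[xF xH ->].
have [p [pp px pH]] := tH.2 x b xH (fH bF).
have fxK : f x \in restrict_cod by rewrite restrict_codE.
suff [u uF ux] : exists2 u, u \in fi_cod f & connected_in restrict_cod (f x) u.
  apply: (connected_in_trans (y := u)).
    by apply: connected_in_sub (tF c u cF uF).
  by apply: connected_in_sym.
elim: p x xF xH fxK pp px pH => [|y p IHp] x xF xH fxK /=.
  by move=> _ xb; rewrite xb bF in xF.
move=> /andP[xy pp] py ypH; have yH : y \in H by rewrite ypH ?mem_head.
have [yF|yF] := boolP (y \in fi_dom f).
  have [u uF fxu] := fi_boundary xF yF xy.
  by exists u => //; apply: connected_in_adj => //; exact: subF.
have fyK : f y \in restrict_cod by rewrite restrict_codE.
have [|u uF yu] := IHp y yF yH fyK pp py.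
  by move=> u up; rewrite ypH // in_cons up orbT.
exists u => //; apply: (connected_in_trans (y := f y)) yu.
by apply: connected_in_adj => //; rewrite fi_adj.
Qed.

Lemma notin_dom x : x \notin H -> x \notin fi_dom f.
Proof. by apply: contra => /fH. Qed.

Lemma notin_cod y : y \notin restrict_cod -> y \notin fi_cod f.
Proof. by apply: contra => yF; rewrite inE yF. Qed.

Lemma restrict_funP x : x \notin H -> f x \notin restrict_cod.
Proof. by move=> xH; rewrite restrict_codE // notin_dom. Qed.

Lemma restrict_invP y : y \notin restrict_cod -> fi_inv f y \notin H.
Proof.
move=> yK; have yF := notin_cod yK.
by rewrite -restrict_codE ?fi_invK // fi_invP.
Qed.

Definition restrict : forest_iso := @ForestIso H restrict_cod f (fi_inv f)
  tH restrict_cod_subtree restrict_funP restrict_invP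
  (fun x xH => fi_funK (notin_dom xH)) (fun y yK => fi_invK (notin_cod yK))
  (fun x y xH yH => fi_adj (notin_dom xH) (notin_dom yH)).

End Restrict.

Section Compose.
Variables g f : forest_iso.

(* T \ comp_dom is mapped by f onto T \ fi_cod comp_f, on which g is defined. *)
Definition comp_dom : {fset T} :=
  hull (fi_dom f `|` fi_inv f @` fi_dom g).

Lemma comp_dom_f : {subset fi_dom f <= comp_dom}.
Proof. by move=> x xF; apply: sub_hull; rewrite inE xF. Qed.

Definition comp_f : forest_iso := restrict (hull_subtree _) comp_dom_f.

Lemma comp_dom_g : {subset fi_dom g <= fi_cod comp_f}.
Proof.
move=> y yG; rewrite inE; have [//|yF /=] := boolP (y \in fi_cod f).
apply/imfsetP; exists (fi_inv f y) => /=; last by rewrite fi_invK.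
rewrite inE fi_invP //=; apply: sub_hull.
by rewrite inE in_imfset ?orbT.
Qed.

Definition comp_g : forest_iso := restrict (fi_codP comp_f) comp_dom_g.

Lemma comp_funP x :
  x \notin fi_dom comp_f -> comp_g (comp_f x) \notin fi_cod comp_g.
Proof. by move=> /(fi_funP (f := comp_f)) /(fi_funP (f := comp_g)). Qed.

Lemma comp_invP y : y \notin fi_cod comp_g ->
  fi_inv comp_f (fi_inv comp_g y) \notin fi_dom comp_f.
Proof. by move=> /(fi_invP (f := comp_g)) /(fi_invP (f := comp_f)). Qed.

Lemma comp_funK x : x \notin fi_dom comp_f ->
  fi_inv comp_f (fi_inv comp_g (comp_g (comp_f x))) = x.
Proof.
move=> xF; rewrite (fi_funK (f := comp_g)) ?(fi_funK (f := comp_f)) //.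
exact: (fi_funP (f := comp_f)).
Qed.

Lemma comp_invK y : y \notin fi_cod comp_g ->
  comp_g (comp_f (fi_inv comp_f (fi_inv comp_g y))) = y.
Proof.
move=> yF; rewrite (fi_invK (f := comp_f)) ?(fi_invK (f := comp_g)) //.
exact: (fi_invP (f := comp_g)).
Qed.

Lemma comp_adj x y : x \notin fi_dom comp_f -> y \notin fi_dom comp_f ->
  adj (comp_g (comp_f x)) (comp_g (comp_f y)) = adj x y.
Proof.
move=> xF yF; rewrite (fi_adj (f := comp_g)) ?(fi_adj (f := comp_f)) //;
  exact: (fi_funP (f := comp_f)).
Qed.

Definition fi_comp : forest_iso :=
  @ForestIso (fi_dom comp_f) (fi_cod comp_g) (comp_g \o comp_f)
    (fi_inv comp_f \o fi_inv comp_g) (fi_domP comp_f) (fi_codP comp_g)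
    comp_funP comp_invP comp_funK comp_invK comp_adj.

End Compose.

Definition fi_inverse (f : forest_iso) : forest_iso :=
  @ForestIso (fi_cod f) (fi_dom f) (fi_inv f) f (fi_codP f) (fi_domP f)
    (@fi_invP f) (@fi_funP f) (@fi_invK f) (@fi_funK f) (@fi_adj_inv f).

Lemma fi_compE (g f : forest_iso) x : fi_comp g f x = g (f x).
Proof. by []. Qed.

Lemma fi_comp_agree g g' f f' :
  agree g g' -> agree f f' -> agree (fi_comp g f) (fi_comp g' f').
Proof.
move=> [G [_ _ _ gg']] [F [_ _ _ ff']].
apply: (@agree_fin _ _ ((F `|` fi_dom f) `|` fi_inv f @` G)) => x.
rewrite !inE !negb_or -!andbA => /and3P[xF xf xG].
rewrite !fi_compE -(ff' _ xF); apply: gg'; apply: contra xG => fxG.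
by rewrite -(fi_funK xf) in_imfset.
Qed.

Lemma fi_inverse_agree f f' :
  agree f f' -> agree (fi_inverse f) (fi_inverse f').
Proof.
move=> [F [_ _ _ ff']].
apply: (@agree_fin _ _ (fi_cod f `|` f @` (F `|` fi_dom f'))) => y.
rewrite !inE negb_or => /andP[yf yF] /=.
have: fi_inv f y \notin F `|` fi_dom f'.
  by apply: contra yF => yF; rewrite -(fi_invK yf) in_imfset.
rewrite inE negb_or => /andP[yF1 yF2].
by rewrite -{2}(fi_invK yf) (ff' _ yF1) fi_funK.
Qed.

Record tree_aut := TreeAut {
  ta_fun :> T -> T;
  ta_inv : T -> T;
  ta_funK : cancel ta_fun ta_inv;
  ta_invK : cancel ta_inv ta_fun;
  ta_adj : {mono ta_fun : x y / adj x y}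
}.

HB.instance Definition _ := gen_eqMixin tree_aut.
HB.instance Definition _ := gen_choiceMixin tree_aut.

Lemma tree_autP (a b : tree_aut) : a =1 b -> a = b.
Proof.
case: a b => [a a' aK a'K aadj] [b b' bK b'K badj] /= ab.
have eab : a = b by apply/funext.
have eab' : a' = b' by apply/funext => x; rewrite -[x in LHS]b'K -ab aK.
subst b b'; congr TreeAut; exact: Prop_irrelevance.
Qed.

Definition ta_id : tree_aut :=
  @TreeAut idfun idfun (fun _ => erefl) (fun _ => erefl) (fun _ _ => erefl).

Section TreeAutGroup.
Variables a b : tree_aut.

Lemma ta_adj_inv : {mono ta_inv a : x y / adj x y}.
Proof. by move=> x y; rewrite -(ta_adj a) !ta_invK. Qed.

Definition ta_inverse : tree_aut :=
  @TreeAut (ta_inv a) a (@ta_invK a) (@ta_funK a) ta_adj_inv.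

Lemma ta_adj_comp : {mono a \o b : x y / adj x y}.
Proof. by move=> x y; rewrite /= !ta_adj. Qed.

Definition ta_comp : tree_aut :=
  @TreeAut (a \o b) (ta_inv b \o ta_inv a)
    (can_comp (@ta_funK a) (@ta_funK b)) (can_comp (@ta_invK b) (@ta_invK a))
    ta_adj_comp.

Variable F : {fset T}.
Hypothesis tF : subtree F.

Lemma ta_iso_cod_subtree : subtree (a @` F).
Proof.
have [/fset0Pn[c cF] cn] := tF.
apply: (@subtree_from _ _ _ (a c)); first by rewrite in_imfset.
move=> _ /imfsetP[/= y yF ->]; have [p [pp <- pF]] := cn c y cF yF.
exists (map a p); split.
- by rewrite path_map (eq_path (e' := adj)) // => x z; exact: ta_adj.
- by rewrite last_map.
- by move=> _ /mapP[x /pF xF ->]; rewrite in_imfset.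
Qed.

Lemma ta_iso_funP x : x \notin F -> a x \notin a @` F.
Proof.
apply: contra => /imfsetP[/= y yF axy].
by rewrite -(ta_funK a x) axy ta_funK.
Qed.

Lemma ta_iso_invP y : y \notin a @` F -> ta_inv a y \notin F.
Proof. by apply: contra => yF; rewrite -(ta_invK a y) in_imfset. Qed.

Definition ta_iso : forest_iso :=
  @ForestIso F (a @` F) a (ta_inv a) tF ta_iso_cod_subtree ta_iso_funP
    ta_iso_invP (fun x _ => ta_funK a x) (fun y _ => ta_invK a y)
    (fun x y _ _ => ta_adj a x y).

End TreeAutGroup.

Local Open Scope group_scope.

Lemma ta_compA : associative ta_comp.
Proof. by move=> a b c; apply: tree_autP. Qed.
Lemma ta_comp1g : left_id ta_id ta_comp.
Proof. by move=> a; apply: tree_autP. Qed.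
Lemma ta_compg1 : right_id ta_id ta_comp.
Proof. by move=> a; apply: tree_autP. Qed.
Lemma ta_compVg : left_inverse ta_id ta_inverse ta_comp.
Proof. by move=> a; apply: tree_autP => x /=; rewrite ta_funK. Qed.
Lemma ta_compgV : right_inverse ta_id ta_inverse ta_comp.
Proof. by move=> a; apply: tree_autP => x /=; rewrite ta_invK. Qed.

HB.instance Definition _ := isGroup.Build tree_aut
  ta_compA ta_comp1g ta_compg1 ta_compVg ta_compgV.

(* The deleted subtree is immaterial: all choices give agreeing isomorphisms. *)
Definition aut_incl (a : tree_aut) : neretin :=
  \pi_neretin (ta_iso a (hull_subtree fset0)).

Definition ner_one : neretin := aut_incl 1.
Definition ner_mul (g h : neretin) : neretin :=
  \pi_neretin (fi_comp (repr g) (repr h)).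
Definition ner_inv (g : neretin) : neretin := \pi_neretin (fi_inverse (repr g)).

Lemma agree_repr f : agree (repr (\pi_neretin f)) f.
Proof. by apply/neretinP; rewrite reprK. Qed.

Lemma ner_mul_pi f g :
  ner_mul (\pi_neretin f) (\pi_neretin g) = \pi_neretin (fi_comp f g).
Proof. by apply/neretinP; apply: fi_comp_agree; exact: agree_repr. Qed.

Lemma ner_inv_pi f : ner_inv (\pi_neretin f) = \pi_neretin (fi_inverse f).
Proof. by apply/neretinP; apply: fi_inverse_agree; exact: agree_repr. Qed.

Lemma neretinW (P : neretin -> Prop) :
  (forall f, P (\pi_neretin f)) -> forall g, P g.
Proof. by move=> Pf g; rewrite -[g]reprK. Qed.

Lemma ner_mulA : associative ner_mul.
Proof.
elim/neretinW=> f; elim/neretinW=> g; elim/neretinW=> h.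
rewrite !ner_mul_pi; apply/neretinP.
exact: (@agree_fin _ _ fset0).
Qed.

Lemma ner_mul1g : left_id ner_one ner_mul.
Proof.
elim/neretinW=> f; rewrite ner_mul_pi; apply/neretinP.
exact: (@agree_fin _ _ fset0).
Qed.

Lemma ner_mulg1 : right_id ner_one ner_mul.
Proof.
elim/neretinW=> f; rewrite ner_mul_pi; apply/neretinP.
exact: (@agree_fin _ _ fset0).
Qed.

Lemma ner_mulVg : left_inverse ner_one ner_inv ner_mul.
Proof.
elim/neretinW=> f; rewrite ner_inv_pi ner_mul_pi; apply/neretinP.
by apply: (@agree_fin _ _ (fi_dom f)) => x xF; rewrite fi_compE /= fi_funK.
Qed.

Lemma ner_mulgV : right_inverse ner_one ner_inv ner_mul.
Proof.
elim/neretinW=> f; rewrite ner_inv_pi ner_mul_pi; apply/neretinP.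
by apply: (@agree_fin _ _ (fi_cod f)) => x xF; rewrite fi_compE /= fi_invK.
Qed.

HB.instance Definition _ := isGroup.Build neretin
  ner_mulA ner_mul1g ner_mulg1 ner_mulVg ner_mulgV.

Lemma aut_inclM : {morph aut_incl : a b / a * b}.
Proof.
move=> a b; rewrite [RHS]ner_mul_pi; apply/neretinP.
exact: (@agree_fin _ _ fset0).
Qed.

HB.instance Definition _ := isUMagmaMorphism.Build tree_aut neretin aut_incl
  (erefl, aut_inclM).

End AlmostAutomorphisms.

Local Open Scope classical_set_scope.
Local Open Scope group_scope.

HB.structure Definition PreTopologicalGroup :=
  {G of Topological G & Group G}.

HB.mixin Record PreTopologicalGroup_isTopologicalGroup G
    of PreTopologicalGroup G := {
  mulg_continuous : continuous (fun x : G * G => x.1 * x.2);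
  invg_continuous : continuous (fun x : G => x^-1)
}.

#[short(type="topologicalGroupType")]
HB.structure Definition TopologicalGroup :=
  {G of PreTopologicalGroup G & PreTopologicalGroup_isTopologicalGroup G}.

Lemma cvg_ptws (I X : Type) (K : topologicalType) (F : set_system X)
    (f : X -> {ptws I -> K}) (h : {ptws I -> K}) : Filter F ->
  (forall i, (fun x => f x i) @ F --> h i) -> f @ F --> h.
Proof.
move=> FF fh; apply/cvg_sup => i A /=.
rewrite (@nbhsE (initial_topology (fun g : (I -> K) => g i))) => -[B [[C oC <-] Ch] CA].
by apply: filterS CA _; apply: fh; exact: open_nbhs_nbhs.
Qed.

Lemma mulgl_continuous (G : topologicalGroupType) (g : G) :
  continuous (fun x : G => g * x).
Proof.
move=> x; apply: (@continuous_comp _ _ _ (fun y : G => (g, y))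
  (fun x : G * G => x.1 * x.2)).
  by apply: cvg_pair => /=; [exact: cvg_cst|exact: cvg_id].
exact: mulg_continuous.
Qed.

Section Topology.
Variables (d : nat) (T : regular_tree d).
Notation Aut := (tree_aut T).
Notation N := (neretin T).
Implicit Types (S : {fset T}) (a b : Aut) (g h : N).

Definition aut_eval (a : Aut) : {ptws T -> discrete_topology T} := a.

HB.instance Definition _ := Topological.copy Aut (initial_topology aut_eval).

Definition eq_on S a b := {in S, a =1 b}.

Lemma aut_nbhsP a (W : set Aut) :
  nbhs a W <-> exists S, forall b, eq_on S b a -> W b.
Proof.
split.
  rewrite nbhsE => -[B [[A oA <-] Aa] AW].
  pose F : set_system Aut :=
    filter_from [set: {fset T}] (fun S => [set b | eq_on S b a]).
  have FF : Filter F.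
    apply: filter_from_filter; first by exists fset0.
    move=> S S' _ _; exists (S `|` S')%fset => // b bS.
    by split=> x xS; apply: bS; rewrite inE xS ?orbT.
  have : aut_eval @ F --> aut_eval a.
    apply: cvg_ptws => x; apply/discrete_cvg.
    by exists [fset x]%fset => // b; apply; rewrite inE.
  move=> /(_ A) [|S _ SA]; first exact: open_nbhs_nbhs.
  by exists S => b /SA /AW.
move=> [S SW].
have ev x : nbhs a [set b : Aut | b x = a x].
  have cx : continuous (fun b : Aut => b x : discrete_topology T).
    move=> b; apply: (@continuous_comp _ _ _ aut_eval (proj x)).
      exact: initial_continuous.
    exact: proj_continuous.
  by apply: (cx a [set a x]); exact: discrete_set1.
have : nbhs a (\bigcap_(x in [set` S]) [set b : Aut | b x = a x]).
  by apply: filter_bigI.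
by apply: filterS => b bS; apply: SW => x xS; exact: bS.
Qed.

Lemma aut_openP (W : set Aut) :
  open W <-> forall a, W a -> exists S, forall b, eq_on S b a -> W b.
Proof.
rewrite openE; split=> [oW a /oW /aut_nbhsP //|oW a /oW aW].
exact/aut_nbhsP.
Qed.

(* U is open if and only if so is the trace on Aut(T) of each of its left
   translates; see [neretin_topology_unique] below. *)
Definition ner_open (U : set N) :=
  forall g, open [set a : Aut | U (g * aut_incl a)].

Lemma ner_openT : ner_open setT.
Proof. by move=> g; exact: openT. Qed.

Lemma ner_openI : setI_closed ner_open.
Proof. by move=> U V oU oV g; exact: openI (oU g) (oV g). Qed.

Lemma ner_open_bigU (I : Type) (f : I -> set N) :
  (forall i, ner_open (f i)) -> ner_open (\bigcup_i f i).
Proof.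
move=> fo g; rewrite (_ : mkset _ =
  \bigcup_i [set a : Aut | f i (g * aut_incl a)]) //.
by apply: bigcup_open => i _; exact: fo.
Qed.

HB.instance Definition _ :=
  isOpenTopological.Build N ner_openT ner_openI ner_open_bigU.

Lemma ner_openE (U : set N) : open U = ner_open U.
Proof. by []. Qed.

Definition fixes S a := {in S, forall x, a x = x}.

Lemma fixes_open g S : open [set h | exists2 a, fixes S a & h = g * aut_incl a].
Proof.
rewrite ner_openE => h; apply/aut_openP => a [s sS hE]; exists S => b ba.
exists (s * (a^-1 * b)); last first.
  by rewrite !gmulfM /= gmulfV mulgA -hE !mulgA mulgK.
by move=> x xS; rewrite /= ba // ta_funK sS.
Qed.

Lemma ner_nbhsP g (U : set N) :
  nbhs g U <-> exists S, forall a, fixes S a -> U (g * aut_incl a).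
Proof.
rewrite nbhsE; split.
  move=> [V [oV Vg] VU].
  have /aut_openP/(_ 1) : open [set a | V (g * aut_incl a)] by exact: oV.
  rewrite /= gmulf1 mulg1 => /(_ Vg) [S SV].
  by exists S => a aS; apply: VU; apply: SV => x xS; rewrite aS.
move=> [S SU].
exists [set h | exists2 a, fixes S a & h = g * aut_incl a].
  split; first exact: fixes_open.
  by exists 1; rewrite ?gmulf1 ?mulg1.
by move=> _ [a aS ->]; exact: SU.
Qed.

Section Conjugation.
Variables (f : forest_iso T) (S : {fset T}).

Definition conj_support : {fset T} := (fi_cod f `|`
  f @` (S `|` [fset x in flatten [seq (nbrs y : seq T) | y <- fi_dom f]]))%fset.

Lemma conj_support_S x : x \in S -> f x \in conj_support.
Proof. by move=> xS; rewrite inE in_imfset ?orbT //= inE xS. Qed.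

Lemma conj_support_nbrs x y : x \in fi_dom f -> adj x y -> f y \in conj_support.
Proof.
move=> xF xy; rewrite inE in_imfset ?orbT //= !inE /=; apply/orP; right.
apply/flattenP; exists (nbrs x : seq T); last by rewrite in_nbrs.
by apply/mapP; exists x.
Qed.

Lemma conj_support_cod x : x \in fi_cod f -> x \in conj_support.
Proof. by move=> xF; rewrite inE xF. Qed.

Section Conj.
Variable a : Aut.
Hypothesis aS : fixes conj_support a.

Lemma conj_notin x : x \notin fi_cod f -> a x \notin fi_cod f.
Proof.
apply: contra => axF; rewrite -(ta_funK a x).
by rewrite -{1}(aS (conj_support_cod axF)) ta_funK.
Qed.

Definition conj_fun x := if x \in fi_dom f then x else fi_inv f (a (f x)).

Lemma conj_fun_dom x : (conj_fun x \in fi_dom f) = (x \in fi_dom f).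
Proof.
rewrite /conj_fun; have [->//|xF] := boolP (x \in fi_dom f).
by apply/negbTE; rewrite fi_invP // conj_notin // fi_funP.
Qed.

Lemma conj_funE x : x \notin fi_dom f -> f (conj_fun x) = a (f x).
Proof.
by move=> xF; rewrite /conj_fun (negbTE xF) fi_invK // conj_notin // fi_funP.
Qed.

Lemma conj_boundary x y : x \in fi_dom f -> y \notin fi_dom f ->
  adj x (conj_fun y) = adj x y.
Proof.
move=> xF yF; have zF : conj_fun y \notin fi_dom f by rewrite conj_fun_dom.
apply/idP/idP => xy.
  have /aS : f (conj_fun y) \in conj_support by exact: conj_support_nbrs xF xy.
  rewrite [in RHS]conj_funE // => /(can_inj (ta_funK a)) fzy.
  by rewrite -(fi_funK yF) -fzy fi_funK.
have fyS : f y \in conj_support by exact: conj_support_nbrs xF xy.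
by rewrite /conj_fun (negbTE yF) aS // fi_funK.
Qed.

Lemma conj_adj : {mono conj_fun : x y / adj x y}.
Proof.
move=> x y; have [xF|xF] := boolP (x \in fi_dom f).
  have xE : conj_fun x = x by rewrite /conj_fun xF.
  rewrite xE; have [yF|yF] := boolP (y \in fi_dom f).
    by rewrite /conj_fun yF.
  exact: conj_boundary.
have [yF|yF] := boolP (y \in fi_dom f).
  have yE : conj_fun y = y by rewrite /conj_fun yF.
  by rewrite yE adj_sym conj_boundary // adj_sym.
by rewrite -(@fi_adj _ _ f) ?conj_fun_dom // !conj_funE // ta_adj fi_adj.
Qed.

End Conj.

Lemma fixesV a : fixes conj_support a -> fixes conj_support a^-1.
Proof. by move=> aS x xS; rewrite -{1}(aS x xS) /= ta_funK. Qed.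

Lemma conj_funK a : fixes conj_support a ->
  cancel (conj_fun a) (conj_fun a^-1).
Proof.
move=> aS x; rewrite {1}/conj_fun conj_fun_dom //.
have [xF|xF] := boolP (x \in fi_dom f); first by rewrite /conj_fun xF.
by rewrite conj_funE //= ta_funK fi_funK.
Qed.

Lemma conj_invK a : fixes conj_support a ->
  cancel (conj_fun a^-1) (conj_fun a).
Proof. by move=> /fixesV /conj_funK; rewrite invgK. Qed.

Definition conj_aut a (aS : fixes conj_support a) : Aut :=
  TreeAut (conj_funK aS) (conj_invK aS) (conj_adj aS).

End Conjugation.

Lemma exists_conj g S : exists S', forall a, fixes S' a ->
  exists2 b, fixes S b & aut_incl a * g = g * aut_incl b.
Proof.
elim/neretinW: g => f; exists (conj_support f S) => a aS.
exists (conj_aut aS) => [x xS|].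
  rewrite /= /conj_fun; case: ifPn => // xF.
  by rewrite aS ?fi_funK //; exact: conj_support_S.
rewrite [LHS]ner_mul_pi [RHS]ner_mul_pi; apply/neretinP.
apply: (@agree_fin _ _ _ _ (fi_dom f)) => x xF.
by rewrite !fi_compE /= (conj_funE aS).
Qed.

Lemma ner_mul_continuous : continuous (fun x : N * N => x.1 * x.2).
Proof.
move=> [g h] U /ner_nbhsP [S SU].
have [S' S'E] := exists_conj h S.
exists ([set x | exists2 a, fixes S' a & x = g * aut_incl a],
        [set x | exists2 a, fixes S a & x = h * aut_incl a]).
  split=> /=; apply/ner_nbhsP; first by exists S' => a aS; exists a.
  by exists S => a aS; exists a.
move=> [_ _] /= [[a aS ->] [b bS ->]].
have [c cS E] := S'E a aS.
rewrite -mulgA (mulgA _ h) E -mulgA -gmulfM mulgA; apply: SU => x xS.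
by rewrite /= bS // cS.
Qed.

Lemma ner_inv_continuous : continuous (fun x : N => x^-1).
Proof.
move=> g U /ner_nbhsP [S SU]; have [S' S'E] := exists_conj g^-1 S.
apply/ner_nbhsP; exists S' => a aS /=.
have [|b bS E] := S'E a^-1; first by move=> x xS; rewrite -{1}(aS x xS) /= ta_funK.
by rewrite invgM -gmulfV E; exact: SU.
Qed.

HB.instance Definition _ := PreTopologicalGroup_isTopologicalGroup.Build N
  ner_mul_continuous ner_inv_continuous.

Lemma aut_incl_continuous : continuous (@aut_incl d T).
Proof.
apply/continuousP => U; rewrite ner_openE => /(_ 1); rewrite (_ : mkset _ = @aut_incl d T @^-1` U) //.
by apply/seteqP; split=> a /=; rewrite mul1g.
Qed.

Lemma aut_incl_open (W : set Aut) : open W -> open (@aut_incl d T @` W).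
Proof.
move=> /aut_openP oW; rewrite ner_openE => g; apply/aut_openP => a [c Wc cE].
have [S SW] := oW c Wc; exists S => b ba.
exists (c * (a^-1 * b)); first by apply: SW => x xS; rewrite /= ba // ta_funK.
by rewrite !gmulfM gmulfV /= cE -!mulgA mulVKg.
Qed.

(* The topology on N_d is the unique group topology for which the inclusion of
   Aut(T) is continuous and open. *)
Lemma neretin_topology_unique (M : topologicalGroupType) (i : N -> M)
    (iM : {morph i : g h / g * h}) (i_bij : bijective i)
    (i_cont : continuous (i \o @aut_incl d T))
    (i_open : forall W, open W -> open ((i \o @aut_incl d T) @` W))
    (U : set M) : open U <-> open (i @^-1` U).
Proof.
split=> oU.
  rewrite ner_openE => g; rewrite (_ : mkset _ =
    (fun a => i g * (i \o @aut_incl d T) a) @^-1` U); last first.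
    by apply/seteqP; split=> a /=; rewrite iM.
  apply: open_comp oU => a _.
  by apply: continuous_comp; [exact: i_cont|exact: mulgl_continuous].
have [j iK jK] := i_bij.
rewrite openE => u Uu; pose W := [set a : Aut | U (u * i (aut_incl a))].
have oW : open W.
  move: oU; rewrite ner_openE => /(_ (j u)); rewrite (_ : mkset _ = W) //.
  by apply/seteqP; split=> a /=; rewrite iM jK.
have i1 : i 1 = 1 by apply: (mulgI (i 1)); rewrite -iM !mulg1.
have W1 : W 1 by rewrite /W /= gmulf1 i1 mulg1.
apply: (@filterS _ _ _ ((fun x => u^-1 * x) @^-1` ((i \o @aut_incl d T) @` W))).
  move=> x [a Wa xE]; rewrite -[x](mulVKg u) -xE; exact: Wa.
apply: open_nbhs_nbhs; split.
  by apply: open_comp (i_open _ oW) => x _; exact: mulgl_continuous.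
by exists 1 => //=; rewrite gmulf1 i1 mulVg.
Qed.

End Topology.

Section ContinuousCohomology.
Local Open Scope ring_scope.
Variables (G : topologicalGroupType) (R : realType).

Definition gtuple (n : nat) := {ptws 'I_n.+1 -> G}.

Definition gact n (g : G) (x : gtuple n) : gtuple n := fun i => (g * x i)%g.

Definition face n (j : 'I_n.+2) (x : gtuple n.+1) : gtuple n :=
  fun i => x (lift j i).

Definition is_cochain n : {pred (gtuple n -> R)} :=
  fun f => `[< continuous f /\ forall g x, f (gact g x) = f x >].

Lemma is_cochainP n (f : gtuple n -> R) : reflect
  (continuous f /\ forall g x, f (gact g x) = f x) (f \in @is_cochain n).
Proof. exact: asboolP. Qed.

Lemma is_cochain_zmod n : zmod_closed (@is_cochain n).
Proof.
split; first by apply/is_cochainP; split=> //; exact: (@cst_continuous _ R 0).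
move=> f h /is_cochainP[fc fi] /is_cochainP[hc hi]; apply/is_cochainP; split.
  by move=> x; apply: continuousB; [exact: fc|exact: hc].
by move=> g x; rewrite !fctE fi hi.
Qed.

HB.instance Definition _ n :=
  GRing.isZmodClosed.Build (gtuple n -> R) (@is_cochain n) (@is_cochain_zmod n).

Record cochain n := Cochain {
  cochain_fun :> gtuple n -> R;
  cochainP : cochain_fun \in @is_cochain n
}.

HB.instance Definition _ n := [isSub for @cochain_fun n].
HB.instance Definition _ n := [Choice of cochain n by <:].
HB.instance Definition _ n := [SubChoice_isSubZmodule of cochain n by <:].

Lemma face_continuous n (j : 'I_n.+2) : continuous (face j).
Proof.
move=> x; have Fx : Filter (nbhs x) := nbhs_filter x; apply: cvg_ptws => i.
exact: (@proj_continuous _ (fun _ : 'I_n.+2 => G)).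
Qed.

Definition diff_fun n (f : gtuple n -> R) : gtuple n.+1 -> R :=
  fun x => \sum_(j < n.+2) (-1) ^+ j * f (face j x).

Lemma mull_continuous (X : topologicalType) (c : R) (h : X -> R) :
  continuous h -> continuous (fun x => c * h x).
Proof. by move=> hc x; apply: cvgM; [exact: cvg_cst|exact: hc]. Qed.

Lemma diff_cochain n (f : cochain n) : diff_fun f \in @is_cochain n.+1.
Proof.
case: f => f /= /is_cochainP[fc fi]; apply/is_cochainP; split=> [|g x].
  apply: (continuous_big (op := +%R)) => [|j _]; first exact: add_continuous.
  apply: (@mull_continuous (gtuple n.+1)) => x.
  by apply: continuous_comp; [exact: face_continuous|exact: fc].
by apply: eq_bigr => j _; rewrite -(fi g (face j x)).
Qed.

Definition diff n (f : cochain n) : cochain n.+1 := Cochain (diff_cochain f).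

Lemma cochain_eq n (f h : cochain n) : (forall x, f x = h x) -> f = h.
Proof. by move=> fh; apply/val_inj/funext. Qed.

Lemma diff_zmod n : zmod_morphism (@diff n).
Proof.
move=> f h; apply: cochain_eq => x /=.
rewrite !fctE /= /diff_fun -sumrB; apply: eq_bigr => j _.
by rewrite -mulrBr.
Qed.

HB.instance Definition _ n :=
  GRing.isZmodMorphism.Build (cochain n) (cochain n.+1) (@diff n) (@diff_zmod n).

Definition face_swap n (p : 'I_n.+3 * 'I_n.+2) : 'I_n.+3 * 'I_n.+2 :=
  if (p.2 < p.1)%N then (inord p.2, inord p.1.-1) else (inord p.2.+1, inord p.1).

Lemma face_swap_lt n (p : 'I_n.+3 * 'I_n.+2) : (p.2 < p.1)%N ->
  ((face_swap p).1 = p.2 :> nat) * ((face_swap p).2 = p.1.-1 :> nat).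
Proof.
case: p => [[j jn] [k kn]] /= kj; rewrite /face_swap /= kj /=.
by rewrite !inordK //; lia.
Qed.

Lemma face_swap_ge n (p : 'I_n.+3 * 'I_n.+2) : (p.1 <= p.2)%N ->
  ((face_swap p).1 = p.2.+1 :> nat) * ((face_swap p).2 = p.1 :> nat).
Proof.
case: p => [[j jn] [k kn]] /= jk; rewrite /face_swap /= ltnNge jk /=.
by rewrite !inordK //; lia.
Qed.

Lemma face_swapK n : involutive (@face_swap n).
Proof.
move=> p; have [kj|jk] := ltnP p.2 p.1.
  have [e1 e2] := face_swap_lt kj.
  have [|f1 f2] := @face_swap_ge _ (face_swap p); first by rewrite e1 e2; lia.
  by apply/pair_eqP/andP; split; apply/eqP/val_inj; rewrite /= ?f1 ?f2 ?e1 ?e2; lia.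
have [e1 e2] := face_swap_ge jk.
have [|f1 f2] := @face_swap_lt _ (face_swap p); first by rewrite e1 e2; lia.
by apply/pair_eqP/andP; split; apply/eqP/val_inj; rewrite /= ?f1 ?f2 ?e1 ?e2; lia.
Qed.

Lemma face_face n (p : 'I_n.+3 * 'I_n.+2) (x : gtuple n.+2) :
  face (face_swap p).2 (face (face_swap p).1 x) = face p.2 (face p.1 x).
Proof.
apply/funext => i; rewrite /face; congr (x _); apply/val_inj => /=.
by have [kj|jk] := ltnP p.2 p.1; [rewrite !(face_swap_lt kj)|
  rewrite !(face_swap_ge jk)]; rewrite /bump; lia.
Qed.

Lemma diff_diff n (f : cochain n) : diff (diff f) = 0.
Proof.
apply: cochain_eq => x /=; rewrite {1}/diff_fun.
under eq_bigr => j _ do rewrite /= /diff_fun mulr_sumr.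
rewrite pair_bigA /=; set S := \sum_p _.
suff : S = - S by move=> SN; change (S = 0); lra.
rewrite /S {1}(reindex_inj (inv_inj (@face_swapK n))) /= -sumrN.
apply: eq_bigr => p _; rewrite face_face !mulrA -mulNr; congr (_ * _).
rewrite -!exprD; have sgn (a b : nat) : odd a = ~~ odd b ->
    (-1) ^+ a = - (-1) ^+ b :> R.
  by move=> ab; rewrite -(signr_odd _ a) ab signrN signr_odd.
apply: sgn; have [kj|jk] := ltnP p.2 p.1.
  by rewrite !(face_swap_lt kj); lia.
by rewrite !(face_swap_ge jk); lia.
Qed.

Definition is_cocycle n : {pred (cochain n)} := fun f => diff f == 0.

Lemma is_cocycle_zmod n : zmod_closed (@is_cocycle n).
Proof.
split; first by rewrite unfold_in raddf0.
by move=> f h /eqP df /eqP dh; rewrite unfold_in raddfB /= df dh subr0.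
Qed.

HB.instance Definition _ n :=
  GRing.isZmodClosed.Build (cochain n) (@is_cocycle n) (@is_cocycle_zmod n).

Record cocycle n := Cocycle {
  cocycle_cochain :> cochain n;
  cocycleP : cocycle_cochain \in @is_cocycle n
}.

HB.instance Definition _ n := [isSub for @cocycle_cochain n].
HB.instance Definition _ n := [Choice of cocycle n by <:].
HB.instance Definition _ n := [SubChoice_isSubZmodule of cocycle n by <:].

Definition is_coboundary n : {pred (cocycle n)} :=
  match n with
  | 0 => fun z => z == 0
  | m.+1 => fun z => `[< exists h : cochain m, diff h = z >]
  end.

Lemma is_coboundary_zmod n : zmod_closed (@is_coboundary n).
Proof.
case: n => [|n]; split; rewrite ?unfold_in //=.
- by move=> x y /eqP -> /eqP ->; rewrite unfold_in subr0.
- by apply/asboolP; exists 0; rewrite raddf0.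
- move=> x y /asboolP[h hx] /asboolP[k ky]; apply/asboolP.
  by exists (h - k); rewrite raddfB /= hx ky.
Qed.

HB.instance Definition _ n := GRing.isZmodClosed.Build (cocycle n)
  (@is_coboundary n) (@is_coboundary_zmod n).

Definition continuous_cohomology n : zmodType :=
  Quotient.quot (@is_coboundary n).

Definition cohomology_class n (z : cocycle n) : continuous_cohomology n :=
  (\pi_(Quotient.quot (@is_coboundary n)) z)%qT.

Lemma cohomology_class_surj n (c : continuous_cohomology n) :
  exists z, c = cohomology_class z.
Proof. by exists (repr c); rewrite /cohomology_class reprK. Qed.

Lemma cohomology_class_eq0 n (z : cocycle n) :
  (cohomology_class z == 0) = (z \in @is_coboundary n).
Proof.
rewrite -[z in RHS]subr0 Quotient.idealrBE.
by congr (_ == _); rewrite [RHS]pi_zeror.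
Qed.

End ContinuousCohomology.

(* Main.v *)
Require Import Defs.
From HB Require Import structures.
From mathcomp Require Import all_boot all_order all_algebra finmap.
From mathcomp Require Import all_classical all_reals topology normedtype.
From mathcomp Require Import zify lra.
Import Order.TTheory GRing.Theory Num.Theory numFieldNormedType.Exports.

(** Let [G] be Neretin's group. It acts on partitions of the boundary of the tree
    into balls: the images [std h F] under almost automorphisms [h] of the partition
    into the ends of the trees left after deleting a finite subtree [F]. Replacing a
    ball by its [d] children is a subdivision ([subdivide]), and subdividing the
    balls of a subset independently gives the cubes of a cube complex on which [G]
    acts ([cube]). Three facts make the continuous cohomology of [G] vanish.

    - The complex is contractible ([exact_cube], [connected_cube]). Partitions are
      pushed up, by subdividing balls which are not balls of the tree itself; this
      ends by [exists_tame], in partitions given by finite subtrees by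
      [std_of_good]. These are pushed down by removing leaves of the subtree. Both
      pushes are instances of [descent], which solves the coboundary equation by
      recursion along a discrete flow.

    - Stabilizers of cubes are compact and open, so averaging makes the usual
      contraction of homogeneous cochains equivariant ([column_exact]). The averages
      rest on an invariant mean for compact groups having arbitrarily small open
      subgroups ([invariant_mean]), and on the identification of the pointwise
      stabilizer of a partition with a compact group of automorphisms of the tree
      ([fix_balls], [fixes_compact]).

    - Any bijection between two partitions is induced by an element of [G]
      ([act_transitive]). Hence the real cochains of the quotient of the complex by
      [G] are those of a half-line: alternating invariant cochains vanish in
      dimensions at least two, since two directions of a cube can be exchanged, and
      partitions and edges are classified by their number of balls
      ([invcochain_exact]).

    The bicomplex of equivariant functions on [p]-cubes with values in continuous
    functions of [q.+1] group elements has exact rows by the first fact and exact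
    columns by the second. So it compares the continuous cohomology of [G] with the
    cohomology of the half-line, which vanishes in positive degrees ([staircase]). *)

Set Implicit Arguments.
Unset Strict Implicit.
Unset Printing Implicit Defensive.

Local Open Scope fset_scope.
Local Open Scope nat_scope.

(** * The tree rooted at a vertex *)
Section RootedTree.
Variables (d : nat) (T : regular_tree d) (v0 : T).
Implicit Types (x y z l : T) (F H J : {fset T}).

Lemma exists_dist x : exists n, `[< exists p, [/\ path adj x p, last x p = v0 & size p = n] >].
Proof.
have [p pp px] := tree_connected x v0.
by exists (size p); apply/asboolP; exists p.
Qed.

Definition depth x : nat := ex_minn (exists_dist x).

Lemma depthP x : exists p, [/\ path adj x p, last x p = v0 & size p = depth x].
Proof. by rewrite /depth; case: ex_minnP => m /asboolP. Qed.

Lemma depth_min x p : path adj x p -> last x p = v0 -> depth x <= size p.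
Proof.
rewrite /depth => pp pl; case: ex_minnP => m _ -> //.
by apply/asboolP; exists p.
Qed.

Lemma depth_eq0 x : (depth x == 0) = (x == v0).
Proof.
apply/eqP/eqP => [x0|->]; last by apply/eqP; rewrite -leqn0; exact: (@depth_min _ [::]).
by have [p [_ <- sp]] := depthP x; rewrite x0 in sp; rewrite (size0nil sp).
Qed.

Lemma depth_adj x y : adj x y -> depth x <= (depth y).+1.
Proof.
move=> xy; have [p [pp pl <-]] := depthP y.
by apply: (@depth_min x (y :: p)); rewrite //= xy.
Qed.

(** Two such neighbours could be joined through shortest paths to the root,
    which avoid [x]; together with [x] that would close a cycle. *)
Lemma upper_nbr_unique x y z : adj x y -> adj x z ->
  depth y <= depth x -> depth z <= depth x -> y = z.
Proof.
move=> xy xz yx zx; apply: contrapT => yz.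
(* The later vertices of a shortest path are closer to the root than [x]. *)
have avoid w : adj x w -> depth w <= depth x ->
    exists2 p, path adj w p & last w p = v0 /\ x \notin w :: p.
  move=> xw wx; have [p [pp pl sp]] := depthP w; exists p => //; split=> //.
  rewrite inE negb_or; apply/andP; split.
    by apply: contraTneq xw => ->; rewrite adj_irr.
  apply/negP => /splitPr xp; case: xp pp pl sp => p1 p2.
  rewrite cat_path last_cat size_cat /= => /and3P[_ _ p2p] p2l sp.
  have := depth_min p2p p2l; lia.
have [p pp [pl xp]] := avoid y xy yx.
have [q qp [ql xq]] := avoid z xz zx.
pose r := rev (belast z q).
have rp : path adj v0 r.
  rewrite -ql rev_path; rewrite (eq_path (e' := adj)) // => u v.
  by rewrite adj_sym.
have rl : last v0 r = z.
  by rewrite /r -ql; case: (q) => //= u q'; rewrite rev_cons last_rcons.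
have wp : path adj y (p ++ r) by rewrite cat_path pp pl.
have wl : last y (p ++ r) = z by rewrite last_cat pl.
have wx : x \notin y :: p ++ r.
  rewrite -cat_cons mem_cat negb_or xp mem_rev.
  by apply: contra xq; exact: mem_belast.
move: wl; case: (shortenP wp) => w' w'p w'u w'sub w'l.
have wx' : x \notin y :: w'.
  by apply: contra wx; rewrite !inE => /orP[->|/w'sub ->] //; rewrite orbT.
have := @tree_acyclic d T (x :: y :: w'); rewrite /ucycle /= rcons_path xy w'p.
have w'0 : w' != [::] by apply/eqP => w'0; apply: yz; rewrite -w'l w'0.
rewrite w'l adj_sym xz wx' /=; move: w'u => /= ->.
by case: (w') w'0 => // ? ? _ /(_ isT).
Qed.

(** At the root the list is empty, so the root is its own parent. *)
Definition par x : T := head x [seq y <- nbrs x | depth y < depth x].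

Definition ch x : seq T := [seq y <- nbrs x | depth x < depth y].

Lemma par_spec x : x != v0 -> adj x (par x) /\ depth x = (depth (par x)).+1.
Proof.
move=> xv; have [[|y p] [/= pp pl sp]] := depthP x; first by rewrite pl eqxx in xv.
case/andP: pp => xy pp; have yp := depth_min pp pl.
have yx : depth y < depth x by rewrite -sp ltnS.
have : y \in [seq y <- nbrs x | depth y < depth x].
  by rewrite mem_filter yx in_nbrs.
rewrite /par => yin.
have : head x [seq y <- nbrs x | depth y < depth x]
    \in [seq y <- nbrs x | depth y < depth x].
  by case: [seq y <- _ | _] yin => //= u s _; rewrite mem_head.
rewrite mem_filter in_nbrs => /andP[dx ax]; split=> //.
by apply/eqP; rewrite eqn_leq dx depth_adj.
Qed.

Lemma adj_par x : x != v0 -> adj x (par x).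
Proof. by case/par_spec. Qed.

Lemma depth_par x : x != v0 -> depth x = (depth (par x)).+1.
Proof. by case/par_spec. Qed.

Lemma depth_v0 : depth v0 = 0.
Proof. by apply/eqP; rewrite depth_eq0. Qed.

Lemma par_v0 : par v0 = v0.
Proof.
rewrite /par depth_v0 (eq_filter (a2 := pred0)) ?filter_pred0 // => y.
Qed.

Lemma par_upper x y : x != v0 -> adj x y -> depth y <= depth x -> par x = y.
Proof.
move=> xv xy yx; apply: (upper_nbr_unique (x := x)) => //; first exact: adj_par.
by rewrite [depth x]depth_par.
Qed.

Lemma adjE x y :
  adj x y = (x != v0) && (par x == y) || (y != v0) && (par y == x).
Proof.
apply/idP/orP => [xy|[]/andP[xv /eqP <-]]; last 2 first.
- exact: adj_par.
- by rewrite adj_sym adj_par.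
have [yx|xlt] := leqP (depth y) (depth x).
  have [xv|xv] := eqVneq x v0; last by left; apply/eqP; exact: par_upper.
  move: yx xy; rewrite xv depth_v0 leqn0 depth_eq0 => /eqP ->.
  by rewrite adj_irr.
have yv : y != v0 by rewrite -depth_eq0 -lt0n (leq_ltn_trans _ xlt).
by right; rewrite yv; apply/eqP; apply: par_upper; rewrite 1?adj_sym // ltnW.
Qed.

Lemma in_ch x y : (y \in ch x) = (y != v0) && (par y == x).
Proof.
rewrite mem_filter in_nbrs adjE; apply/andP/idP => [[xy /orP[|//]]|].
  by move=> /andP[xv /eqP yx]; move: xy; rewrite (depth_par xv) yx; lia.
move=> /[dup] /andP[yv /eqP yx] ->; rewrite orbT; split=> //.
by rewrite (depth_par yv) yx.
Qed.

Lemma ch_uniq x : uniq (ch x).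
Proof. by rewrite filter_uniq ?fset_uniq. Qed.

Lemma par_ch x y : y \in ch x -> par y = x.
Proof. by rewrite in_ch => /andP[_ /eqP]. Qed.

Lemma mem_ch_par x : x != v0 -> x \in ch (par x).
Proof. by rewrite in_ch eqxx andbT. Qed.

Lemma ch_neq0 x y : y \in ch x -> y != v0.
Proof. by rewrite in_ch => /andP[]. Qed.

Lemma depth_ch x y : y \in ch x -> depth y = (depth x).+1.
Proof. by rewrite in_ch => /andP[/depth_par -> /eqP ->]. Qed.

Lemma ch_irr x : x \notin ch x.
Proof. by apply/negP => /depth_ch; lia. Qed.

Lemma size_ch x : x != v0 -> size (ch x) = d.
Proof.
move=> xv; have : perm_eq (nbrs x) (par x :: ch x).
  apply: uniq_perm; first exact: fset_uniq.
    rewrite /= ch_uniq andbT in_ch negb_and -implybE; apply/implyP => pv.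
    by apply/eqP => /(congr1 depth); rewrite (depth_par xv) (depth_par pv); lia.
  by move=> y; rewrite in_nbrs adjE xv /= inE in_ch [par x == y]eq_sym.
by move=> /perm_size; rewrite card_nbrs /= => -[].
Qed.

Lemma tree_ind (Q : T -> Prop) : Q v0 ->
  (forall x, x != v0 -> Q (par x) -> Q x) -> forall x, Q x.
Proof.
move=> Q0 Qp x; move: {2}(depth x) (erefl (depth x)) => n.
elim: n x => [|n IH] x xn.
  by move/eqP: xn; rewrite depth_eq0 => /eqP ->.
have xv : x != v0 by rewrite -depth_eq0 xn.
by apply: Qp => //; apply: IH; move: xn; rewrite (depth_par xv) => -[].
Qed.

(** ** Branches *)

Definition desc l x := exists n, iter n par x = l.

Lemma desc_refl l : desc l l. Proof. by exists 0. Qed.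

Lemma desc_par l x : desc l (par x) -> desc l x.
Proof. by case=> n <-; exists n.+1; rewrite iterSr. Qed.

Lemma desc_par_neq l x : desc l x -> x <> l -> desc l (par x).
Proof. by case=> [[|n]] //= xl _; exists n; rewrite -iterSr. Qed.

Lemma desc_trans y x z : desc x y -> desc y z -> desc x z.
Proof. by move=> [n <-] [m <-]; exists (n + m); rewrite iterD. Qed.

Lemma desc_ch x y : y \in ch x -> desc x y.
Proof. by move=> /par_ch <-; exists 1. Qed.

Lemma iter_par_v0 n : iter n par v0 = v0.
Proof. by elim: n => //= n ->; rewrite par_v0. Qed.

Lemma desc_neq0 l x : l != v0 -> desc l x -> x != v0.
Proof. by move=> lv [n xl]; apply: contraNneq lv => xv; rewrite -xl xv iter_par_v0. Qed.

Lemma desc_ind l (Q : T -> Prop) : Q l ->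
  (forall x, desc l (par x) -> x != v0 -> x <> l -> Q (par x) -> Q x) ->
  forall x, desc l x -> Q x.
Proof.
move=> Ql Qp; elim/tree_ind => [[n]|x xv IH lx].
  by rewrite iter_par_v0 => ->.
have [->//|/eqP xl] := eqVneq x l.
by have lp := desc_par_neq lx xl; apply: Qp => //; exact: IH.
Qed.

Lemma depth_desc l x : desc l x -> depth l <= depth x.
Proof.
move: x; apply: desc_ind => // x _ xv _ IH.
by rewrite (depth_par xv) leqW.
Qed.

Lemma desc_anti l x : desc l x -> desc x l -> l = x.
Proof.
move=> lx xl; apply: contrapT => /eqP; rewrite eq_sym => /eqP nlx.
have [xv|xv] := eqVneq x v0.
  by case: lx nlx => n; rewrite xv iter_par_v0.
have := depth_desc (desc_par_neq lx nlx); have := depth_desc xl.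
by rewrite (depth_par xv); lia.
Qed.

Lemma desc_total l l' x : desc l x -> desc l' x -> desc l l' \/ desc l' l.
Proof.
move=> [n <-] [m <-]; case: (leqP n m) => [|/ltnW] nm.
  by right; exists (m - n); rewrite -iterD subnK.
by left; exists (n - m); rewrite -iterD subnK.
Qed.

Lemma desc_deep l n : 0 < d -> l != v0 -> exists2 x, desc l x & depth x = depth l + n.
Proof.
move=> d0 lv; elim: n => [|n [x lx xd]].
  by exists l; [exact: desc_refl|rewrite addn0].
have := size_ch (desc_neq0 lv lx).
case E : (ch x) => [|y s] /=; first by lia.
have yx : y \in ch x by rewrite E mem_head.
exists y; first exact: desc_trans lx (desc_ch yx).
by rewrite (depth_ch yx) xd addnS.
Qed.

(** Branches are infinite: what holds almost everywhere holds somewhere on each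
    of them. *)
Lemma desc_notin (S : {fset T}) l : 0 < d -> l != v0 ->
  exists2 x, desc l x & x \notin S.
Proof.
move=> d0 lv; have [x lx xd] := desc_deep (\sum_(y <- S) depth y).+1 d0 lv.
exists x => //; apply/negP => xS; move: xd.
by rewrite (big_fsetD1 x xS) /=; lia.
Qed.

(** ** Rooted subtrees *)

(** These are the finite subtrees containing the root. *)
Definition ideal F := v0 \in F /\ {in F, forall x, par x \in F}.

Lemma ideal_subtree F : ideal F -> subtree F.
Proof.
move=> [vF Fp]; apply: (@subtree_from _ _ _ v0) => // y.
elim/tree_ind: y => [_|y yv IH yF]; first exact: connected_in_refl.
apply: (connected_in_trans (IH (Fp _ yF))).
by apply: connected_in_adj => //; rewrite adj_sym adj_par.
Qed.

(** A path from [x] to the root must leave the branch below [x], and the only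
    edge doing so joins [x] to its parent. *)
Lemma subtree_ideal F : subtree F -> v0 \in F -> ideal F.
Proof.
move=> [_ cF] vF; split=> // x xF.
have [->|xv] := eqVneq x v0; first by rewrite par_v0.
have [p [pp pl pF]] := cF x v0 xF vF.
have nv : ~ desc x v0.
  by case=> n; rewrite iter_par_v0 => xE; rewrite xE eqxx in xv.
rewrite -pl in nv.
suff H : forall y, desc x y -> path adj y p -> ~ desc x (last y p) -> par x \in F.
  exact: (H x (desc_refl x)).
elim: p pF {pp pl nv} => [|z p IHp] pF y xy //= /andP[yz zp] nv.
have zF : z \in F by rewrite pF ?mem_head.
have [xz|xz] := pselect (desc x z).
  by apply: IHp zp nv => // u up; rewrite pF // in_cons up orbT.
move: yz; rewrite adjE => /orP[]/andP[_ /eqP pE]; last first.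
  by case: xz; apply: desc_par; rewrite pE.
suff yx : y = x by rewrite -yx pE.
by apply: contrapT => yx; apply: xz; rewrite -pE; exact: desc_par_neq.
Qed.

Lemma ideal1 : ideal [fset v0].
Proof. by split=> [|x]; rewrite ?inE // => /eqP ->; rewrite par_v0. Qed.

Lemma ideal_desc F l x : ideal F -> desc l x -> l \notin F -> x \notin F.
Proof.
move=> [_ Fp] [n <-]; elim: n => //= n IH; move=> /negP lF; apply: IH.
by apply/negP => /Fp.
Qed.

(** The roots of the trees of the forest left after deleting [F]. *)
Definition bd F : {fset T} := [fset y in flatten [seq ch x | x <- F]] `\` F.

Lemma in_bd F y : ideal F -> (y \in bd F) = (y \notin F) && (par y \in F).
Proof.
move=> iF; rewrite !inE; case yF : (y \in F) => //=.
have yv : y != v0 by apply: contraFneq yF => ->; case: iF.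
apply/flattenP/idP => [[s /mapP[x xF ->] /par_ch ->]//|pF].
by exists (ch (par y)); [exact: map_f|exact: mem_ch_par].
Qed.

Lemma bd_neq0 F y : ideal F -> y \in bd F -> y != v0.
Proof. by move=> iF; rewrite in_bd // => /andP[yF _]; apply: contraNneq yF => ->; case: iF. Qed.

Lemma bd_notin F y : y \in bd F -> y \notin F.
Proof. by rewrite inE => /andP[]. Qed.

Lemma exists_bd F x : ideal F -> x \notin F -> exists2 l, l \in bd F & desc l x.
Proof.
move=> iF; elim/tree_ind: x => [|x xv IH xF]; first by case: iF => ->.
have [pF|/IH[l lF lp]] := boolP (par x \in F).
  by exists x; [rewrite in_bd // xF|exact: desc_refl].
by exists l => //; exact: desc_par.
Qed.

Lemma bd_unique F l l' x : ideal F -> l \in bd F -> l' \in bd F ->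
  desc l x -> desc l' x -> l = l'.
Proof.
move=> iF; have H k k' : k \in bd F -> k' \in bd F -> desc k k' -> k = k'.
  rewrite !in_bd // => /andP[kF kp] /andP[k'F k'p] kk'.
  apply: contrapT => /eqP; rewrite eq_sym => /eqP nkk'.
  by have := ideal_desc iF (desc_par_neq kk' nkk') kF; rewrite k'p.
by move=> lF l'F lx l'x; case: (desc_total lx l'x) => /H ->.
Qed.

Lemma bd_inj F F' : ideal F -> ideal F' -> bd F = bd F' -> F = F'.
Proof.
suff H G G' : ideal G -> ideal G' -> bd G = bd G' -> {subset G <= G'}.
  by move=> iF iF' E; apply/fsetP => x; apply/idP/idP; apply: H.
move=> iG iG' E x xG; apply: contraT => xG'.
have [l lG' lx] := exists_bd iG' xG'.
rewrite -E in lG'; have := ideal_desc iG lx (bd_notin lG').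
by rewrite xG.
Qed.

Lemma ideal_add F l : ideal F -> l \in bd F -> ideal (l |` F).
Proof.
move=> iF; rewrite in_bd // => /andP[lF lp]; split.
  by rewrite !inE; case: iF => ->; rewrite orbT.
move=> x; rewrite !inE => /orP[/eqP ->|xF]; first by rewrite lp orbT.
by case: iF => _ ->; rewrite ?orbT.
Qed.

Lemma bd_add F l : ideal F -> l \in bd F ->
  bd (l |` F) = (bd F `\ l) `|` [fset y in ch l].
Proof.
move=> iF lF; have iF' := ideal_add iF lF.
have [nlF lp] : l \notin F /\ par l \in F by apply/andP; rewrite -in_bd.
apply/fsetP => y; rewrite (in_bd _ iF') [RHS]in_fsetU [in RHS]in_fsetD1.
rewrite [in RHS](in_bd _ iF) !inE in_ch negb_or.
have [->|yl] /= := eqVneq y l.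
  rewrite (negbTE (bd_neq0 iF lF)) /=; apply/esym/negbTE.
  by apply/negP => /eqP pl; rewrite -pl lp in nlF.
have [pl|] := eqVneq (par y) l => /=.
  rewrite andbT pl (negbTE nlF) andbF /=.
  have [yF|yF] := boolP (y \in F) => /=.
    by have := iF.2 y yF; rewrite pl (negbTE nlF).
  by rewrite andbT; apply/esym; apply: contraNneq yF => ->; case: iF.
by rewrite andbF orbF.
Qed.

(** Allows growing an ideal into a larger one by boundary vertices. *)
Lemma exists_bd_in F H : ideal F -> ideal H -> F `<=` H -> F != H ->
  exists2 l, l \in bd F & l \in H.
Proof.
move=> iF iH FH nFH.
have /fsubsetPn[x xH xF] : ~~ (H `<=` F).
  by apply: contra nFH => HF; rewrite eqEfsubset FH.
have [l lF lx] := exists_bd iF xF; exists l => //.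
by apply: contraT => lH; have := ideal_desc iH lx lH; rewrite xH.
Qed.

End RootedTree.

(** * Almost automorphisms as almost everywhere defined maps *)
Section AlmostEverywhere.
Variables (d : nat) (T : regular_tree d).
Notation N := (neretin T).
Implicit Types (f : forest_iso T) (g h : N) (Q : T -> Prop) (S : {fset T}).
Local Open Scope group_scope.

Definition almost Q := exists S, forall x, x \notin S -> Q x.

Lemma almost_all Q : (forall x, Q x) -> almost Q.
Proof. by move=> QT; exists fset0. Qed.

Lemma almost_notin S : almost (fun x => x \notin S).
Proof. by exists S. Qed.

Lemma almost_and Q Q' : almost Q -> almost Q' -> almost (fun x => Q x /\ Q' x).
Proof.
move=> [S SQ] [S' SQ']; exists (S `|` S') => x.
by rewrite inE negb_or => /andP[/SQ ? /SQ' ?].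
Qed.

Lemma almost_sub Q Q' : (forall x, Q x -> Q' x) -> almost Q -> almost Q'.
Proof. by move=> QQ' [S SQ]; exists S => x /SQ /QQ'. Qed.

Lemma almost_comp Q (A : T -> Prop) (u v : T -> T) :
  (forall x, A x -> v (u x) = x) -> almost Q -> almost (fun x => A x -> Q (u x)).
Proof.
move=> uK [S SQ]; exists (v @` S) => x xS Ax; apply: SQ.
by apply: contra xS => uS; rewrite -(uK x Ax) in_imfset.
Qed.

Lemma almost_iso Q f : almost Q -> almost (fun x => Q (f x)).
Proof.
move=> aQ; have := almost_and (almost_notin (fi_dom f))
  (almost_comp (@fi_funK _ _ f) aQ).
by apply: almost_sub => x [xf]; apply.
Qed.

(** Only the values of [ev h] up to finitely many vertices are meaningful. *)
Definition ev h : forest_iso T := repr h.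

Lemma ev_pi f : almost (fun x => ev (\pi_(neretin T)%qT f) x = f x).
Proof. by have [S [_ _ _ SE]] := agree_repr f; exists S. Qed.

Lemma ev_eq g h : almost (fun x => ev g x = ev h x) -> g = h.
Proof.
move=> [S SE]; rewrite -[g]reprK -[h]reprK; apply/neretinP.
exact: agree_fin SE.
Qed.

Lemma evM g h : almost (fun x => ev (g * h) x = ev g (ev h x)).
Proof. exact: ev_pi. Qed.

Lemma ev_aut (a : tree_aut T) : almost (fun x => ev (aut_incl a) x = a x).
Proof. exact: ev_pi. Qed.

Lemma ev1 : almost (fun x => ev 1 x = x).
Proof. exact: (ev_aut 1). Qed.

End AlmostEverywhere.

Section RootedForm.
Variables (d : nat) (T : regular_tree d) (v0 : T).
Notation N := (neretin T).
Notation par := (par v0).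
Notation ideal := (ideal v0).
Notation bd := (bd v0).
Notation desc := (desc v0).
Notation ch := (ch v0).
Implicit Types (f : forest_iso T) (g h : N) (F : {fset T}) (x y l : T).
Local Open Scope group_scope.

(** If [f] did not send the parent of [x] to that of [f x], then [f (par x)] would
    be a child of [f x]; but by induction its parent is in the deleted subtree, or
    else is the image of the parent of [par x]. *)
Lemma iso_par f x : ideal (fi_dom f) -> ideal (fi_cod f) -> x \notin fi_dom f ->
  (par x \in fi_dom f -> par (f x) \in fi_cod f) /\
  (par x \notin fi_dom f -> par (f x) = f (par x)).
Proof.
move=> iF iF'; elim/(tree_ind (v0 := v0)): x => [|x xv IH xF].
  by move=> /negP[]; exact: iF.1.
have xp := adj_par xv; split=> pF.
  have [z zF] := fi_boundary xF pF xp.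
  rewrite (adjE v0) => /orP[/andP[_ /eqP -> //]|/andP[_ /eqP pE]].
  by have := iF'.2 z zF; rewrite pE (negbTE (fi_funP xF)).
have [IH1 IH2] := IH pF; move: xp; rewrite -(fi_adj xF pF) (adjE v0).
case/orP=> /andP[_ /eqP pE] //.
have ppF : par (par x) \notin fi_dom f.
  by apply/negP => /IH1; rewrite pE (negbTE (fi_funP xF)).
have xpp : x = par (par x).
  by rewrite -[RHS](fi_funK ppF) -(IH2 ppF) pE fi_funK.
have pv : par x != v0 by apply: contraNneq pF => ->; case: iF.
have := depth_par xv; have := depth_par pv; rewrite -xpp; lia.
Qed.

(** With the root in both deleted subtrees, representatives respect parents. *)
Lemma exists_rep h (S : {fset T}) : exists f, [/\ h = \pi_(neretin T)%qT f,
  ideal (fi_dom f), ideal (fi_cod f) & {subset S <= fi_dom f}].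
Proof.
elim/neretinW: h => f; pose S' := v0 |` (fi_inv f v0 |` (S `|` fi_dom f)).
have fH : {subset fi_dom f <= hull S'}.
  by move=> x xf; apply: sub_hull; rewrite !inE xf !orbT.
exists (Defs.restrict (hull_subtree S') fH); split.
- by apply/neretinP; exact: (@agree_fin _ _ _ _ fset0).
- apply: subtree_ideal => /=; first exact: hull_subtree.
  by apply: sub_hull; rewrite !inE eqxx.
- apply: subtree_ideal => /=; first exact: (restrict_cod_subtree (hull_subtree S') fH).
  rewrite inE; have [//|vf /=] := boolP (v0 \in fi_cod f).
  apply/imfsetP; exists (fi_inv f v0) => /=; last by rewrite fi_invK.
  by rewrite inE fi_invP //= sub_hull // !inE eqxx orbT.
- by move=> x xS; apply: sub_hull; rewrite !inE xS !orbT.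
Qed.

Definition half_iso F F' (f f' : T -> T) := forall x, x \notin F ->
  [/\ f x \notin F', f' (f x) = x & par x \notin F -> par (f x) = f (par x)].

Lemma half_iso_adj F F' (f f' : T -> T) : ideal F' -> half_iso F F' f f' ->
  forall x y, x \notin F -> y \notin F -> adj x y -> adj (f x) (f y).
Proof.
move=> iF' ff'; have H x y : x \notin F -> y \notin F -> par x = y ->
    adj (f x) (f y).
  move=> xF yF xy; have [fxF fxK fxp] := ff' x xF.
  have pF : par x \notin F by rewrite xy.
  rewrite (adjE v0) -xy fxp // eqxx andbT.
  by apply/orP; left; apply: contraNneq fxF => ->; case: iF'.
move=> x y xF yF; rewrite (adjE v0) => /orP[]/andP[_ /eqP xy].
  exact: H.
by rewrite adj_sym; exact: H.
Qed.

Lemma build_iso F F' (f f' : T -> T) : ideal F -> ideal F' ->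
  half_iso F F' f f' -> half_iso F' F f' f ->
  exists k : forest_iso T, [/\ fi_dom k = F, fi_cod k = F' & k = f :> (T -> T)].
Proof.
move=> iF iF' H H'.
have fP x : x \notin F -> f x \notin F' by move=> /H[].
have f'P x : x \notin F' -> f' x \notin F by move=> /H'[].
have fK x : x \notin F -> f' (f x) = x by move=> /H[].
have f'K x : x \notin F' -> f (f' x) = x by move=> /H'[].
have fA x y : x \notin F -> y \notin F -> adj (f x) (f y) = adj x y.
  move=> xF yF; apply/idP/idP => [|]; last by have := half_iso_adj iF' H xF yF.
  by move=> /(half_iso_adj iF H' (fP x xF) (fP y yF)); rewrite !fK.
by exists (ForestIso (ideal_subtree iF) (ideal_subtree iF') fP f'P fK f'K fA).
Qed.

(** ** Balls *)

Definition bmor l l' (u : T -> T) :=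
  u l = l' /\ forall x, desc l x -> x <> l -> par (u x) = u (par x).

Definition biso l l' u v := [/\ bmor l l' u, bmor l' l v,
  forall x, desc l x -> v (u x) = x & forall y, desc l' y -> u (v y) = y].

Lemma bmor_desc l l' u x : bmor l l' u -> desc l x -> desc l' (u x).
Proof.
move=> [<- up]; move: x; apply: desc_ind; first exact: desc_refl.
move=> x lp xv xl IH; apply: desc_par; rewrite up //.
exact: desc_par.
Qed.

Lemma biso_sym l l' u v : biso l l' u v -> biso l' l v u.
Proof. by case. Qed.

Lemma bmor_trans l l' l'' u u' : bmor l l' u -> bmor l' l'' u' ->
  (forall x, desc l x -> x <> l -> u x <> l') -> bmor l l'' (u' \o u).
Proof.
move=> bu [u'l u'p] ul; split=> [|x lx xl] /=; first by rewrite bu.1 u'l.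
rewrite u'p; [by rewrite bu.2|exact: bmor_desc bu lx|exact: ul].
Qed.

Lemma biso_neq l l' u v x : biso l l' u v -> desc l x -> x <> l -> u x <> l'.
Proof.
by move=> [_ [vl _] uK _] lx xl uxl; apply: xl; rewrite -(uK x lx) uxl.
Qed.

Lemma biso_trans l l' l'' u v u' v' :
  biso l l' u v -> biso l' l'' u' v' -> biso l l'' (u' \o u) (v \o v').
Proof.
move=> uv uv'; have [bu bv uK vK] := uv; have [bu' bv' uK' vK'] := uv'.
split.
- by apply: bmor_trans bu bu' _ => x; exact: biso_neq uv.
- by apply: bmor_trans bv' bv _ => x; exact: biso_neq (biso_sym uv').
- by move=> x lx /=; rewrite uK' ?uK //; exact: bmor_desc bu lx.
- by move=> x lx /=; rewrite vK ?vK' //; exact: bmor_desc bv' lx.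
Qed.

(** The pair [(h, l)] stands for the ball of the boundary of the tree which is the
    image under [h] of the ends of the branch below [l], together with its tree
    structure transported from that branch. *)
Definition sim (p q : N * T) := exists u v, biso p.2 q.2 u v /\
  almost (fun x => desc p.2 x -> ev p.1 x = ev q.1 (u x)).

Lemma sim_refl p : sim p p.
Proof. by exists id, id; split=> //; exact: almost_all. Qed.

Lemma sim_sym p q : sim p q -> sim q p.
Proof.
move=> [u [v [uv E]]]; exists v, u; split; first exact: biso_sym.
have [bu bv uK vK] := uv.
have := almost_comp vK E; apply: almost_sub => y Ey qy.
by rewrite Ey ?vK //; exact: bmor_desc bv qy.
Qed.

Lemma sim_trans q p r : sim p q -> sim q r -> sim p r.
Proof.
move=> [u [v [uv E]]] [u' [v' [uv' E']]]; exists (u' \o u), (v \o v').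
split; first exact: biso_trans uv uv'.
have [bu bv uK vK] := uv.
have := almost_and E (almost_comp uK E'); apply: almost_sub => x [Ex E'x] px /=.
by rewrite Ex // E'x //; exact: bmor_desc bu px.
Qed.

Definition simb (p q : N * T) : bool := `[< sim p q >].

Lemma simb_equiv : equiv_class_of simb.
Proof.
split=> [p|p q|q p r].
- by apply/asboolP; exact: sim_refl.
- by apply/asboolP/asboolP; exact: sim_sym.
- move=> /asboolP pq /asboolP qr; apply/asboolP; exact: sim_trans pq qr.
Qed.

Canonical simb_equivRel := EquivRelPack simb_equiv.

Definition bball := {eq_quot simb}%qT.
HB.instance Definition _ : EqQuotient _ simb bball := EqQuotient.on bball.
HB.instance Definition _ := Choice.on bball.

Definition mkball h l : bball := (\pi_bball (h, l))%qT.

Lemma mkballP h l h' l' : mkball h l = mkball h' l' <-> sim (h, l) (h', l').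
Proof.
rewrite /mkball; split=> [/eqP|E]; first by rewrite piE => /asboolP.
by apply/eqP; rewrite piE; apply/asboolP.
Qed.

Lemma ballW (Q : bball -> Prop) : (forall h l, Q (mkball h l)) -> forall b, Q b.
Proof. by move=> Qm b; rewrite -[b]reprK; case: (repr b). Qed.

Lemma sim_repr h l : sim (repr (mkball h l)) (h, l).
Proof.
have := reprK (mkball h l); rewrite -/(mkball h l) => E.
by move: E; case: (repr _) => h' l' /mkballP.
Qed.

Lemma sim_mull g p q : sim p q -> sim (g * p.1, p.2) (g * q.1, q.2).
Proof.
move=> [u [v [uv E]]]; exists u, v; split=> //=.
have [bu bv uK vK] := uv.
have := almost_and E (almost_and (evM g p.1) (almost_comp uK (evM g q.1))).
by apply: almost_sub => x [Ex [Ep Eq]] px; rewrite Ep Eq // Ex.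
Qed.

Definition act g (b : bball) : bball := mkball (g * (repr b).1) (repr b).2.

Lemma actE g h l : act g (mkball h l) = mkball (g * h) l.
Proof. by apply/mkballP; exact: (sim_mull g (sim_repr h l)). Qed.

Lemma act1 b : act 1 b = b.
Proof. by elim/ballW: b => h l; rewrite actE mul1g. Qed.

Lemma actM g h b : act (g * h) b = act g (act h b).
Proof. by elim/ballW: b => k l; rewrite !actE mulgA. Qed.

Lemma actK g : cancel (act g) (act g^-1).
Proof. by move=> b; rewrite -actM mulVg act1. Qed.

Lemma actVK g : cancel (act g^-1) (act g).
Proof. by move=> b; rewrite -actM mulgV act1. Qed.

Lemma act_inj g : injective (act g).
Proof. exact: can_inj (actK g). Qed.

Lemma mkball_act h l : mkball h l = act h (mkball 1 l).
Proof. by rewrite actE mulg1. Qed.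

Lemma sim_ch h l h' l' : sim (h, l) (h', l') -> forall c,
  c \in ch l -> exists2 c', c' \in ch l' & sim (h, c) (h', c').
Proof.
move=> [u [v [uv /= E]]] c cl; have [bu bv uK vK] := uv.
have cnl : c <> l by move=> cE; move: cl; rewrite cE (negbTE (ch_irr _ _)).
have lc : desc l c by exact: desc_ch.
have lx x : desc c x -> desc l x by exact: desc_trans.
have ucnl : u c <> l' by exact: biso_neq uv lc cnl.
have uc : u c \in ch l'.
  rewrite in_ch bu.2 // (par_ch cl) bu.1 eqxx andbT.
  have [l'v|lv'] := eqVneq l' v0; first by apply/eqP; rewrite -l'v.
  exact: desc_neq0 lv' (bmor_desc bu lc).
exists (u c) => //; exists u, v; split=> /=; last first.
  by apply: almost_sub E => x Ex /lx; exact: Ex.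
have l'x x : desc (u c) x -> desc l' x by apply: desc_trans; exact: desc_ch.
have xnl x : desc c x -> x <> l.
  by move=> + xE; rewrite xE => cx; apply: cnl; exact: desc_anti cx lc.
have xnl' x : desc (u c) x -> x <> l'.
  by move=> + xE; rewrite xE => cx; apply: ucnl; exact: desc_anti cx (desc_ch uc).
split.
- by split=> // x cx xc; apply: bu.2; [exact: lx|exact: xnl].
- split; first by rewrite uK.
  by move=> x cx xc; apply: bv.2; [exact: l'x|exact: xnl'].
- by move=> x /lx /uK.
- by move=> x /l'x /vK.
Qed.

(** The maximal balls properly contained in a ball. *)
Definition bch (b : bball) : {fset bball} :=
  [fset mkball (repr b).1 c | c in ch (repr b).2].

Lemma bchE h l : bch (mkball h l) = [fset mkball h c | c in ch l].
Proof.
suff H p q : sim p q -> [fset mkball p.1 c | c in ch p.2]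
    `<=` [fset mkball q.1 c | c in ch q.2].
  have := sim_repr h l; move=> pq; apply/eqP; rewrite eqEfsubset.
  by rewrite (H _ _ pq) (H _ _ (sim_sym pq)).
case: p q => h1 l1 [h2 l2] pq; apply/fsubsetP => _ /imfsetP[c /= cl ->].
have [c' cl' /mkballP ->] := sim_ch pq cl.
by apply/imfsetP; exists c'.
Qed.

Lemma act_bch g b : bch (act g b) = act g @` bch b.
Proof.
elim/ballW: b => h l; rewrite actE !bchE; apply/fsetP => b; apply/imfsetP/imfsetP.
  move=> [c /= cl ->]; exists (mkball h c); rewrite ?actE //.
  by apply/imfsetP; exists c.
by move=> [_ /= /imfsetP[c /= cl ->] ->]; exists c; rewrite // actE.
Qed.

Lemma bmor_iter l l' u x : bmor l l' u -> desc l x ->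
  exists n, iter n par x = l /\ iter n par (u x) = l'.
Proof.
move=> [ul up]; move: x; apply: desc_ind; first by exists 0.
move=> x lp xv xl [n [nx nu]]; exists n.+1; rewrite !iterSr nx up //.
exact: desc_par.
Qed.

(** Branches are infinite, so the rooted isomorphism involved fixes some vertex,
    hence all ancestors of it. *)
Lemma mkball_inj h l l' : 0 < d -> l != v0 -> mkball h l = mkball h l' -> l = l'.
Proof.
move=> d0 lv; rewrite ![mkball h _]mkball_act => /act_inj /mkballP.
move=> [u [v [/= [bu _ uK _] E]]].
have [S SE] := almost_and E (almost_and (ev1 T) (almost_comp uK (ev1 T))).
have [x lx /SE[Ex [x1 ux1]]] := desc_notin S d0 lv.
have [n [<- <-]] := bmor_iter bu lx.
by rewrite -(ux1 lx) -Ex // x1.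
Qed.

Lemma bmor_iso f l : ideal (fi_dom f) -> ideal (fi_cod f) -> l \notin fi_dom f ->
  bmor l (f l) f.
Proof.
move=> iF iF' lF; split=> // x lx xl.
apply: (iso_par iF iF' _).2; first exact: ideal_desc lx lF.
exact: ideal_desc (desc_par_neq lx xl) lF.
Qed.

(** A representative respects parents, so it restricts to a rooted isomorphism from
    the branch below [l] onto the one below [f l]. *)
Lemma mkball_rep f l : ideal (fi_dom f) -> ideal (fi_cod f) -> l \notin fi_dom f ->
  mkball (\pi_(neretin T)%qT f) l = mkball 1 (f l).
Proof.
move=> iF iF' lF; apply/mkballP; exists f, (fi_inv f); split=> /=.
  split; first exact: bmor_iso.
  - have := bmor_iso (f := fi_inverse f) iF' iF (fi_funP lF).
    by rewrite /= fi_funK.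
  - by move=> x lx; rewrite fi_funK //; exact: ideal_desc lx lF.
  - by move=> x lx; rewrite fi_invK //; exact: ideal_desc lx (fi_funP lF).
have := almost_and (ev_pi f) (almost_iso f (ev1 T)).
by apply: almost_sub => x [-> ->].
Qed.

Lemma par_aut (a : tree_aut T) x : a v0 = v0 -> par (a x) = a (par x).
Proof.
move=> av; have [->|xv] := eqVneq x v0; first by rewrite av !par_v0.
have E : (a @` [fset v0])%fset = [fset v0] by rewrite imfset_fset1 /= av.
have [||/=] := @iso_par (ta_iso a (subtree1 v0)) x (ideal1 v0); rewrite /= ?E.
- exact: ideal1.
- by rewrite inE.
move=> p1 p2; have [pv|pv] := eqVneq (par x) v0; last by apply: p2; rewrite inE.
by rewrite pv av; apply/eqP; rewrite -in_fset1 p1 // pv inE.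
Qed.

Lemma mkball_aut (a : tree_aut T) l : a v0 = v0 -> mkball (aut_incl a) l = mkball 1 (a l).
Proof.
move=> av; have a'v : ta_inverse a v0 = v0 by rewrite /= -{1}av ta_funK.
apply/mkballP; exists a, (ta_inv a); split=> /=.
  split; [|split|by move=> x _; exact: ta_funK|by move=> x _; exact: ta_invK].
  - by split=> // x _ _; exact: par_aut.
  - exact: ta_funK.
  - by move=> x _ _; exact: (par_aut x a'v).
have := almost_and (ev_aut a) (almost_comp (A := fun=> True) (fun x _ => ta_funK a x) (ev1 T)).
by apply: almost_sub => x [-> ->].
Qed.

(** An almost automorphism fixing all balls of the partition given by [F] is an
    isomorphism on each of the branches hanging off [F]; glue these. *)
Lemma fix_balls g F : ideal F ->
  (forall l, l \in bd F -> act g (mkball 1 l) = mkball 1 l) ->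
  exists2 a : tree_aut T, fixes (F `|` bd F) a & g = aut_incl a.
Proof.
move=> iF gF.
(* [top x] is the boundary vertex above [x]. *)
have topE x : exists l, x \notin F -> l \in bd F /\ desc l x.
  have [xF|xF] := boolP (x \in F); first by exists x; rewrite ?xF.
  by have [l ? ?] := exists_bd iF xF; exists l.
have [top topP] := boolp.choice topE.
have uvE l : exists uv : (T -> T) * (T -> T), l \in bd F -> biso l l uv.1 uv.2 /\
    almost (fun x => desc l x -> ev g x = uv.1 x).
  have [lF|//] := boolP (l \in bd F); last by exists (id, id).
  have := gF l lF; rewrite actE mulg1 => /mkballP[u [v [uv /= E]]].
  exists (u, v) => _; split=> //.
  have [_ _ uK _] := uv.
  have := almost_and E (almost_comp uK (ev1 T)).
  by apply: almost_sub => x [Ex x1] lx; rewrite Ex // x1.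
have [uv uvP] := boolp.choice uvE.
pose glue (w : T -> T -> T) x := if x \in F then x else w (top x) x.
have top_eq l x : l \in bd F -> desc l x -> x \notin F -> top x = l.
  by move=> lF lx xF; have [tF tx] := topP x xF; exact: bd_unique iF tF lF tx lx.
have glue_par w : (forall l, l \in bd F -> bmor l l (w l)) ->
    forall x, par (glue w x) = glue w (par x).
  move=> bw x; rewrite /glue; case: ifPn => xF; first by rewrite iF.2.
  have [tF tx] := topP x xF; have [wl wp] := bw _ tF.
  have [xt|/eqP xt] := eqVneq x (top x).
    have : par x \in F by move: tF; rewrite -xt in_bd // => /andP[].
    by move=> pF; rewrite pF {2}xt wl -xt.
  have tp := desc_par_neq tx xt.
  have pF : par x \notin F by exact: ideal_desc iF tp (bd_notin tF).
  by rewrite (negbTE pF) wp // (top_eq (top x)).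
have glueK w w' : (forall l, l \in bd F -> bmor l l (w l)) ->
    (forall l x, l \in bd F -> desc l x -> w' l (w l x) = x) ->
    cancel (glue w) (glue w').
  move=> bw wK x; rewrite {2}/glue; case: ifPn => xF.
    by rewrite /glue xF.
  have [tF tx] := topP x xF.
  have wx := bmor_desc (bw _ tF) tx.
  have wF := ideal_desc iF wx (bd_notin tF).
  by rewrite /glue (negbTE wF) (top_eq (top x)) // wK.
pose u l := (uv l).1; pose v l := (uv l).2.
have bu l : l \in bd F -> bmor l l (u l) by move=> /uvP[[]].
have bv l : l \in bd F -> bmor l l (v l) by move=> /uvP[[]].
have uK : cancel (glue u) (glue v).
  by apply: glueK => // l x lF; have [[_ _ + _] _] := uvP l lF; exact.
have vK : cancel (glue v) (glue u).
  by apply: glueK => // l x lF; have [[_ _ _ +] _] := uvP l lF; exact.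
have gv w : glue w v0 = v0 by rewrite /glue iF.1.
have uA : {mono glue u : x y / adj x y}.
  move=> x y; rewrite !(adjE v0) !glue_par //.
  have e z w : (glue u z == glue u w) = (z == w) := inj_eq (can_inj uK) z w.
  have e0 z : (glue u z == v0) = (z == v0) by rewrite -{1}(gv u) e.
  by rewrite !e !e0.
exists (TreeAut uK vK uA).
  move=> x; rewrite inE /= /glue => /orP[->//|xB]; rewrite (negbTE (bd_notin xB)).
  rewrite (top_eq x x xB (desc_refl _ _) (bd_notin xB)).
  by case: (bu x xB).
apply: ev_eq.
have [S SE] : exists S : {fset T}, forall l, l \in bd F -> forall x,
    x \notin S -> desc l x -> ev g x = u l x.
  have SP l : exists S : {fset T}, l \in bd F -> forall x,
      x \notin S -> desc l x -> ev g x = u l x.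
    have [lF|_] := boolP (l \in bd F); last by exists fset0.
    by have [_ [S ?]] := uvP l lF; exists S.
  have [S SE] := boolp.choice SP.
  exists [fset x in flatten [seq (S l : seq T) | l <- bd F]] => l lF x xS lx.
  apply: (SE l) => //; apply: contra xS => xS; rewrite !inE.
  by apply/flattenP; exists (S l : seq T) => //; apply/mapP; exists l.
have := almost_and (almost_and (almost_notin F) (almost_notin S))
  (ev_aut (TreeAut uK vK uA)).
apply: almost_sub => x [[xF xS] ->] /=; rewrite /glue (negbTE xF).
by have [tF tx] := topP x xF; exact: SE xS tx.
Qed.

Section Transport.
Variables (F F' : {fset T}) (pi : T -> T).

(** The map taking the branch below each boundary vertex [l] of [F] to the branch
    below [pi l], preserving the ranks among siblings. *)
Fixpoint transport_rec n x : T :=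
  if x \in bd F then pi x else
  if n is n'.+1 then
    let y := transport_rec n' (par x) in nth y (ch y) (index x (ch (par x)))
  else x.

Definition transport x := transport_rec (depth v0 x) x.

Lemma transport_bd l : l \in bd F -> transport l = pi l.
Proof. by rewrite /transport; case: (depth _ _) => [|n] /= ->. Qed.

Lemma transport_par x : x != v0 -> x \notin bd F ->
  transport x = nth (transport (par x)) (ch (transport (par x)))
    (index x (ch (par x))).
Proof.
by move=> xv /negbTE xB; rewrite {1}/transport (depth_par xv) /= xB.
Qed.

Hypotheses (iF : ideal F) (iF' : ideal F').
Hypothesis piP : forall l, l \in bd F -> pi l \in bd F'.

Lemma notinW (Q : T -> Prop) : (forall l, l \in bd F -> Q l) ->
  (forall x, x != v0 -> x \notin F -> par x \notin F -> x \notin bd F ->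
     Q (par x) -> Q x) -> forall x, x \notin F -> Q x.
Proof.
move=> QB Qp; elim/(tree_ind (v0 := v0)) => [|x xv IH xF].
  by rewrite iF.1.
have [xB|xB] := boolP (x \in bd F); first exact: QB.
have pF : par x \notin F by move: xB; rewrite in_bd // xF.
by apply: Qp => //; exact: IH.
Qed.

Lemma transport_ch x : x != v0 -> x \notin F -> x \notin bd F ->
  transport (par x) \notin F' ->
  transport x \in ch (transport (par x)) /\
  index (transport x) (ch (transport (par x))) = index x (ch (par x)).
Proof.
move=> xv xF xB tF'; rewrite transport_par //.
have pF : par x \notin F by move: xB; rewrite in_bd // xF.
have pv : par x != v0 by apply: contraNneq pF => ->; exact: iF.1.
have tv : transport (par x) != v0 by apply: contraNneq tF' => ->; exact: iF'.1.
have ix : index x (ch (par x)) < size (ch (transport (par x))).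
  by rewrite (size_ch tv); apply: leq_trans (eq_leq (size_ch pv)); rewrite index_mem mem_ch_par.
by split; [exact: mem_nth|rewrite index_uniq // ch_uniq].
Qed.

Lemma transport_notin x : x \notin F -> transport x \notin F'.
Proof.
move: x; apply: notinW => [l lB|x xv xF pF xB tF].
  by rewrite transport_bd //; apply: (@bd_notin _ _ v0); exact: piP.
have [/par_ch tp _] := transport_ch xv xF xB tF.
by apply: contra tF => /iF'.2; rewrite tp.
Qed.

Lemma transport_bmor l : l \in bd F -> bmor l (pi l) transport.
Proof.
move=> lB; split=> [|x lx xl]; first exact: transport_bd.
have lF := bd_notin lB.
have pF := ideal_desc iF (desc_par_neq lx xl) lF.
have xF := ideal_desc iF lx lF.
have xB : x \notin bd F by rewrite in_bd // negb_and pF orbT.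
have xv : x != v0 by apply: contraNneq xF => ->; exact: iF.1.
by have [/par_ch] := transport_ch xv xF xB (transport_notin pF).
Qed.

End Transport.

Lemma transportK F F' pi pi' : ideal F -> ideal F' ->
  (forall l, l \in bd F -> pi l \in bd F' /\ pi' (pi l) = l) ->
  half_iso F F' (transport F pi) (transport F' pi').
Proof.
move=> iF iF' piP; have pi1 l (lB : l \in bd F) := (piP l lB).1.
have tN x := transport_notin iF iF' pi1 (x := x).
have tP x : x \notin F -> par x \notin F ->
    par (transport F pi x) = transport F pi (par x).
  move=> xF pF; have [l lB lp] := exists_bd iF pF.
  apply: (transport_bmor iF iF' pi1 lB).2; first exact: desc_par.
  by move=> xl; move: lB; rewrite in_bd // -xl (negbTE pF) andbF.
have tK : forall x, x \notin F -> transport F' pi' (transport F pi x) = x.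
  apply: notinW => // [l lB|x xv xF pF xB IH].
    by rewrite (transport_bd _ lB) transport_bd ?pi1 // (piP l lB).2.
  have [tc ti] := transport_ch iF iF' xv xF xB (tN _ pF).
  have tB : transport F pi x \notin bd F'.
    by rewrite in_bd // (par_ch tc) negb_and (tN _ pF) orbT.
  rewrite (transport_par _ (ch_neq0 tc) tB) (par_ch tc) IH ti.
  by rewrite nth_index // mem_ch_par.
by move=> x xF; split; [exact: tN|exact: tK|exact: tP].
Qed.

End RootedForm.

(** * Partitions of the boundary into balls *)
Section Partitions.
Variables (d : nat) (T : regular_tree d) (v0 : T).
Hypothesis d2 : 2 <= d.
Notation N := (neretin T).
Notation par := (par v0).
Notation ideal := (ideal v0).
Notation bd := (bd v0).
Notation ch := (ch v0).
Notation bball := (bball v0).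
Notation mkball := (mkball v0).
Implicit Types (g h : N) (F : {fset T}) (l : T) (a b c : bball) (x y : {fset bball}).
Local Open Scope group_scope.

Let d0 : 0 < d. Proof. by apply: leq_trans d2. Qed.

(** The image under [h] of the partition of the boundary of the tree into the
    ends of the trees left after deleting [F]. *)
Definition std h F : {fset bball} := [fset mkball h l | l in bd F].

Definition vert x := exists h F, ideal F /\ x = std h F.

Definition subdivide x a : {fset bball} := (x `\ a) `|` bch a.

Lemma in_stdP h F b : reflect (exists2 l, l \in bd F & b = mkball h l) (b \in std h F).
Proof. by apply: (iffP (imfsetP _ _ _ _)) => -[l ? ?]; exists l. Qed.

Lemma mkball_std h F l : ideal F -> l != v0 -> (mkball h l \in std h F) = (l \in bd F).
Proof.
move=> iF lv; apply/in_stdP/idP => [[l' lF /(mkball_inj d0 lv) ->//]|lF].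
by exists l.
Qed.

Lemma mkball_bch h l k : k != v0 -> (mkball h k \in bch (mkball h l)) = (k \in ch l).
Proof.
move=> kv; rewrite bchE; apply/imfsetP/idP => [[k' /= kl]|kl].
  by move=> /(mkball_inj d0 kv) ->.
by exists k.
Qed.

Lemma act_std g h F : act g @` std h F = std (g * h) F.
Proof.
apply/fsetP => b; apply/imfsetP/in_stdP.
  by move=> [_ /= /in_stdP[l lF ->] ->]; exists l; rewrite ?actE.
by move=> [l lF ->]; exists (mkball h l); rewrite ?actE //; apply/in_stdP; exists l.
Qed.

Lemma vert_std h F : ideal F -> vert (std h F).
Proof. by exists h, F. Qed.

Lemma vert_act g x : vert x -> vert (act g @` x).
Proof. by move=> [h [F [iF ->]]]; rewrite act_std; exact: vert_std. Qed.

Lemma in_bd_add F l k : ideal F -> l \in bd F ->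
  (k \in bd (l |` F)) = (k != l) && (k \in bd F) || (k \in ch l).
Proof. by move=> iF lF; rewrite bd_add // in_fsetU in_fsetD1; congr (_ || _); rewrite inE. Qed.

Lemma subdivide_std h F l : ideal F -> l \in bd F ->
  subdivide (std h F) (mkball h l) = std h (l |` F).
Proof.
move=> iF lF; have lv := bd_neq0 iF lF.
apply/fsetP => b; rewrite /subdivide in_fsetU in_fsetD1 bchE.
apply/orP/in_stdP => [[/andP[bl /in_stdP[k kF bE]]|/imfsetP[c /= cl ->]]|].
- exists k => //; rewrite in_bd_add // kF andbT; apply/orP; left.
  by apply: contra bl => /eqP <-; rewrite bE.
- by exists c => //; rewrite in_bd_add // cl orbT.
move=> [k]; rewrite in_bd_add // => /orP[/andP[kl kF] ->|kl ->].
  left; apply/andP; split; last by apply/in_stdP; exists k.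
  apply: contra kl => /eqP /(mkball_inj d0) -> //; exact: bd_neq0 kF.
by right; apply/imfsetP; exists k.
Qed.

Lemma vertE x a : vert x -> a \in x ->
  exists h F l, [/\ ideal F, l \in bd F, a = mkball h l & x = std h F].
Proof. by move=> [h [F [iF ->]]] /in_stdP[l lF ->]; exists h, F, l. Qed.

Lemma vert_subdivide x a : vert x -> a \in x -> vert (subdivide x a).
Proof.
move=> vx ax; have [h [F [l [iF lF -> ->]]]] := vertE vx ax.
by rewrite subdivide_std //; apply: vert_std; exact: ideal_add.
Qed.

Lemma vert_bch x a b : vert x -> a \in x -> b \in x -> b \notin bch a.
Proof.
move=> vx ax; have [h [F [l [iF lF -> ->]]]] := vertE vx ax => /in_stdP[k kF ->].
rewrite mkball_bch ?(bd_neq0 iF) //; apply/negP => /par_ch kl.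
by move: kF; rewrite in_bd // kl (negbTE (bd_notin lF)) andbF.
Qed.

Lemma unsubdivide x a : vert x -> a \in x -> x = a |` (subdivide x a `\` bch a).
Proof.
move=> vx ax; apply/fsetP => b; rewrite !inE.
have [->|ba] /= := eqVneq b a; first by rewrite ax.
case bx : (b \in x) => /=; first by rewrite (vert_bch vx ax bx).
by case: (b \in bch a).
Qed.

Lemma in_subdivide x a b : b \in x -> b != a -> b \in subdivide x a.
Proof. by move=> bx ba; rewrite !inE ba bx. Qed.

Lemma subdivideC x a b : vert x -> a \in x -> b \in x -> a != b ->
  subdivide (subdivide x a) b = subdivide (subdivide x b) a.
Proof.
move=> vx ax bx ab; apply/fsetP => c; rewrite !inE.
have [->|cb] /= := eqVneq c b.
  by rewrite (negbTE (vert_bch vx ax bx)) (negbTE (vert_bch vx bx bx)) !andbF.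
have [->|ca] /= := eqVneq c a.
  by rewrite (negbTE (vert_bch vx ax ax)) (negbTE (vert_bch vx bx ax)).
by rewrite -!orbA; congr (_ || _); rewrite orbC.
Qed.

Lemma card_bch a x : vert x -> a \in x -> #|` bch a| = d.
Proof.
move=> vx ax; have [h [F [l [iF lF -> _]]]] := vertE vx ax.
rewrite bchE card_in_imfset /=; last first.
  by move=> c c' /ch_neq0 cv _; exact: mkball_inj d0 cv.
apply: etrans (size_ch (bd_neq0 iF lF)).
by rewrite undup_id // ch_uniq.
Qed.

Lemma card_subdivide x a : vert x -> a \in x -> #|` subdivide x a| = #|` x| + d.-1.
Proof.
move=> vx ax; rewrite /subdivide cardfsU (_ : _ `&` _ = fset0) ?cardfs0 ?subn0.
  by rewrite (card_bch vx ax) (cardfsD1 a x) ax; lia.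
apply/fsetP => b; rewrite !inE; apply/negbTE; rewrite negb_and -implybE.
by apply/implyP => /andP[_ bx]; exact: vert_bch vx ax bx.
Qed.

Lemma act_subdivide g x a : act g @` subdivide x a = subdivide (act g @` x) (act g a).
Proof.
rewrite /subdivide imfsetU act_bch; congr (_ `|` _); apply/fsetP => b.
rewrite in_fsetD1; apply/imfsetP/andP => /=.
  move=> [c]; rewrite in_fsetD1 => /andP[ca cx] ->.
  by rewrite (inj_eq (@act_inj _ _ _ g)) ca in_imfset.
move=> [+ /imfsetP[c /= cx bE]]; rewrite bE (inj_eq (@act_inj _ _ _ g)) => ca.
by exists c; rewrite // in_fsetD1 ca.
Qed.

(** ** Transitivity *)

Lemma enum_std h F s : ideal F -> uniq s -> s =i std h F ->
  exists p, [/\ uniq p, p =i bd F & s = map (mkball h) p].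
Proof.
move=> iF us sE.
have fE b : exists l, b \in std h F -> l \in bd F /\ b = mkball h l.
  by have [/in_stdP[l lF ->]|_] := boolP (b \in std h F); [exists l|exists v0].
have [f fP] := boolp.choice fE.
have sf : map (mkball h) (map f s) = s.
  rewrite -map_comp -[RHS]map_id; apply/eq_in_map => b.
  by rewrite sE => /fP[_ {2}->].
exists (map f s); split=> //; first by move: us; rewrite -{1}sf => /map_uniq.
move=> l; apply/mapP/idP => [[b]|lF].
  by rewrite sE => /fP[? _] ->.
have : mkball h l \in std h F by apply/in_stdP; exists l.
move=> /[dup] /fP[_ /(mkball_inj d0 (bd_neq0 iF lF)) E]; rewrite -sE => sl.
by exists (mkball h l).
Qed.

(** Transport each branch of one partition to the branch matched with it in the
    other. *)
Lemma act_transitive x y s t : vert x -> vert y -> uniq s -> s =i x ->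
  uniq t -> t =i y -> size s = size t -> exists g, map (act g) s = t.
Proof.
move=> [h [F [iF ->]]] [h' [F' [iF' ->]]] us sx ut ty.
have [p [up pF ->]] := enum_std iF us sx; have [q [uq qF ->]] := enum_std iF' ut ty.
rewrite !size_map => spq.
pose pi l := nth v0 q (index l p); pose pi' l := nth v0 p (index l q).
have piP l : l \in bd F -> pi l \in bd F' /\ pi' (pi l) = l.
  rewrite -pF -qF /pi /pi' => lp; have ip : index l p < size q by rewrite -spq index_mem.
  by rewrite mem_nth // index_uniq // nth_index.
have pi'P l : l \in bd F' -> pi' l \in bd F /\ pi (pi' l) = l.
  rewrite -pF -qF /pi /pi' => lp; have ip : index l q < size p by rewrite spq index_mem.
  by rewrite mem_nth // index_uniq // nth_index.
have [k [kF kF' kE]] := build_iso iF iF' (transportK iF iF' piP) (transportK iF' iF pi'P).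
exists (h' * \pi_(neretin T)%qT k * h^-1).
rewrite -map_comp; apply: (@eq_from_nth _ (mkball 1 v0)); rewrite !size_map // => i ip.
have iq : i < size q by rewrite -spq.
rewrite !(nth_map v0) //= actE mulgVK.
set l := nth v0 p i; have lF : l \in bd F by rewrite -pF mem_nth.
rewrite -actE mkball_rep ?kF ?kF' // ?(bd_notin lF) //.
by rewrite actE mulg1 kE transport_bd // /pi index_uniq.
Qed.

(** ** Balls of the tree *)

Definition good b := exists2 l, l != v0 & b = mkball 1 l.

Lemma good_bch b c : good b -> c \in bch b -> good c.
Proof.
move=> [l lv ->]; rewrite bchE => /imfsetP[k /= kl ->]; exists k => //.
exact: ch_neq0 kl.
Qed.

Lemma good_std F b : ideal F -> b \in std 1 F -> good b.
Proof. by move=> iF /in_stdP[l lF ->]; exists l => //; exact: bd_neq0 lF. Qed.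

(** When a ball of the tree has been subdivided, all its children are boundary
    vertices, so the vertex of the ball can be removed from the ideal. *)
Lemma std_contract x a : vert x -> a \in x -> good a ->
  (exists2 F, ideal F & subdivide x a = std 1 F) -> exists2 F, ideal F & x = std 1 F.
Proof.
move=> vx ax [l lv aE] [F' iF' xE].
have chF k : k \in ch l -> k \in bd F'.
  move=> kl; have kv := ch_neq0 kl; rewrite -(mkball_std 1 iF' kv) -xE !inE.
  by rewrite aE mkball_bch // kl orbT.
have [k kl] : exists k, k \in ch l.
  have := size_ch lv; have := d0; case: (ch l) => [|k s] /= dpos E; first by lia.
  by exists k; rewrite mem_head.
have lF' : l \in F' by have := chF k kl; rewrite in_bd // (par_ch kl) => /andP[].
have iF : ideal (F' `\ l).
  split; first by rewrite !inE eq_sym lv iF'.1.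
  move=> z; rewrite !inE => /andP[zl zF]; rewrite iF'.2 // andbT.
  apply/negP => /eqP pz.
  have zv : z != v0 by apply: contraNneq lv => zv; rewrite -pz zv par_v0.
  have : z \in ch l by rewrite in_ch zv pz eqxx.
  by move=> /chF /bd_notin; rewrite zF.
have lF : l \in bd (F' `\ l).
  rewrite in_bd // !inE eqxx iF'.2 //= andbT.
  apply/negP => /eqP pl.
  by have := depth_par lv; rewrite pl; lia.
have FE : l |` (F' `\ l) = F' by rewrite fsetD1K.
exists (F' `\ l) => //.
have a'x : a \in std 1 (F' `\ l) by rewrite aE mkball_std.
rewrite (unsubdivide vx ax) (unsubdivide (vert_std 1 iF) a'x) xE.
by congr (_ |` (_ `\` _)); rewrite aE subdivide_std // FE.
Qed.

Lemma std_rep f : ideal (fi_dom f) -> ideal (fi_cod f) ->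
  std (\pi_(neretin T)%qT f) (fi_dom f) = std 1 (fi_cod f).
Proof.
move=> iF iF'.
have H k : ideal (fi_dom k) -> ideal (fi_cod k) -> forall l, l \in bd (fi_dom k) ->
    k l \in bd (fi_cod k).
  move=> jF jF' l lB; have lF := bd_notin lB.
  rewrite in_bd // fi_funP //= (iso_par jF jF' lF).1 //.
  by move: lB; rewrite in_bd // => /andP[].
apply/fsetP => b; apply/in_stdP/in_stdP => -[l lB ->].
  by exists (f l); [exact: H|rewrite mkball_rep ?(bd_notin lB)].
have lF := bd_notin lB.
exists (fi_inv f l); first exact: (H (fi_inverse f)).
by rewrite mkball_rep ?fi_invP // fi_invK.
Qed.

(** Subdividing until the subtree deleted by a representative of [h] is reached
    yields a partition into branches of the tree itself; then undo the
    subdivisions. *)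
Lemma std_of_good x : vert x -> (forall b, b \in x -> good b) ->
  exists2 F, ideal F & x = std 1 F.
Proof.
move=> [h [F [iF ->]]]; have [f [hE iD iC FD]] := exists_rep v0 h F.
have {FD} FD : F `<=` fi_dom f by apply/fsubsetP.
move: {2}#|` fi_dom f `\` F| (leqnn #|` fi_dom f `\` F|) => n.
elim: n F iF FD => [|n IH] F iF FD nF gx.
all: have [FE|nFE] := eqVneq F (fi_dom f);
  first by exists (fi_cod f) => //; rewrite FE hE std_rep.
all: have [l lB lD] := exists_bd_in iF iD FD nFE.
all: have lx : mkball h l \in std h F by apply/in_stdP; exists l.
all: have nlF := bd_notin lB.
all: have lDF : l \in fi_dom f `\` F by rewrite inE nlF lD.
  by move: nF; rewrite (cardfsD1 l) lDF.
apply: (std_contract (vert_std h iF) lx (gx _ lx)); rewrite subdivide_std //.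
apply: IH; first exact: ideal_add.
- by apply/fsubsetP => z; rewrite !inE => /orP[/eqP -> //|]; exact: (fsubsetP FD).
- move: nF; rewrite (cardfsD1 l) lDF (_ : _ `\ l = fi_dom f `\` (l |` F)) //.
  by apply/fsetP => z; rewrite !inE negb_or andbA.
- rewrite -subdivide_std // => b; rewrite !inE => /orP[/andP[_ /gx //]|].
  exact: good_bch (gx _ lx).
Qed.

Fixpoint tame n x : Prop :=
  if n is n'.+1 then forall a, a \in x -> ~ good a -> tame n' (subdivide x a)
  else forall a, a \in x -> good a.

(** Such a subdivision uses up a vertex of the subtree deleted by a representative
    of [h]. *)
Lemma exists_tame x : vert x -> exists n, `[< tame n x >].
Proof.
move=> [h [F [iF ->]]]; have [f [hE iD iC _]] := exists_rep v0 h F.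
suff H n : forall F, ideal F -> #|` fi_dom f `\` F| <= n -> tame n (std h F).
  by exists #|` fi_dom f `\` F|; apply/asboolP; exact: H.
have gd l : l \notin fi_dom f -> good (mkball h l).
  move=> lD; exists (f l); last by rewrite hE mkball_rep.
  by apply: contraNneq (fi_funP lD) => ->; exact: iC.1.
elim: n {F iF} => [|n IH] F iF nF a /in_stdP[l lB aE].
  rewrite aE; apply: gd; apply/negP => lD.
  have : l \in fi_dom f `\` F by rewrite inE lD (bd_notin lB).
  by move: nF; rewrite leqn0 cardfs_eq0 => /eqP ->.
rewrite aE => nga; have lD : l \in fi_dom f by apply/negPn/negP => /gd.
rewrite subdivide_std //; apply: IH; first exact: ideal_add.
have lDF : l \in fi_dom f `\` F by rewrite inE lD (bd_notin lB).
move: nF; rewrite (cardfsD1 l) lDF (_ : _ `\ l = fi_dom f `\` (l |` F)) //.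
by apply/fsetP => z; rewrite !inE negb_or andbA.
Qed.

(** Decreases along the flow that subdivides the balls that are not good. *)
Definition rank x : nat :=
  if pselect (exists n, `[< tame n x >]) is left e then ex_minn e else 0.

Lemma rank_subdivide x a : vert x -> a \in x -> ~ good a -> rank (subdivide x a) < rank x.
Proof.
move=> vx ax ga; rewrite /rank; case: pselect => [e|[]]; last first.
  by apply: exists_tame; exact: vert_subdivide.
case: pselect => [e'|[]]; last exact: exists_tame.
case: ex_minnP => m _ mP; case: ex_minnP => -[|n] /asboolP /= nP _.
  by case: ga; exact: nP.
by rewrite ltnS; apply: mP; apply/asboolP; exact: nP.
Qed.

End Partitions.

(** * Alternating cubical cochains *)
Section AlternatingSum.
Variable I : eqType.
Local Open Scope ring_scope.

(** Unfolds to the sum over the entries [a] of [s], with alternating signs, of [F]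
    at [a] and the list of the other entries; the recursion avoids positions. *)
Fixpoint asum (V : zmodType) (F : I -> seq I -> V) (s : seq I) : V :=
  if s is a :: s' then F a s' - asum (fun b r => F b (a :: r)) s' else 0.

Lemma perm_swap2 (a b : I) r : perm_eq [:: a, b & r] [:: b, a & r].
Proof. by rewrite (perm_catCA [:: a] [:: b] r). Qed.

Lemma perm_insert (a b : I) r s : perm_eq (b :: r) s ->
  perm_eq [:: b, a & r] (a :: s).
Proof. by move=> br; rewrite (perm_trans (perm_swap2 b a r)) // perm_cons. Qed.

Variables V W : zmodType.

Lemma sub_sub3 (x y z : V) : x - (x - y - z) - y - z = 0.
Proof. by rewrite -!(addrA _ (- y)) -!opprD opprB [x + _]addrC subrK subrr. Qed.

Lemma subr_subr_swap (x y z t : V) : x - y - (z - t) = x - z - (y - t).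
Proof. by rewrite !opprB addrACA [RHS]addrACA; congr (_ + _); exact: addrC. Qed.

Implicit Types (F : I -> seq I -> V) (a b c : I) (r s : seq I).

Lemma asum_ext F F' s : (forall a r, perm_eq (a :: r) s -> F a r = F' a r) ->
  asum F s = asum F' s.
Proof.
elim: s F F' => //= a s IH F F' FF'; rewrite FF' //; congr (_ - _).
by apply: IH => b r br; apply: FF'; exact: perm_insert.
Qed.

Lemma asum_closed (S : zmodClosed V) F s :
  (forall a r, perm_eq (a :: r) s -> F a r \in S) -> asum F s \in S.
Proof.
elim: s F => [|a s IH] F FS /=; first exact: rpred0.
rewrite rpredB ?FS //; apply: IH => b r br; apply: FS.
exact: perm_insert.
Qed.

Lemma asum0 s : asum (fun _ _ => 0 : V) s = 0.
Proof. by elim: s => //= a s ->; rewrite subr0. Qed.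

Lemma asumB F F' s : asum (fun a r => F a r - F' a r) s = asum F s - asum F' s.
Proof.
elim: s F F' => [|a s IH] F F' /=; first by rewrite subr0.
by rewrite IH subr_subr_swap.
Qed.

Lemma asum_sym (F : I -> I -> seq I -> V) s :
  (forall a b r, perm_eq [:: a, b & r] s -> F a b r = F b a r) ->
  asum (fun a r => asum (F a) r) s = 0.
Proof.
elim: s F => //= a s IH F Fs; rewrite asumB.
have -> : asum (fun b r => F b a r) s = asum (F a) s.
  by apply: asum_ext => b r br; apply: Fs; exact: perm_insert.
rewrite (IH (fun b c r => F b c (a :: r))) ?subr0 ?subrr // => b c r bcr.
by apply: Fs; rewrite (perm_catCA [:: b; c] [:: a] r) perm_cons.
Qed.

Lemma asum_alt F s1 a b s2 :
  (forall c r1 r2, perm_eq (c :: r1 ++ [:: a, b & r2]) (s1 ++ [:: a, b & s2]) ->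
     F c (r1 ++ [:: a, b & r2]) = - F c (r1 ++ [:: b, a & r2])) ->
  asum F (s1 ++ [:: a, b & s2]) = - asum F (s1 ++ [:: b, a & s2]).
Proof.
elim: s1 F => [|c s1 IH] F Falt /=; last first.
  rewrite (Falt c s1 s2) // IH ?opprB ?opprK 1?addrC // => e r1 r2 er.
  by apply: (Falt _ (c :: r1)); rewrite /= perm_insert.
rewrite (asum_ext (F' := fun c r => - F c [:: b, a & r])) => [|c r cr]; last first.
  apply: (Falt c [::]); rewrite /= (perm_catCA [:: c] [:: a; b] r) /=.
  by rewrite !perm_cons.
have -> : asum (fun c r => - F c [:: b, a & r]) s2 =
    - asum (fun c r => F c [:: b, a & r]) s2.
  rewrite -[RHS]add0r -(asum0 s2) -asumB; apply: asum_ext => c r _.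
  by rewrite add0r.
by rewrite !opprB addrA.
Qed.

End AlternatingSum.

Lemma asum_map (I J : eqType) (V : zmodType) (g : I -> J) (F : J -> seq J -> V) s :
  asum F (map g s) = asum (fun a r => F (g a) (map g r)) s.
Proof. by elim: s F => //= a s IH F; rewrite IH. Qed.

Section Cubes.
Variables (X I : eqType) (cube : X -> seq I -> Prop) (mv : X -> I -> X).
Hypotheses (cube_uniq : forall x s, cube x s -> uniq s)
  (cube_perm : forall x s t, cube x s -> perm_eq s t -> cube x t)
  (cube_near : forall x a s, cube x (a :: s) -> cube x s)
  (cube_far : forall x a s, cube x (a :: s) -> cube (mv x a) s)
  (mvC : forall x a b s, cube x [:: a, b & s] -> mv (mv x a) b = mv (mv x b) a).
Variable V : zmodType.
Implicit Types (phi psi : X -> seq I -> V) (x : X) (a b : I) (s : seq I).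
Local Open Scope ring_scope.

(** The signed sum over the facets of a cube: those at the far end of a
    direction [a], and those opposite. *)
Definition cob phi x s : V := asum (fun a r => phi (mv x a) r - phi x r) s.

Definition alternating phi := forall x s1 a b s2, cube x (s1 ++ [:: a, b & s2]) ->
  phi x (s1 ++ [:: a, b & s2]) = - phi x (s1 ++ [:: b, a & s2]).

Lemma cube_facet x s a r : cube x s -> perm_eq (a :: r) s ->
  cube x r /\ cube (mv x a) r.
Proof.
move=> xs ar; have xar : cube x (a :: r).
  by apply: cube_perm xs _; rewrite perm_sym.
by split; [exact: cube_near xar|exact: cube_far].
Qed.

Lemma cob_ext phi psi x s : cube x s ->
  (forall y r, cube y r -> (size r).+1 = size s -> phi y r = psi y r) ->
  cob phi x s = cob psi x s.
Proof.
move=> xs E; apply: asum_ext => a r ar; have [xr xar] := cube_facet xs ar.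
by rewrite !E // -(perm_size ar).
Qed.

Lemma cobB phi psi x s :
  cob (fun x s => phi x s - psi x s) x s = cob phi x s - cob psi x s.
Proof.
rewrite -asumB; apply: asum_ext => a r _.
by rewrite subr_subr_swap.
Qed.

Lemma cob_alt phi : alternating phi -> alternating (cob phi).
Proof.
move=> pa x s1 a b s2 xs; apply: asum_alt => c r1 r2 cr.
have [xr xcr] := cube_facet xs cr.
by rewrite (pa _ _ _ _ _ xr) (pa _ _ _ _ _ xcr) opprB opprK addrC.
Qed.

Lemma cob_cob phi x s : cube x s -> cob (cob phi) x s = 0.
Proof.
move=> xs; rewrite /cob.
rewrite (asum_ext (F' := fun a r => asum (fun b t =>
  phi (mv (mv x a) b) t - phi (mv x a) t - (phi (mv x b) t - phi x t)) r)); last first.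
  by move=> a r _; rewrite -asumB.
apply: asum_sym => a b r abr.
have xabr : cube x [:: a, b & r] by apply: cube_perm xs _; rewrite perm_sym.
by rewrite (mvC xabr) subr_subr_swap.
Qed.

Lemma cob_closed (S : zmodClosed V) phi x s : cube x s ->
  (forall y r, cube y r -> phi y r \in S) -> cob phi x s \in S.
Proof.
move=> xs pS; apply: asum_closed => a r ar; have [xr xar] := cube_facet xs ar.
by rewrite rpredB ?pS.
Qed.

(** By alternation, a cochain vanishes as soon as it does when a given
    direction comes first. *)
Lemma alt_front phi x c : alternating phi ->
  (forall r, cube x (c :: r) -> phi x (c :: r) = 0) ->
  forall s, cube x s -> c \in s -> phi x s = 0.
Proof.
move=> pa p0 s xs /splitPr cs; case: cs xs => s1 s2.
elim/last_ind: s1 s2 => [|s1 a IH] s2 /=; first exact: p0.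
rewrite cat_rcons => xs; rewrite pa // IH ?oppr0 //.
apply: cube_perm xs _; rewrite perm_cat2l; exact: perm_swap2.
Qed.

(** ** Exactness by descent *)

(** Choose at each bad vertex a direction [c x] such that moving along any
    direction either decreases the rank or does not affect the choice. This is a
    discrete flow pushing all cubes to the vertices that are not bad. *)
Section Descent.
Variables (bad : pred X) (c : X -> I) (rk : X -> nat) (drop : X -> I -> bool).
Hypotheses (cube_c : forall x s, bad x -> cube x s -> c x \notin s -> cube x (c x :: s))
  (drop_c : forall x, bad x -> drop x (c x))
  (drop_rk : forall x a s, cube x (a :: s) -> drop x a -> (rk (mv x a) < rk x)%N)
  (dropN : forall x a s, bad x -> cube x (a :: s) -> ~~ drop x a ->
     bad (mv x a) && (c (mv x a) == c x))
  (badN : forall x a s, ~~ bad x -> cube x (a :: s) -> ~~ bad (mv x a)).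
Variables (phi psi0 : X -> seq I -> V).

(** The coboundary equation at the cube [(x, c x :: s)], solved for the value at
    [(x, s)] under the gauge condition that cubes containing the direction
    [c x] have value zero. *)
Fixpoint prim n x s : V :=
  if bad x then
    if c x \in s then 0 else
    if n is n'.+1 then
      prim n' (mv x (c x)) s
      - asum (fun a r => if drop x a then prim n' (mv x a) (c x :: r) else 0) s
      - phi x (c x :: s)
    else 0
  else psi0 x s.

Lemma prim_stable n m x s : cube x s -> (rk x <= n)%N -> (rk x <= m)%N ->
  prim n x s = prim m x s.
Proof.
elim: n m x s => [|n IH] m x s xs xn xm.
  case: m xm => //= m _; case: ifP => // bx; case: ifPn => // cs.
  have := drop_rk (cube_c bx xs cs) (drop_c bx); lia.
case: m xm => [|m] xm /=; case: ifP => // bx; case: ifPn => // cs.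
  have := drop_rk (cube_c bx xs cs) (drop_c bx); lia.
have xcs := cube_c bx xs cs; have lt := drop_rk xcs (drop_c bx).
congr (_ - _ - _); first by apply: IH; [exact: cube_far|lia|lia].
apply: asum_ext => a r ar; case: ifP => // xa.
have xacr : cube x [:: a, c x & r].
  by apply: cube_perm xcs _; rewrite perm_sym perm_insert.
by have lta := drop_rk xacr xa; apply: IH; [exact: cube_far|lia|lia].
Qed.

Let psi x s := prim (rk x) x s.

Lemma primE x s : bad x -> cube x s -> c x \notin s ->
  psi x s = psi (mv x (c x)) s
    - asum (fun a r => if drop x a then psi (mv x a) (c x :: r) else 0) s
    - phi x (c x :: s).
Proof.
move=> bx xs cs; have xcs := cube_c bx xs cs.
have lt := drop_rk xcs (drop_c bx).
rewrite {1}/psi; case E : (rk x) => [|n] /=; first by lia.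
rewrite bx (negbTE cs); congr (_ - _ - _).
  by apply: prim_stable => //; [exact: cube_far|lia].
apply: asum_ext => a r ar; case: ifP => // xa.
have xacr : cube x [:: a, c x & r].
  by apply: cube_perm xcs _; rewrite perm_sym perm_insert.
have lta := drop_rk xacr xa.
by apply: prim_stable => //; [exact: cube_far|lia].
Qed.

Lemma prim_gauge x s : bad x -> c x \in s -> psi x s = 0.
Proof. by rewrite /psi => bx cs; case: (rk x) => [|n] /=; rewrite bx cs. Qed.

Lemma prim_good x s : ~~ bad x -> psi x s = psi0 x s.
Proof. by rewrite /psi => /negbTE bx; case: (rk x) => [|n] /=; rewrite bx. Qed.

Lemma rk_ind (Q : X -> Prop) :
  (forall x, (forall y, (rk y < rk x)%N -> Q y) -> Q x) -> forall x, Q x.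
Proof.
move=> H x; have [n] := ubnP (rk x); elim: n x => // n IH x xn.
by apply: H => y yx; apply: IH; lia.
Qed.

Hypotheses (phi_alt : alternating phi)
  (psi0_alt : forall x s1 a b s2, ~~ bad x -> cube x (s1 ++ [:: a, b & s2]) ->
  psi0 x (s1 ++ [:: a, b & s2]) = - psi0 x (s1 ++ [:: b, a & s2])).

Lemma prim_alt : alternating psi.
Proof.
move=> x; elim/rk_ind: x => x IH s1 a b s2 xs.
case: (boolP (bad x)) => bx; last by rewrite !prim_good // psi0_alt.
have pab : perm_eq (s1 ++ [:: a, b & s2]) (s1 ++ [:: b, a & s2]).
  by rewrite perm_cat2l perm_swap2.
have xs' := cube_perm xs pab.
have [cs|cs] := boolP (c x \in s1 ++ [:: a, b & s2]).
  by rewrite !prim_gauge ?oppr0 // -(perm_mem pab).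
have cs' : c x \notin s1 ++ [:: b, a & s2] by rewrite -(perm_mem pab).
have xcs := cube_c bx xs cs; have lt := drop_rk xcs (drop_c bx).
rewrite (primE bx xs cs) (primE bx xs' cs') (phi_alt (s1 := c x :: s1) xcs) /=.
rewrite (IH _ lt _ _ _ _ (cube_far xcs)).
rewrite asum_alt => [|e r1 r2 er]; first by rewrite !opprK opprB [in RHS]opprB addrC [- _ + _]addrC.
case: ifP => xe; last by rewrite oppr0.
have xecr : cube x [:: e, c x & r1 ++ [:: a, b & r2]].
  by apply: cube_perm xcs _; rewrite perm_sym perm_insert.
by rewrite (IH _ (drop_rk xecr xe) (c x :: r1)) //; exact: cube_far xecr.
Qed.

Hypotheses (phi_closed : forall x s, cube x s -> cob phi x s = 0)
  (psi0P : forall x s, ~~ bad x -> cube x s -> cob psi0 x s = phi x s).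

Lemma cob_prim x s : cube x s -> cob psi x s = phi x s.
Proof.
move=> xs; apply/eqP; rewrite -subr_eq0; apply/eqP; move: x s xs.
pose w x s := cob psi x s - phi x s; rewrite -/w.
have w_alt : alternating w.
  move=> x s1 a b s2 xs; rewrite /w (cob_alt prim_alt xs) (phi_alt xs).
  by rewrite opprB opprK addrC.
have w_gauge x s : bad x -> cube x s -> c x \in s -> w x s = 0.
  move=> bx xs cs; apply: (alt_front w_alt _ xs cs) => {xs cs}r xcr.
  have xr := cube_near xcr.
  have cr : c x \notin r by have := cube_uniq xcr => /= /andP[].
  rewrite /w /cob /= (primE bx xr cr).
  rewrite (asum_ext (F' := fun a t => if drop x a then psi (mv x a) (c x :: t) else 0)).
    exact: sub_sub3.
  move=> a t art; rewrite (prim_gauge (s := _ :: _) bx) ?mem_head // subr0.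
  case: ifPn => // xa.
  have xact : cube x [:: a, c x & t].
    by apply: cube_perm xcr _; rewrite perm_sym perm_insert.
  have /andP[ba /eqP cE] := dropN bx xact xa.
  by rewrite prim_gauge // cE mem_head.
have w_closed x s : cube x s -> cob w x s = 0.
  by move=> xs; rewrite cobB cob_cob // phi_closed // subrr.
elim/rk_ind => x IH s xs; case: (boolP (bad x)) => bx; last first.
  rewrite /w -(psi0P bx xs); apply/eqP; rewrite subr_eq0; apply/eqP.
  apply: asum_ext => a r ar; rewrite !prim_good //; apply: badN bx _.
  by apply: cube_perm xs _; rewrite perm_sym; exact: ar.
have [cs|cs] := boolP (c x \in s); first exact: w_gauge.
have xcs := cube_c bx xs cs; have := w_closed _ _ xcs.
have wc : w (mv x (c x)) s = 0 := IH _ (drop_rk xcs (drop_c bx)) _ (cube_far xcs).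
rewrite /cob /= wc.
rewrite (asum_ext (F' := fun _ _ => 0)) ?asum0.
  by rewrite sub0r subr0 => /eqP; rewrite oppr_eq0 => /eqP.
move=> a t art; have xact : cube x [:: a, c x & t].
  by apply: cube_perm xcs _; rewrite perm_sym perm_insert.
have xct : cube x (c x :: t).
  by apply: cube_near; apply: cube_perm xact _; exact: perm_refl.
rewrite (w_gauge _ _ bx xct) ?mem_head // subr0.
have [xa|xa] := boolP (drop x a).
  by apply: IH; [exact: drop_rk xact xa|exact: cube_far].
have /andP[ba /eqP cE] := dropN bx xact xa.
by apply: w_gauge => //; [exact: cube_far|rewrite cE mem_head].
Qed.

Lemma prim_closed (S : zmodClosed V) x s :
  (forall y t, cube y t -> phi y t \in S) ->
  (forall y t, ~~ bad y -> cube y t -> psi0 y t \in S) -> cube x s -> psi x s \in S.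
Proof.
move=> pS p0S; move: s; elim/rk_ind: x => x IH s xs.
case: (boolP (bad x)) => bx; last by rewrite prim_good // p0S.
have [cs|cs] := boolP (c x \in s); first by rewrite prim_gauge // rpred0.
have xcs := cube_c bx xs cs; rewrite primE // !rpredB ?pS //.
  by apply: IH; [exact: drop_rk xcs (drop_c bx)|exact: cube_far].
apply: asum_closed => a r ar; case: ifP => xa; last exact: rpred0.
have xacr : cube x [:: a, c x & r].
  by apply: cube_perm xcs _; rewrite perm_sym perm_insert.
by apply: IH; [exact: drop_rk xacr xa|exact: cube_far].
Qed.

(** In a bad vertex the equation [cob psi x s = phi x s] holds for [s] containing
    [c x] by definition of [prim], and then for the other [s] by induction on the
    rank, since the difference of the two sides is a cocycle. *)
Lemma descent (S : zmodClosed V) :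
  (forall x s, cube x s -> phi x s \in S) ->
  (forall x s, ~~ bad x -> cube x s -> psi0 x s \in S) ->
  exists psi, [/\ alternating psi, forall x s, cube x s -> cob psi x s = phi x s &
    forall x s, cube x s -> psi x s \in S].
Proof.
move=> pS p0S; exists psi; split; [exact: prim_alt|exact: cob_prim|].
by move=> x s; exact: prim_closed.
Qed.

End Descent.
End Cubes.

Lemma mem_headW (K : eqType) (z : K) (s : seq K) k : k \in s -> head z s \in s.
Proof. by case: s => //= a s _; rewrite mem_head. Qed.

Lemma in_seq_fset (K : choiceType) (s : seq K) k : (k \in [fset z in s]) = (k \in s).
Proof. by rewrite inE. Qed.

(** * Contractibility of the cube complex *)
Section Contractible.
Variables (d : nat) (T : regular_tree d) (v0 : T).
Hypothesis d2 : 2 <= d.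
Notation N := (neretin T).
Notation par := (par v0).
Notation ideal := (ideal v0).
Notation bd := (bd v0).
Notation ch := (ch v0).
Notation bball := (bball v0).
Notation mk := (mkball v0 1%g).
Notation std := (std v0 1%g).
Notation vert := (@vert d T v0).
Notation good := (@good d T v0).
Implicit Types (F J : {fset T}) (l e : T) (a b c : bball) (x y : {fset bball}).

Let d0 : 0 < d. Proof. by apply: leq_trans d2. Qed.

(** The cube with bottom vertex [x] and directions [s]: its vertices are obtained
    from [x] by subdividing some of the balls in [s]. *)
Definition cube x (s : seq bball) := [/\ vert x, uniq s & {subset s <= x}].

Lemma cube_uniq x s : cube x s -> uniq s. Proof. by case. Qed.

Lemma cube_vert x s : cube x s -> vert x. Proof. by case. Qed.

Lemma cube0 x : vert x -> cube x [::]. Proof. by []. Qed.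

Lemma cube_perm x s t : cube x s -> perm_eq s t -> cube x t.
Proof.
move=> [vx us sx] st; split=> //; first by rewrite -(perm_uniq st).
by move=> b; rewrite -(perm_mem st); exact: sx.
Qed.

Lemma cube_near x a s : cube x (a :: s) -> cube x s.
Proof.
move=> [vx /= /andP[_ us] sx]; split=> // b bs.
by apply: sx; rewrite in_cons bs orbT.
Qed.

Lemma cube_head x a s : cube x (a :: s) -> a \in x.
Proof. by move=> [_ _]; apply; rewrite mem_head. Qed.

Lemma cube_far x a s : cube x (a :: s) -> cube (subdivide x a) s.
Proof.
move=> xas; have [vx /= /andP[as_ us] sx] := xas; have ax := cube_head xas.
split=> //; first exact: vert_subdivide.
move=> b bs; apply: in_subdivide; first by apply: sx; rewrite in_cons bs orbT.
by apply: contraNneq as_ => <-.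
Qed.

Lemma cube_subdivideC x a b s : cube x [:: a, b & s] ->
  subdivide (subdivide x a) b = subdivide (subdivide x b) a.
Proof.
move=> xabs; have [vx /= /andP[+ _] _] := xabs; rewrite inE negb_or => /andP[ab _].
by apply: subdivideC => //; [exact: cube_head xabs|exact: cube_head (cube_near xabs)].
Qed.

(** ** Subtrees containing the root *)

(** The cubes of partitions [std F], described from their top vertices by the
    leaves that may be removed. Seen from there, their two families of facets are
    exchanged, which only changes the sign of the coboundary. *)
Definition extremal J e := [/\ e \in J, e != v0 & forall k, k \in ch e -> k \notin J].

Definition tcube J (s : seq T) := [/\ ideal J, uniq s & forall e, e \in s -> extremal J e].

Lemma ideal_del J (s : seq T) : ideal J -> (forall e, e \in s -> extremal J e) ->
  ideal (J `\` [fset e in s]).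
Proof.
move=> iJ sJ; split=> [|z].
  by rewrite in_fsetD in_seq_fset iJ.1 andbT; apply/negP => /sJ[_ /eqP].
rewrite !in_fsetD !in_seq_fset => /andP[zs zJ]; rewrite iJ.2 // andbT.
apply/negP => /sJ[_ pv /(_ z)]; rewrite in_ch eqxx andbT zJ => H.
have zv : z != v0 by apply: contraNneq pv => ->; rewrite par_v0.
by have := H zv.
Qed.

Lemma extremal_par J (s : seq T) e : ideal J -> (forall e, e \in s -> extremal J e) ->
  e \in s -> par e \notin s.
Proof.
move=> iJ sJ es; have [eJ ev _] := sJ e es; apply/negP => /sJ[_ _ /(_ e)].
by rewrite mem_ch_par // eJ => /(_ isT).
Qed.

Lemma extremal_bd J (s : seq T) e : ideal J -> (forall e, e \in s -> extremal J e) ->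
  e \in s -> e \in bd (J `\` [fset e in s]).
Proof.
move=> iJ sJ es; have [eJ _ _] := sJ e es.
rewrite in_bd; last exact: ideal_del.
rewrite !in_fsetD !in_seq_fset es /= iJ.2 // andbT.
exact: extremal_par iJ sJ es.
Qed.

(** A vertex of maximal depth will do. *)
Lemma exists_extremal J : ideal J -> J != [fset v0] -> exists e, extremal J e.
Proof.
move=> iJ nJ; have vJ := iJ.1.
pose e := [arg max_(i > FSetSub vJ) depth v0 (val i)].
have eP k : k \in J -> depth v0 k <= depth v0 (val e).
  by move=> kJ; rewrite /e; case: arg_maxnP => //= i _ /(_ (FSetSub kJ) isT).
exists (val e); split; first exact: valP.
- apply: contra nJ => /eqP ev; rewrite eqEfsubset fsub1set vJ andbT.
  apply/fsubsetP => k /eP; rewrite ev depth_v0 leqn0 depth_eq0.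
  by rewrite inE.
- by move=> k /depth_ch kd; apply/negP => /eP; rewrite kd ltnn.
Qed.

Lemma tcube_perm J s t : tcube J s -> perm_eq s t -> tcube J t.
Proof.
move=> [iJ us sJ] st; split=> //; first by rewrite -(perm_uniq st).
by move=> b; rewrite -(perm_mem st); exact: sJ.
Qed.

Lemma tcube_near J e s : tcube J (e :: s) -> tcube J s.
Proof.
move=> [iJ /= /andP[_ us] sJ]; split=> // b bs.
by apply: sJ; rewrite in_cons bs orbT.
Qed.

Lemma fsetD1_seq J e : J `\ e = J `\` [fset k in [:: e]].
Proof. by apply/fsetP => k; rewrite in_fsetD1 in_fsetD in_seq_fset inE. Qed.

Lemma tcube_far J e s : tcube J (e :: s) -> tcube (J `\ e) s.
Proof.
move=> Jes; have [iJ /= /andP[es us] sJ] := Jes; split=> //.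
  rewrite fsetD1_seq; apply: ideal_del => // k; rewrite inE => /eqP ->.
  by apply: sJ; rewrite mem_head.
move=> k ks; have [kJ kv kc] : extremal J k by apply: sJ; rewrite in_cons ks orbT.
split=> //; first by rewrite !inE kJ andbT; apply: contraNneq es => <-.
by move=> m /kc mJ; rewrite !inE negb_and mJ orbT.
Qed.

Lemma tcube_delC J e e' s : tcube J [:: e, e' & s] -> J `\ e `\ e' = J `\ e' `\ e.
Proof. by move=> _; rewrite !fsetDDl fsetUC. Qed.

Lemma tcube_cube J s : tcube J s -> cube (std (J `\` [fset e in s])) (map mk s).
Proof.
move=> [iJ us sJ]; split; first by apply: vert_std; exact: ideal_del.
  rewrite map_inj_in_uniq // => e e' es e's /(mkball_inj d0) -> //.
  by case: (sJ e es).
move=> _ /mapP[e es ->]; apply/in_stdP; exists e => //.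
exact: extremal_bd.
Qed.

Lemma std_inj F F' : ideal F -> ideal F' -> std F = std F' -> F = F'.
Proof.
move=> iF iF' E; apply: (bd_inj iF iF'); apply/fsetP => l.
have [->|lv] := eqVneq l v0; last by rewrite -!(mkball_std d2 1%g) // E.
by rewrite !in_bd // iF.1 iF'.1.
Qed.

Definition tree_of x : {fset T} := xget fset0 [set F | ideal F /\ x = std F]%classic.

Lemma tree_of_std F : ideal F -> tree_of (std F) = F.
Proof.
move=> iF; rewrite /tree_of; case: xgetP => [F' -> [iF' /esym /std_inj]|/(_ F)].
  exact.
by case.
Qed.

Definition vertex_of b : T := xget v0 [set l | l != v0 /\ b = mk l]%classic.

Lemma vertex_of_mk l : l != v0 -> vertex_of (mk l) = l.
Proof.
move=> lv; rewrite /vertex_of; case: xgetP => [l' -> [l'v /esym /(mkball_inj d0)]|/(_ l)].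
  exact.
by case.
Qed.

Lemma cube_std F s : ideal F -> cube (std F) s -> let t := map vertex_of s in
  [/\ map mk t = s, uniq t & {subset t <= bd F}].
Proof.
move=> iF [_ us sF] t.
have E : map mk t = s.
  rewrite -map_comp -[RHS]map_id; apply/eq_in_map => b /sF /in_stdP[l lF ->] /=.
  by rewrite vertex_of_mk // (bd_neq0 iF).
split=> //; first by move: us; rewrite -{1}E => /map_uniq.
move=> _ /mapP[b /sF /in_stdP[l lF ->] ->].
by rewrite vertex_of_mk // (bd_neq0 iF).
Qed.

Lemma tcube_add F t : ideal F -> uniq t -> {subset t <= bd F} ->
  tcube (F `|` [fset e in t]) t /\ (F `|` [fset e in t]) `\` [fset e in t] = F.
Proof.
move=> iF ut tF; split; last first.
  apply/fsetP => k; rewrite in_fsetD in_fsetU in_seq_fset.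
  case kt : (k \in t) => /=; last by rewrite orbF.
  by apply/esym/negbTE; exact: bd_notin (tF k kt).
split=> //.
  split; first by rewrite in_fsetU iF.1.
  move=> z; rewrite !in_fsetU !in_seq_fset => /orP[/iF.2 ->//|/tF].
  by rewrite in_bd // => /andP[_ ->].
move=> e et; have eB := tF e et; split.
- by rewrite in_fsetU in_seq_fset et orbT.
- exact: bd_neq0 eB.
move=> k ke; have eF := bd_notin eB; rewrite in_fsetU in_seq_fset negb_or.
apply/andP; split; first by apply: contra eF => /iF.2; rewrite (par_ch ke).
by apply: contra eF => /tF; rewrite in_bd // (par_ch ke) => /andP[].
Qed.

(** ** Exactness *)
Section Exactness.
Variables (V : zmodType) (S : zmodClosed V).
Implicit Types (phi psi : {fset bball} -> seq bball -> V).
Local Open Scope ring_scope.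

Notation cobd := (cob (@subdivide d T v0)).
Notation altd := (alternating cube).

Lemma seq_fset_perm (s t : seq T) : perm_eq s t -> [fset e in s] = [fset e in t].
Proof. by move=> st; apply/fsetP => k; rewrite !in_seq_fset (perm_mem st). Qed.

(** On partitions into balls of the tree, push down: remove extremal vertices
    until only the root is left. *)
Lemma exact_std phi : altd phi -> (forall x s, cube x s -> cobd phi x s = 0) ->
  (forall x, vert x -> phi x [::] = 0) -> (forall x s, cube x s -> phi x s \in S) ->
  exists psi, [/\ forall F s1 a b s2, ideal F -> cube (std F) (s1 ++ [:: a, b & s2]) ->
      psi (std F) (s1 ++ [:: a, b & s2]) = - psi (std F) (s1 ++ [:: b, a & s2]),
    forall F s, ideal F -> cube (std F) s -> cobd psi (std F) s = phi (std F) s &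
    forall F s, ideal F -> cube (std F) s -> psi (std F) s \in S].
Proof.
move=> pa pc p0 pS.
pose phi' J (s : seq T) := phi (std (J `\` [fset e in s])) (map mk s).
pose mv J e : {fset T} := J `\ e.
have cE J : exists e, ideal J /\ J != [fset v0] -> extremal J e.
  have [iJ|iJ] := pselect (ideal J); last by exists v0 => -[].
  have [->|nJ] := eqVneq J [fset v0]; first by exists v0 => -[].
  by have [e eJ] := exists_extremal iJ nJ; exists e.
have [c cP] := boolp.choice cE.
have phi'_alt : alternating tcube phi'.
  move=> J s1 a b s2 Js; have pab : perm_eq (s1 ++ [:: a, b & s2]) (s1 ++ [:: b, a & s2]).
    by rewrite perm_cat2l perm_swap2.
  rewrite /phi' -(seq_fset_perm pab); have := tcube_cube Js.
  by rewrite !map_cat /= => Js'; rewrite (pa _ _ _ _ _ Js').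
have cobE J s : tcube J s -> cob mv phi' J s =
    - cobd phi (std (J `\` [fset e in s])) (map mk s).
  move=> Js; have [iJ us sJ] := Js.
  rewrite /cob asum_map -[RHS]add0r -(asum0 V s) -asumB.
  apply: asum_ext => e r er; rewrite sub0r opprB /phi' /mv.
  have es : e \in s by rewrite -(perm_mem er) mem_head.
  have er' k : (k \in s) = (k == e) || (k \in r) by rewrite -(perm_mem er) inE.
  have u : e \notin r by move: us; rewrite -(perm_uniq er) => /= /andP[].
  rewrite subdivide_std //; [|exact: ideal_del|exact: extremal_bd].
  congr (phi (std _) _ - phi (std _) _); apply/fsetP => k.
    by rewrite !in_fsetD in_fset1 !in_seq_fset er' negb_or -andbA andbCA.
  rewrite !in_fsetU !in_fsetD !in_seq_fset er' in_fset1.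
  have [->|] //= := eqVneq k e; by rewrite u; case: (sJ e es).
pose bad J := J != [fset v0].
have hc J s : bad J -> tcube J s -> c J \notin s -> tcube J (c J :: s).
  move=> bJ [iJ us sJ] cs; split=> //; first by rewrite /= cs.
  by move=> e; rewrite inE => /orP[/eqP ->|/sJ //]; exact: cP.
have hrk J e s : tcube J (e :: s) -> true -> (#|` mv J e| < #|` J|)%N.
  move=> [_ _ /(_ e)]; rewrite mem_head => /(_ isT)[eJ _ _] _.
  by rewrite /mv (cardfsD1 e J) eJ.
have hgood J e s : ~~ bad J -> tcube J (e :: s) -> False.
  rewrite negbK => /eqP -> [_ _ /(_ e)]; rewrite mem_head => /(_ isT)[].
  by rewrite inE => ->.
have hnil J s : ~~ bad J -> tcube J s -> s = [::].
  by case: s => // e s bJ /(hgood _ _ _ bJ).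
have phi'_closed J s : tcube J s -> cob mv phi' J s = 0.
  by move=> Js; rewrite cobE // pc ?oppr0 //; exact: tcube_cube.
have psi0P J s : ~~ bad J -> tcube J s -> cob mv (fun _ _ => 0) J s = phi' J s.
  move=> bJ Js; rewrite (hnil _ _ bJ Js) /= /phi' p0 //.
  by have [iJ _ _] := Js; apply: vert_std; exact: ideal_del.
have phi'S J s : tcube J s -> phi' J s \in S by move=> /tcube_cube /pS.
have [psi [psi_alt psiE psiS]] := @descent _ _ tcube mv
  (fun J s Js => let: And3 _ us _ := Js in us)
  tcube_perm tcube_near tcube_far tcube_delC V bad c (fun J => #|` J|)
  (fun _ _ => true) hc (fun _ _ => isT) hrk (fun _ _ _ _ _ => ltac:(by []))
  (fun J e s bJ Js => False_ind _ (hgood J e s bJ Js)) phi' (fun _ _ => 0)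
  phi'_alt (fun _ _ _ _ _ _ _ => esym (oppr0 V)) phi'_closed psi0P S phi'S
  (fun _ _ _ _ => rpred0 S).
pose psi0 x (s : seq bball) := let t := map vertex_of s in
  - psi (tree_of x `|` [fset e in t]) t.
exists psi0; split=> [F s1 a b s2 iF Fs|F s iF Fs|F s iF Fs].
- have [_ ut tF] := cube_std iF Fs; have [Jt _] := tcube_add iF ut tF.
  have pab : perm_eq (map vertex_of (s1 ++ [:: a, b & s2]))
      (map vertex_of (s1 ++ [:: b, a & s2])).
    by apply: perm_map; rewrite perm_cat2l perm_swap2.
  rewrite /psi0 tree_of_std // -(seq_fset_perm pab).
  by move: Jt; rewrite !map_cat /= => Jt; rewrite (psi_alt _ _ _ _ _ Jt).
- have [sE ut tF] := cube_std iF Fs; have [Jt JE] := tcube_add iF ut tF.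
  move: sE Jt JE ut tF; set t := map vertex_of s; set J := F `|` _ => sE Jt JE ut tF.
  transitivity (phi' J t); last by rewrite /phi' JE sE.
  rewrite -psiE // -[X in cobd _ _ X]sE /cob asum_map; apply: asum_ext => e r er.
  have rt k : (k \in t) = (k == e) || (k \in r) by rewrite -(perm_mem er) inE.
  have eF : e \in bd F by apply: tF; rewrite rt eqxx.
  have rF : {subset r <= bd F} by move=> k kr; apply: tF; rewrite rt kr orbT.
  have u : e \notin r by move: ut; rewrite -(perm_uniq er) => /= /andP[].
  have rE : map vertex_of (map mk r) = r.
    rewrite -map_comp -[RHS]map_id; apply/eq_in_map => k /rF kF /=.
    by rewrite vertex_of_mk // (bd_neq0 iF).
  rewrite subdivide_std // /psi0 !tree_of_std //; last exact: ideal_add.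
  rewrite rE opprK addrC; congr (psi _ _ - psi _ _); apply/fsetP => k.
    rewrite in_fsetD1 !in_fsetU !in_seq_fset rt.
    have [->|//] := eqVneq k e.
    by rewrite (negbTE (bd_notin eF)) (negbTE u).
  by rewrite !in_fsetU !in_seq_fset rt in_fset1 orbCA orbA.
- have [_ ut tF] := cube_std iF Fs; have [Jt _] := tcube_add iF ut tF.
  by rewrite /psi0 tree_of_std // rpredN psiS.
Qed.

Definition bad_balls x : {fset bball} := [fset b in x | ~~ `[< good b >]].

Lemma in_bad_balls x b : (b \in bad_balls x) = (b \in x) && ~~ `[< good b >].
Proof. by rewrite !inE. Qed.

Lemma bad_balls_subdivide x a : vert x -> good a -> bad_balls (subdivide x a) = bad_balls x.
Proof.
move=> vx ga; apply/fsetP => b; rewrite !in_bad_balls !inE.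
have [gb|gb] := boolP `[< good b >]; first by rewrite !andbF.
rewrite !andbT; have -> : (b \in bch a) = false.
  by apply: contraNF gb => ba; apply/asboolP; exact: good_bch ga ba.
rewrite orbF; case: eqP => // bE; move: gb; rewrite bE => /asboolP; by case.
Qed.

Lemma std_of_bad_balls0 x : vert x -> bad_balls x = fset0 -> exists2 F, ideal F & x = std F.
Proof.
move=> vx cx; apply: (std_of_good d2 vx) => b bx; apply: contrapT => gb.
have : b \in bad_balls x by rewrite in_bad_balls bx; apply/asboolP.
by rewrite cx inE.
Qed.

(** Push up: subdivide the balls that are not good until all are. Subdividing
    good balls does not affect the choice of the next bad one. *)
Lemma exact_cube phi : altd phi -> (forall x s, cube x s -> cobd phi x s = 0) ->
  (forall x, vert x -> phi x [::] = 0) -> (forall x s, cube x s -> phi x s \in S) ->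
  exists psi, [/\ altd psi, forall x s, cube x s -> cobd psi x s = phi x s &
    forall x s, cube x s -> psi x s \in S].
Proof.
move=> pa pc p0 pS; have [psi0 [psi0_alt psi0E psi0S]] := exact_std pa pc p0 pS.
pose bad x := bad_balls x != fset0.
pose c x : bball := head (mk v0) (bad_balls x).
pose drop x (a : bball) := ~~ `[< good a >].
have cP x : bad x -> c x \in bad_balls x.
  by move=> /fset0Pn[b]; exact: (@mem_headW _ _ (enum_fset (bad_balls x))).
have hc x s : bad x -> cube x s -> c x \notin s -> cube x (c x :: s).
  move=> bx [vx us sx] cs; split=> //; first by rewrite /= cs.
  move=> b; rewrite inE => /orP[/eqP ->|/sx //].
  by have := cP x bx; rewrite in_bad_balls => /andP[].
have hd x : bad x -> drop x (c x).
  by move=> /cP; rewrite in_bad_balls => /andP[].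
have hrk x a s : cube x (a :: s) -> drop x a -> (rank (subdivide x a) < rank x)%N.
  move=> xas /asboolP ga; apply: rank_subdivide => //; first exact: cube_vert xas.
  exact: cube_head xas.
have hN x a s : bad x -> cube x (a :: s) -> ~~ drop x a ->
    bad (subdivide x a) && (c (subdivide x a) == c x).
  move=> bx xas; rewrite negbK => /asboolP ga.
  by rewrite /bad /c (bad_balls_subdivide (cube_vert xas) ga) eqxx andbT.
have std_good x : vert x -> ~~ bad x -> exists2 F, ideal F & x = std F.
  by move=> vx; rewrite negbK => /eqP; exact: std_of_bad_balls0.
have hb x a s : ~~ bad x -> cube x (a :: s) -> ~~ bad (subdivide x a).
  move=> bx xas; have vx := cube_vert xas; have [F iF xE] := std_good x vx bx.
  rewrite /bad bad_balls_subdivide //; apply: (good_std iF).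
  by rewrite -xE; exact: cube_head xas.
have [|||psi ?] := @descent _ _ cube (@subdivide d T v0) cube_uniq cube_perm cube_near
  cube_far cube_subdivideC V bad c (@rank d T v0) drop hc hd hrk hN hb phi psi0 pa _ pc _ S pS _.
- move=> x s1 a b s2 bx xs; have [F iF xE] := std_good x (cube_vert xs) bx.
  by rewrite xE in xs *; exact: psi0_alt.
- move=> x s bx xs; have [F iF xE] := std_good x (cube_vert xs) bx.
  by rewrite xE in xs *; exact: psi0E.
- move=> x s bx xs; have [F iF xE] := std_good x (cube_vert xs) bx.
  by rewrite xE in xs *; exact: psi0S.
by exists psi.
Qed.

(** Both pushes together connect any partition to the one at the root. *)
Lemma connected_cube (f : {fset bball} -> V) :
  (forall x a, vert x -> a \in x -> f (subdivide x a) = f x) ->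
  forall x, vert x -> f x = f (std [fset v0]).
Proof.
move=> fE; elim/(rk_ind (rk := @rank d T v0)) => x IH vx.
have [cx|/fset0Pn[b]] := eqVneq (bad_balls x) fset0; last first.
  rewrite in_bad_balls => /andP[bx /asboolP gb].
  rewrite -(fE _ _ vx bx) IH //; last exact: vert_subdivide.
  exact: rank_subdivide.
have [F iF -> {x IH vx cx}] := std_of_bad_balls0 vx cx.
elim/(rk_ind (rk := fun F => #|` F|)): F iF => F IH iF.
have [->//|nF] := eqVneq F [fset v0].
have [e [eF ev eC]] := exists_extremal iF nF.
have sF k : k \in [:: e] -> extremal F k by rewrite inE => /eqP ->.
have iF' := ideal_del iF sF; have eB := extremal_bd iF sF (mem_head _ _).
rewrite -fsetD1_seq in iF' eB.
have ex : mk e \in std (F `\ e) by apply/in_stdP; exists e.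
rewrite -(IH _ _ iF') -1?(fE _ _ (vert_std _ iF') ex) ?subdivide_std ?fsetD1K //.
by rewrite (cardfsD1 e F) eF.
Qed.

End Exactness.
End Contractible.

(** * Invariant means on compact groups *)
Section InvariantMean.
Local Open Scope classical_set_scope.
Local Open Scope ring_scope.
Variables (G : topologicalGroupType) (R : realType) (K : set G).
Implicit Types (H : set G) (f h : G -> R) (u v g : G).
Local Notation "x ** y" := (x * y)%g (at level 40, left associativity).
Local Notation e := (1%g : G).

Definition open_subgroup H := [/\ open H, H e, forall u v, H u -> H v -> H (u ** v) &
  forall u, H u -> H (u^-1)%g].

Definition lcos u H : set G := [set v | H ((u^-1)%g ** v)].

Hypotheses (cK : compact K) (K1 : K e)
  (KM : forall u v, K u -> K v -> K (u ** v)) (KV : forall u, K u -> K (u^-1)%g).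
Hypothesis basis : forall U, nbhs e U -> exists2 H, open_subgroup H & H `<=` U.

Lemma lcos_open u H : open_subgroup H -> open (lcos u H).
Proof. by case=> oH _ _ _; apply: open_comp oH => x _; exact: mulgl_continuous. Qed.

Lemma lcos_refl u H : open_subgroup H -> lcos u H u.
Proof. by case=> _ H1 _ _; rewrite /lcos /= mulVg. Qed.

Lemma lcos_eq u v H : open_subgroup H -> lcos u H v -> lcos u H = lcos v H.
Proof.
case=> _ _ HM HV uv; apply/seteqP; split=> w; rewrite /lcos /= => uw.
  have -> : (v^-1)%g ** w = (((u^-1)%g ** v)^-1)%g ** ((u^-1)%g ** w).
    by rewrite invgM invgK -mulgA mulVKg.
  by apply: HM => //; exact: HV.
have -> : (u^-1)%g ** w = ((u^-1)%g ** v) ** ((v^-1)%g ** w).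
  by rewrite -mulgA mulVKg.
exact: HM.
Qed.

Definition cosets H : {fset set G} := fset_set [set lcos u H | u in K].

Lemma cosets_finite H : open_subgroup H -> finite_set [set lcos u H | u in K].
Proof.
move=> oH; pose F : set_system {fset set G} :=
  filter_from setT (fun D0 => [set D | D0 `<=` D]%fset).
have FF : Filter F.
  apply: filter_from_filter; first by exists fset0.
  move=> D D' _ _; exists (D `|` D')%fset => // E /fsubUsetP[DE D'E]; by split.
have : \forall D \near F, K `<=` (fun u => lcos u H \in D).
  apply: ((compact_near_coveringP K).1 cK _ F (fun D u => lcos u H \in D) FF) => u Ku.
  exists (lcos u H, [set D : {fset set G} | lcos u H \in D]) => /=.
    split; first by apply: open_nbhs_nbhs; split; [exact: lcos_open|exact: lcos_refl].
    by exists [fset lcos u H]%fset => // D; rewrite /= fsub1set.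
  by move=> [v D] /= [uv uD]; rewrite -(lcos_eq oH uv).
move=> [D0 _ /(_ D0 (fsubset_refl _)) KD].
apply: (@sub_finite_set _ _ [set` D0]); last exact: finite_fset.
by move=> _ [u Ku <-]; exact: KD.
Qed.

Lemma in_cosetsP H w : open_subgroup H ->
  reflect (exists2 u, K u & w = lcos u H) (w \in cosets H).
Proof.
move=> oH; rewrite in_fset_set; last exact: cosets_finite.
by apply: (iffP idP); rewrite inE => -[u Ku ?]; exists u.
Qed.

Definition rep w : G := xget e (w `&` K).

Lemma repP H w : open_subgroup H -> w \in cosets H -> K (rep w) /\ w = lcos (rep w) H.
Proof.
move=> oH /(in_cosetsP _ oH)[u Ku wE].
have : (w `&` K) (rep w).
  by apply: xgetPex; exists u; split => //; rewrite wE; exact: lcos_refl.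
move: (rep w) => r []; rewrite wE => ur Kr; split=> //; exact: lcos_eq.
Qed.

(** A Riemann sum for the Haar measure of [K]. *)
Definition avg f H : R := (\sum_(w <- cosets H) f (rep w)) / (#|` cosets H|)%:R.

Lemma cosets_gt0 H : open_subgroup H -> (0 < #|` cosets H|)%N.
Proof.
move=> oH; rewrite cardfs_gt0; apply/fset0Pn; exists (lcos e H).
by apply/in_cosetsP => //; exists e.
Qed.

Lemma sum_cst (I : Type) (r : seq I) (c : R) : \sum_(i <- r) c = c *+ size r.
Proof. by rewrite big_const_seq count_predT iter_addr_0. Qed.

Lemma avgB f h H : avg (fun u => f u - h u) H = avg f H - avg h H.
Proof. by rewrite /avg sumrB mulrBl. Qed.

Lemma avg_le f (c : R) H : open_subgroup H -> (forall u, K u -> `|f u| <= c) ->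
  `|avg f H| <= c.
Proof.
move=> oH fc; have n0 := cosets_gt0 oH.
rewrite /avg normrM normfV normr_nat ler_pdivrMr ?ltr0n //.
apply: (le_trans (ler_norm_sum _ _ _)).
rewrite mulr_natr -sum_cst big_seq [leRHS]big_seq; apply: ler_sum => w wH.
by apply: fc; have [] := repP oH wH.
Qed.

Lemma avg_cst (c : R) H : open_subgroup H -> avg (fun=> c) H = c.
Proof.
move=> oH; rewrite /avg sum_cst -(mulr_natr c) mulfK // pnatr_eq0 -lt0n.
exact: cosets_gt0.
Qed.

(** By compactness of [K] and continuity of the map sending [(u, v)] to
    [f u - f (u * v)] at the points [(u, 1)]. *)
Lemma uniformly_continuous f (c : R) : continuous f -> 0 < c ->
  exists2 H, open_subgroup H & forall u v, K u -> H v -> `|f u - f (u ** v)| < c.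
Proof.
move=> cf c0; suff : nbhs e [set v | forall u, K u -> `|f u - f (u ** v)| < c].
  by move=> /basis[H oH HU]; exists H => // u v Ku /HU; apply.
have : \forall v \near e, K `<=` (fun u => `|f u - f (u ** v)| < c).
  apply: ((compact_near_coveringP K).1 cK _ (nbhs e)
    (fun v u => `|f u - f (u ** v)| < c) _) => u Ku.
  have cg : continuous (fun p : G * G => f p.1 - f (p.1 ** p.2)).
    move=> p; apply: cvgB; apply: continuous_comp; try exact: cf.
      exact: cvg_fst.
    exact: mulg_continuous.
  have /cvgrPdist_lt /(_ _ c0) := cg (u, e).
  by apply: filterS => -[u' v] /=; rewrite mulg1 subrr sub0r normrN.
by apply: filterS => v vU u /vU.
Qed.

(** Translation by [k] permutes the cosets, and moves their representatives within
    a coset. *)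
Lemma avg_mull f k (c : R) H : open_subgroup H -> K k ->
  (forall u v, K u -> H v -> `|f u - f (u ** v)| <= c) ->
  `|avg f H - avg (fun u => f (k ** u)) H| <= c.
Proof.
move=> oH Kk fc; have n0 := cosets_gt0 oH.
pose t g (w : set G) : set G := [set u | w ((g^-1)%g ** u)].
have tE g u : t g (lcos u H) = lcos (g ** u) H.
  by apply/seteqP; split=> v; rewrite /t /lcos /= invgM mulgA.
have tK g : K g -> {in cosets H, forall w, t g w \in cosets H}.
  move=> Kg w /(in_cosetsP _ oH)[u Ku ->]; rewrite tE.
  by apply/in_cosetsP => //; exists (g ** u) => //; exact: KM.
have tC g : cancel (t g) (t (g^-1)%g).
  by move=> w; apply/seteqP; split=> u; rewrite /t /= invgK mulgA mulVg mul1g.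
have reindex : \sum_(w <- cosets H) f (rep w) = \sum_(w <- cosets H) f (rep (t k w)).
  rewrite -[RHS](big_map (t k) xpredT (fun w => f (rep w))).
  apply: perm_big; apply: uniq_perm; first exact: fset_uniq.
    by rewrite map_inj_uniq ?fset_uniq //; exact: can_inj (tC k).
  move=> w; apply/idP/mapP => [wH|[w' w'H ->]]; last exact: tK.
  exists (t (k^-1)%g w); first by apply: tK => //; exact: KV.
  by have := tC (k^-1)%g w; rewrite invgK.
rewrite /avg reindex -mulrBl -sumrB normrM normfV normr_nat ler_pdivrMr ?ltr0n //.
apply: (le_trans (ler_norm_sum _ _ _)).
rewrite mulr_natr -sum_cst big_seq [leRHS]big_seq; apply: ler_sum => w wH.
have [Kr wE] := repP oH wH; have [Kt tE'] := repP oH (tK k Kk w wH).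
have : t k w (k ** rep w).
  by rewrite /t /= mulKg {1}wE; exact: lcos_refl.
by rewrite {1}tE' => /(fc _ _ Kt); rewrite mulVKg.
Qed.

(** Take the limit of the averages along an ultrafilter finer than the filter of
    small open subgroups; the continuous function being bounded on [K], it
    exists. *)
Lemma invariant_mean : exists m : (G -> R) -> R, [/\
  forall f h, continuous f -> continuous h -> m (fun u => f u - h u) = m f - m h,
  forall c, m (fun=> c) = c,
  forall f c, continuous f -> (forall u, K u -> `|f u| <= c) -> `|m f| <= c &
  forall f k, continuous f -> K k -> m (fun u => f (k ** u)) = m f].
Proof.
pose F0 : set_system (set G) := filter_from open_subgroup
  (fun H0 => [set H | open_subgroup H /\ H `<=` H0]).
have F0F : ProperFilter F0.
  apply: filter_from_proper; last by move=> H oH; exists H; split.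
  apply: filter_from_filter.
    by have [H oH _] := basis (@filterT _ _ _ : nbhs e setT); exists H.
  move=> H H' [oH H1 HM HV] [oH' H1' HM' HV']; exists (H `&` H').
    split; [exact: openI|by []|by move=> u v [? ?] [? ?]; split; [exact: HM|exact: HM']|].
    by move=> u [? ?]; split; [exact: HV|exact: HV'].
  by move=> L [oL LH]; split; split=> // u /LH[].
have [U [UU F0U]] := ultraFilterLemma F0F.
have Uo H0 : open_subgroup H0 -> U [set H | open_subgroup H /\ H `<=` H0].
  by move=> oH0; apply: F0U; exists H0.
have [Hs oHs _] := basis (@filterT _ _ _ : nbhs e setT).
have Uo' : U [set H | open_subgroup H] by apply: filterS (Uo _ oHs) => H [].
pose m f := lim (avg f @ U).
have bounded f : continuous f -> exists c : R, forall u, K u -> `|f u| <= c.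
  move=> cf; have : \forall c \near (+oo : set_system R), K `<=` (fun u => `|f u| <= c).
    apply: ((compact_near_coveringP K).1 cK _ (+oo) (fun c u => `|f u| <= c) _) => u Ku.
    have := cf u => /cvgrPdist_lt /(_ _ ltr01) fu.
    exists ([set u' | `|f u - f u'| < 1], [set c | `|f u| + 1 < c]).
      by split=> //=; exists (`|f u| + 1); split=> //; exact: num_real.
    move=> [u' c] [/= u'1 cu]; apply: ltW; apply: le_lt_trans cu.
    have -> : f u' = f u - (f u - f u') by rewrite opprB addrC subrK.
    by apply: (le_trans (ler_normB _ _)); rewrite lerD2l ltW.
  by move=> /filter_ex[c Kc]; exists c.
have mE f (l : R) : avg f @ U --> l -> m f = l.
  by move=> fl; apply: cvg_lim fl; exact: norm_hausdorff.
have cv f : continuous f -> avg f @ U --> m f.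
  move=> cf; have [c fc] := bounded f cf.
  suff [l fl] : exists l : R, avg f @ U --> l by rewrite (mE _ _ fl).
  have Uc : (avg f @ U) `[- c, c]%classic.
    apply: (@filterS _ U _ _ _ _ Uo') => H oH; rewrite /= in_itv /= -ler_norml.
    exact: avg_le.
  have [l [_ lc]] := @segment_compact R (- c) c (avg f @ U) _ Uc.
  exists l => A lA.
  have [//|nA] := in_ultra_setVsetC (avg f @^-1` A) UU.
  by have [x [? ?]] := lc (~` A) A nA lA.
have mB f h : continuous f -> continuous h -> m (fun u => f u - h u) = m f - m h.
  move=> cf ch; apply: mE; rewrite (_ : avg _ = avg f \- avg h).
    by apply: cvgB; exact: cv.
  by apply/funext => H; exact: avgB.
have mle f c : continuous f -> (forall u, K u -> `|f u| <= c) -> `|m f| <= c.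
  move=> cf fc; apply: (cvgr_to_le (cvg_norm (cv f cf))).
  by apply: filterS Uo' => H oH; exact: avg_le.
exists m; split=> // [c|f k cf Kk].
  apply: mE; apply/cvgrPdist_lt => eps eps0.
  by apply: filterS Uo' => H oH; rewrite avg_cst // subrr normr0.
have ck : continuous (fun u => f (k ** u)).
  by move=> u; apply: continuous_comp; [exact: mulgl_continuous|exact: cf].
apply/eqP; rewrite -subr_eq0 -normr_eq0 -[_ == 0]negbK -normr_gt0 normr_id; apply/negP => c0.
have cv2 : (fun H => `|avg f H - avg (fun u => f (k ** u)) H|) @ U -->
    `|m f - m (fun u => f (k ** u))|.
  by apply: cvg_norm; apply: cvgB; exact: cv.
rewrite distrC in c0; have c20 := divr_gt0 c0 (ltr0n R 2).
have [H0 oH0 fH0] := uniformly_continuous cf c20.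
have : `|m f - m (fun u => f (k ** u))| <= `|m f - m (fun u => f (k ** u))| / 2.
  apply: (cvgr_to_le cv2); apply: filterS (Uo _ oH0) => H [oH HH0].
  by apply: avg_mull => // u v Ku /HH0 Hv; apply: ltW; exact: fH0.
by move: c0; lra.
Qed.

End InvariantMean.

(** * Averaging over the almost automorphisms that carry a partition *)
Lemma continuous_pair (X Y Z : topologicalType) (f : X -> Y) (g : X -> Z) :
  continuous f -> continuous g -> continuous (fun x => (f x, g x)).
Proof. by move=> cf cg x; apply: cvg_pair; [exact: cf|exact: cg]. Qed.

Lemma continuous_idfun (X : topologicalType) : continuous (fun x : X => x).
Proof. by move=> x; exact: cvg_id. Qed.

Lemma continuous_sub (R : realType) (X : topologicalType) (f g : X -> R) :
  continuous f -> continuous g -> continuous (fun x => f x - g x)%R.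
Proof. by move=> cf cg x; apply: cvgB; [exact: cf|exact: cg]. Qed.

Lemma continuous_neg (R : realType) (X : topologicalType) (f : X -> R) :
  continuous f -> continuous (fun x => - f x)%R.
Proof. by move=> cf x; apply: cvgN; exact: cf. Qed.

Section PartitionMean.
Local Open Scope classical_set_scope.
Local Open Scope ring_scope.
Variables (d : nat) (T : regular_tree d) (v0 : T).
Hypothesis d2 : (2 <= d)%N.
Notation N := (neretin T).
Notation Aut := (tree_aut T).
Notation par := (par v0).
Notation ideal := (ideal v0).
Notation bd := (bd v0).
Notation bball := (bball v0).
Notation mk := (mkball v0 1%g).
Notation vert := (@vert d T v0).
Implicit Types (S : {fset T}) (a : Aut) (g h : N).

Let d0 : (0 < d)%N. Proof. by apply: leq_trans d2. Qed.

Lemma finite_sphere n : exists B : {fset T}, forall x, (depth v0 x <= n)%N -> x \in B.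
Proof.
elim: n => [|n [B BP]].
  by exists [fset v0]%fset => x; rewrite leqn0 depth_eq0 inE.
exists (B `|` [fset y in flatten [seq ch v0 x | x <- B]])%fset => x xn.
rewrite inE; have [xB //|xB /=] := boolP (x \in B).
have xv : x != v0 by apply: contraNneq xB => ->; apply: BP; rewrite depth_v0.
rewrite in_seq_fset; apply/flattenP; exists (ch v0 (par x)); last exact: mem_ch_par.
by apply: map_f; apply: BP; move: xn; rewrite (depth_par xv).
Qed.

Lemma depth_aut a x : a v0 = v0 -> depth v0 (a x) = depth v0 x.
Proof.
move=> av; have le (b : Aut) y : b v0 = v0 -> (depth v0 (b y) <= depth v0 y)%N.
  move=> bv; have [p [pp pl <-]] := depthP v0 y.
  rewrite -(size_map b p); apply: depth_min; last by rewrite last_map pl.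
  by rewrite path_map (eq_path (e' := adj)) // => u w; exact: ta_adj.
apply/eqP; rewrite eqn_leq le //= -{1}(ta_funK a x); apply: (le (ta_inverse a)) => /=.
by rewrite -{1}av ta_funK.
Qed.

Lemma ultra_finite (X : Type) (U : set_system X) (f : X -> T) (s : seq T) :
  UltraFilter U -> U [set u | f u \in s] -> exists y, U [set u | f u = y].
Proof.
move=> UU; elim: s => [|y s IH] Us.
  by have [u] := @filter_ex _ _ _ _ Us; rewrite /= in_nil.
have [Uy|Uy] := in_ultra_setVsetC [set u | f u = y] UU; first by exists y.
apply: IH; apply: filterS (filterI Us Uy) => u [/=].
by rewrite inE => /orP[/eqP|].
Qed.

(** The pointwise limit along an ultrafilter exists, all vertices having finite
    orbits, and is an automorphism. *)
Lemma fixes_compact S : v0 \in S -> compact [set a : Aut | fixes S a].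
Proof.
move=> vS; rewrite compact_ultra => U UU US.
have Uv : U [set a : Aut | a v0 = v0] by apply: filterS US => a; apply.
have bE x : exists y, U [set a : Aut | a x = y].
  have [B BP] := finite_sphere (depth v0 x).
  apply: (@ultra_finite _ U (fun a : Aut => a x) B UU); apply: filterS Uv => a av.
  by apply: BP; rewrite depth_aut.
have cE x : exists y, U [set a : Aut | ta_inv a x = y].
  have [B BP] := finite_sphere (depth v0 x).
  apply: (@ultra_finite _ U (fun a : Aut => ta_inv a x) B UU); apply: filterS Uv => a av.
  apply: BP; rewrite (@depth_aut (ta_inverse a)) //=.
  by rewrite -{1}av ta_funK.
have [b bP] := boolp.choice bE; have [c cP] := boolp.choice cE.
have bK : cancel b c.
  move=> x; have [a [/= ax ac]] := filter_ex (filterI (bP x) (cP (b x))).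
  by rewrite -ac -ax ta_funK.
have cK : cancel c b.
  move=> x; have [a [/= ax ac]] := filter_ex (filterI (cP x) (bP (c x))).
  by rewrite -ac -ax ta_invK.
have bA : {mono b : x y / adj x y}.
  move=> x y; have [a [/= ax ay]] := filter_ex (filterI (bP x) (bP y)).
  by rewrite -ax -ay ta_adj.
exists (TreeAut bK cK bA); split.
  move=> x xS; have [a [/= aS ax]] := filter_ex (filterI US (bP x)).
  by rewrite /= -ax aS.
move=> W /aut_nbhsP[S' S'W].
have : U [set a : Aut | {in (S' : seq T), forall x, a x = b x}].
  elim: (S' : seq T) => [|x s IH]; first by apply: filterS US.
  apply: filterS (filterI IH (bP x)) => a [/= aS ax] z.
  by rewrite inE => /orP[/eqP ->|/aS].
by apply: filterS => a aS; apply: S'W => x xS; exact: aS.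
Qed.

Definition fixgroup S : set N := [set g | exists2 a, fixes S a & g = aut_incl a].

Lemma fixgroup_compact S : v0 \in S -> compact (fixgroup S).
Proof.
move=> vS; have -> : fixgroup S = @aut_incl d T @` [set a | fixes S a].
  by apply/seteqP; split=> g; [move=> [a aS ->]; exists a|move=> [a aS <-]; exists a].
apply: continuous_compact (fixes_compact vS).
by apply: continuous_subspaceT; exact: aut_incl_continuous.
Qed.

Lemma fixgroup1 S : fixgroup S 1%g.
Proof. by exists 1%g; rewrite ?gmulf1. Qed.

Lemma fixgroupM S g h : fixgroup S g -> fixgroup S h -> fixgroup S (g * h)%g.
Proof.
move=> [a aS ->] [b bS ->]; exists (a * b)%g; rewrite ?gmulfM // => x xS.
by rewrite /= bS // aS.
Qed.

Lemma fixgroupV S g : fixgroup S g -> fixgroup S (g^-1)%g.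
Proof.
move=> [a aS ->]; exists (a^-1)%g; rewrite ?gmulfV // => x xS.
by rewrite /= -{1}(aS x xS) ta_funK.
Qed.

Lemma fixgroup_open S : open_subgroup (fixgroup S).
Proof.
split; [|exact: fixgroup1|exact: fixgroupM|exact: fixgroupV].
have := fixes_open 1%g S; congr (open _); apply/seteqP.
by split=> g [a aS ->]; exists a; rewrite ?mul1g.
Qed.

Lemma fixgroup_basis (U : set N) : nbhs (1%g : N) U ->
  exists2 H, open_subgroup H & H `<=` U.
Proof.
move=> /ner_nbhsP[S SU]; exists (fixgroup S); first exact: fixgroup_open.
by move=> _ [a aS ->]; rewrite -[aut_incl a]mul1g; exact: SU.
Qed.

Variable R : realType.

(** The almost automorphisms carrying a fixed partition [std F] to [x] form a
    compact open set: they are distributed, according to the bijection induced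
    between the balls, into cosets of the group fixing all balls of [std F], which
    is a compact group of automorphisms of the tree by [fix_balls]. Average over
    the bijections the invariant means on these cosets; choosing [F] by the number
    of balls only makes the result equivariant. *)
Lemma partition_mean : exists mu : {fset bball} -> (N -> R) -> R, forall x, vert x -> [/\
  forall f f' : N -> R, continuous f -> continuous f' ->
    mu x (fun u => f u - f' u) = mu x f - mu x f',
  forall c : R, mu x (fun=> c) = c,
  forall g (f : N -> R), continuous f -> mu (act g @` x)%fset f = mu x (fun u => f (g * u)%g) &
  forall (Y : topologicalType) (f : N -> Y -> R), continuous (fun p : N * Y => f p.1 p.2) ->
    continuous (fun y => mu x (f^~ y))].
Proof.
have FE n : exists F, (exists F', ideal F' /\ #|` bd F'| = n) -> ideal F /\ #|` bd F| = n.
  have [[F' F'P]|?] := pselect (exists F', ideal F' /\ #|` bd F'| = n).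
    by exists F'.
  by exists fset0.
have [F FP] := boolp.choice FE.
pose K n := fixgroup (v0 |` (F n `|` bd (F n)))%fset.
have mE n := invariant_mean R (fixgroup_compact (S := v0 |` (F n `|` bd (F n)))%fset (fset1U1 _ _))
  (@fixgroup1 _) (@fixgroupM _) (@fixgroupV _) fixgroup_basis.
have [m mP] := boolp.choice mE.
pose L n : seq T := bd (F n).
(* For [s] listing the balls of a partition, [gs s] carries the partition given
   by [F (size s)] to it, in the order of the lists. *)
pose gs (s : seq bball) : N := xget 1%g [set g | map (act g) (map mk (L (size s))) = s].
have card_std h J : ideal J -> #|` std v0 h J| = #|` bd J|.
  move=> iJ; rewrite /std card_in_imfset //= => l l' lJ _.
  by apply: mkball_inj => //; exact: bd_neq0 lJ.
have xF x : vert x -> ideal (F #|` x|) /\ #|` bd (F #|` x|)| = #|` x|.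
  move=> [h [J [iJ ->]]]; apply: FP; exists J; split=> //.
  by rewrite card_std.
have gsP x s : vert x -> perm_eq s x -> map (act (gs s)) (map mk (L (size s))) = s.
  move=> vx sx; have [iF cF] := xF x vx.
  suff : [set g | map (act g) (map mk (L (size s))) = s] (gs s) by [].
  apply: xgetPex; rewrite /= (perm_size sx).
  apply: (act_transitive d2 (vert_std 1%g iF) vx).
  - rewrite map_inj_in_uniq ?fset_uniq // => l l' lF _; apply: mkball_inj => //.
    exact: bd_neq0 lF.
  - move=> b; apply/mapP/in_stdP => -[l lF ->]; by exists l.
  - by rewrite (perm_uniq sx) fset_uniq.
  - exact: perm_mem sx.
  - by rewrite size_map (perm_size sx) /L; exact: cF.
have gs_act g x s : vert x -> perm_eq s x ->
    K #|` x| ((g * gs s)^-1 * gs (map (act g) s))%g.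
  move=> vx sx; have [iF cF] := xF x vx.
  have gsx : perm_eq (map (act g) s) (act g @` x)%fset.
    apply: uniq_perm; [|exact: fset_uniq|].
      by rewrite map_inj_uniq ?(perm_uniq sx) ?fset_uniq //; exact: act_inj.
    move=> b; apply/mapP/imfsetP => /=.
      by move=> [c cs ->]; exists c => //; rewrite -(perm_mem sx).
    by move=> [c cx ->]; exists c => //; rewrite (perm_mem sx).
  have E : map (act (gs (map (act g) s))) (map mk (L #|` x|)) =
      map (act (g * gs s)%g) (map mk (L #|` x|)).
    have := gsP _ _ (vert_act g vx) gsx; rewrite size_map (perm_size sx) => ->.
    rewrite -{1}(gsP _ _ vx sx) (perm_size sx) -map_comp; apply/eq_in_map => b _ /=.
    by rewrite actM.
  have [l lF|a aF ->] := fix_balls (g := ((g * gs s)^-1 * gs (map (act g) s))%g) iF.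
    have lL : mk l \in map mk (L #|` x|) by exact: map_f.
    by move/eq_in_map: E => E; rewrite actM (E _ lL) actK.
  exists a => // y; rewrite inE => /orP[|/aF //]; rewrite inE => /eqP ->.
  by apply: aF; rewrite inE iF.1.
have cl g (f : N -> R) : continuous f -> continuous (fun u => f (g * u)%g).
  by move=> cf u; apply: continuous_comp; [exact: mulgl_continuous|exact: cf].
pose p x : R := (size (permutations (x : {fset bball})))%:R.
have p0 x : p x != 0.
  rewrite /p pnatr_eq0 -lt0n; have : (x : seq bball) \in permutations x.
    by rewrite mem_permutations.
  by case: (permutations _).
exists (fun (x : {fset bball}) (f : N -> R) => (\sum_(s <- permutations x) m #|` x| (fun u => f (gs s * u)%g)) / p x).
move=> x vx; have [mB mc mle mK] := mP #|` x|; split.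
- move=> f f' cf cf'; rewrite -mulrBl -sumrB; congr (_ / _).
  by apply: eq_bigr => s _; rewrite mB //; exact: cl.
- move=> c; rewrite (eq_bigr (fun=> c)) => [|s _]; last exact: mc.
  by rewrite sum_cst -(mulr_natr c) mulfK //; exact: p0.
- move=> g f cf.
  have pgx : perm_eq (permutations (act g @` x)%fset) (map (map (act g)) (permutations x)).
    apply: uniq_perm; first exact: permutations_uniq.
      rewrite map_inj_uniq ?permutations_uniq //; apply: inj_map; exact: act_inj.
    have gx : perm_eq (act g @` x)%fset (map (act g) x).
      apply: uniq_perm; first exact: fset_uniq.
        by rewrite map_inj_uniq ?fset_uniq //; exact: act_inj.
      by move=> b; apply/imfsetP/mapP => -[c cx ->]; exists c.
    move=> t; rewrite mem_permutations (permPr gx); apply/idP/mapP.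
      move=> tx; exists (map (act g^-1%g) t).
        rewrite mem_permutations; apply: (perm_trans (perm_map _ tx)).
        by rewrite -map_comp (eq_map (g := id)) ?map_id // => b /=; rewrite actK.
      by rewrite -map_comp (eq_map (g := id)) ?map_id // => b /=; rewrite actVK.
    by move=> [s]; rewrite mem_permutations => sx ->; exact: perm_map.
  rewrite /p (perm_size pgx) size_map; congr (_ / _).
  rewrite (perm_big _ pgx) big_map big_seq [RHS]big_seq; apply: eq_bigr => s.
  rewrite mem_permutations => sx.
  have -> : #|` (act g @` x)%fset| = #|` x| by apply: card_imfset; exact: act_inj.
  rewrite -[RHS](mK _ ((g * gs s)^-1 * gs (map (act g) s))%g).
  + by congr (m _ _); apply/funext => u; rewrite !mulgA mulgV mul1g.
  + by apply: (cl (gs s) (fun v => f (g * v)%g)); exact: cl.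
  + exact: gs_act.
move=> Y f cf; have ccf y : continuous (f^~ y).
  move=> u; apply: (@continuous_comp _ _ _ (fun u : N => (u, y)) (fun p : N * Y => f p.1 p.2)).
    by apply: continuous_pair; [exact: continuous_idfun|exact: cst_continuous].
  exact: cf.
have ccg g y : continuous (fun u => f (g * u)%g y).
  by apply: (cl g (f^~ y)); exact: ccf.
have cm g : continuous (fun y => m #|` x| (fun u => f (g * u)%g y)).
  move=> y; apply/cvgrPdist_le => c c0.
  have : \forall y' \near y, K #|` x| `<=` (fun u => `|f (g * u)%g y - f (g * u)%g y'| <= c).
    apply: ((compact_near_coveringP (K #|` x|)).1 (fixgroup_compact (fset1U1 _ _)) _ (nbhs y)
      (fun y' u => `|f (g * u)%g y - f (g * u)%g y'| <= c) _) => u Ku.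
    have ch : continuous (fun q : N * Y => f (g * q.1)%g y - f (g * q.1)%g q.2).
      move=> q; apply: cvgB.
        apply: (@continuous_comp _ _ _ (fun q : N * Y => q.1) (fun u : N => f (g * u)%g y)).
          exact: cvg_fst.
        exact: ccg.
      apply: (@continuous_comp _ _ _ (fun q : N * Y => ((g * q.1)%g, q.2)) (fun p : N * Y => f p.1 p.2)).
        apply: continuous_pair => z; last exact: cvg_snd.
        by apply: continuous_comp; [exact: cvg_fst|exact: mulgl_continuous].
      exact: cf.
    have /cvgrPdist_lt /(_ _ c0) := ch (u, y).
    by apply: filterS => -[u' y'] /=; rewrite subrr sub0r normrN => /ltW.
  apply: filterS => y' Ky'; rewrite -(mB _ _ (ccg g y) (ccg g y')).
  by apply: mle Ky'; exact: continuous_sub (ccg g y) (ccg g y').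
have := @mull_continuous R Y (p x)^-1 (fun y => \sum_(s <- permutations x)
  m #|` x| (fun u => f (gs s * u)%g y)).
rewrite (_ : (fun y => _ * _) = (fun y => (\sum_(s <- permutations x)
  m #|` x| (fun u => f (gs s * u)%g y)) / p x)); last by apply/funext => y; rewrite mulrC.
apply; apply: (continuous_big (op := +%R)) => [|s _]; last exact: cm.
exact: add_continuous.
Qed.

End PartitionMean.

(** * Bicomplex *)
Section Tuples.
Local Open Scope ring_scope.
Variables (G : topologicalGroupType) (R : realType).
Notation gtuple := (gtuple G).

Definition gcons n (u : G) (t : gtuple n) : gtuple n.+1 :=
  fun i => if unlift ord0 i is Some j then t j else u.

Lemma gcons0 n u (t : gtuple n) : gcons u t ord0 = u.
Proof. by rewrite /gcons unlift_none. Qed.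

Lemma gconsS n u (t : gtuple n) j : gcons u t (lift ord0 j) = t j.
Proof. by rewrite /gcons liftK. Qed.

Lemma face_gcons0 n u (t : gtuple n) : face ord0 (gcons u t) = t.
Proof. by apply/funext => i; rewrite /face gconsS. Qed.

Lemma face_gconsS n u (t : gtuple n.+1) j :
  face (lift ord0 j) (gcons u t) = gcons u (face j t).
Proof.
apply/funext => i; rewrite /face /gcons.
case: (unliftP ord0 i) => [k ->|->].
  have -> : lift (lift ord0 j) (lift ord0 k) = lift ord0 (lift j k) :> 'I_n.+3.
    by apply/val_inj; rewrite /= /bump; lia.
  by rewrite liftK.
have -> : lift (lift ord0 j) ord0 = ord0 :> 'I_n.+3 by apply/val_inj.
by rewrite unlift_none.
Qed.

Lemma gconsK n (t : gtuple n.+1) : gcons (t ord0) (face ord0 t) = t.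
Proof.
apply/funext => i; case: (unliftP ord0 i) => [k ->|->]; last exact: gcons0.
by rewrite gconsS.
Qed.

Lemma gact_gcons n g u (t : gtuple n) : gact g (gcons u t) = gcons (g * u)%g (gact g t).
Proof.
apply/funext => i; rewrite /gact; case: (unliftP ord0 i) => [k ->|->].
  by rewrite !gconsS.
by rewrite !gcons0.
Qed.

Lemma gact_face n g j (t : gtuple n.+1) : face j (gact g t) = gact g (face j t).
Proof. by []. Qed.

Lemma gactM n g h (t : gtuple n) : gact (g * h)%g t = gact g (gact h t).
Proof. by apply/funext => i; rewrite /gact mulgA. Qed.

Lemma gact1 n (t : gtuple n) : gact 1%g t = t.
Proof. by apply/funext => i; rewrite /gact mul1g. Qed.

(** The differential, seen from the first argument: the identity behind the
    contracting homotopies of homogeneous cochains. *)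
Lemma diff_gcons n (f : gtuple n.+1 -> R) u (t : gtuple n.+1) :
  diff_fun f (gcons u t) = f t - diff_fun (fun t' => f (gcons u t')) t.
Proof.
rewrite /diff_fun big_ord_recl expr0 mul1r face_gcons0; congr (_ + _).
rewrite -sumrN; apply: eq_bigr => j _; rewrite face_gconsS.
by rewrite lift0 exprS mulN1r mulNr.
Qed.

Lemma diffB n (f h : gtuple n -> R) t :
  diff_fun (fun t => f t - h t) t = diff_fun f t - diff_fun h t.
Proof. by rewrite /diff_fun -sumrB; apply: eq_bigr => j _; rewrite mulrBr. Qed.

Lemma diff_ext n (f h : gtuple n -> R) t : f =1 h -> diff_fun f t = diff_fun h t.
Proof. by move=> fh; apply: eq_bigr => j _; rewrite fh. Qed.

Lemma diff_asum n (I : eqType) (F : I -> seq I -> gtuple n -> R) s t :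
  diff_fun (asum F s) t = asum (fun a r => diff_fun (F a r) t) s.
Proof.
elim: s F => [|a s IH] F /=.
  by rewrite /diff_fun big1 // => j _; rewrite mulr0.
by rewrite -IH -diffB.
Qed.

Lemma asum_eval n (I : eqType) (F : I -> seq I -> gtuple n -> R) s t :
  asum F s t = asum (fun a r => F a r t) s.
Proof. by elim: s F => //= a s IH F; rewrite -(IH (fun b r => F b (a :: r))). Qed.

Lemma diff_fun0 (f : gtuple 0 -> R) (t : gtuple 1) :
  diff_fun f t = f (fun=> t ord_max) - f (fun=> t ord0).
Proof.
rewrite /diff_fun !big_ord_recl big_ord0 addr0 expr0 mul1r expr1 mulN1r.
by congr (f _ - f _); apply/funext => i; rewrite /face; congr (t _);
  apply/val_inj; case: i => [[]].
Qed.

Lemma diff_fun0_eq0 (f : gtuple 0 -> R) : (forall t, diff_fun f t = 0) ->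
  forall t u, f t = f u.
Proof.
move=> f0 t u; have := f0 (gcons (u ord0) t); rewrite diff_fun0 gcons0.
have -> : ord_max = lift ord0 ord0 :> 'I_2 by apply/val_inj.
rewrite gconsS => /eqP; rewrite subr_eq0 => /eqP E.
have cst (w : gtuple 0) : (fun=> w ord0) = w by apply/funext => i; rewrite [i]ord1.
by rewrite -(cst t) -(cst u).
Qed.

Lemma diff_diff_fun n (f : gtuple n -> R) t : diff_fun (diff_fun f) t = 0.
Proof.
elim: n f t => [|n IH] f t; rewrite -[t]gconsK diff_gcons; last first.
  set u := t ord0; set s := face ord0 t.
  rewrite (diff_ext s (diff_gcons f u)) diffB IH subr0 subrr //.
have gcE (u v : G) : gcons u ((fun=> v) : gtuple 0) ord_max = v.
  have -> : ord_max = lift ord0 ord0 :> 'I_2 by apply/val_inj.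
  exact: gconsS.
by rewrite !diff_fun0 !gcE !gcons0 [X in _ - X]subr_subr_swap subrr subr0 subrr.
Qed.

End Tuples.

Section Bicomplex.
Local Open Scope classical_set_scope.
Local Open Scope ring_scope.
Variables (d : nat) (T : regular_tree d) (v0 : T).
Hypothesis d2 : (2 <= d)%N.
Variable R : realType.
Notation N := (neretin T).
Notation bball := (bball v0).
Notation vert := (@vert d T v0).
Notation cube := (@cube d T v0).
Notation cobd := (cob (@subdivide d T v0)).
Notation gtuple := (gtuple N).
Implicit Types (g h : N) (a b : bball) (x y : {fset bball}) (s : seq bball) (p q : nat).

Lemma imfset_actM g h x : (act (g * h)%g @` x = act g @` (act h @` x))%fset.
Proof.
apply/fsetP => b; apply/imfsetP/imfsetP => /= [[c cx ->]|[_ /imfsetP[c /= cx ->] ->]].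
  by exists (act h c); rewrite ?actM // in_imfset.
by exists c; rewrite // actM.
Qed.

Lemma map_actM g h s : map (act (g * h)%g) s = map (act g) (map (act h) s).
Proof. by rewrite -map_comp; apply: eq_map => b; rewrite /= actM. Qed.

Lemma cube_act g x s : cube x s -> cube (act g @` x)%fset (map (act g) s).
Proof.
move=> [vx us sx]; split; first exact: vert_act.
  by rewrite map_inj_uniq //; exact: act_inj.
by move=> _ /mapP[b bs ->]; rewrite in_imfset //; exact: sx.
Qed.

(** By [exists_conj], an automorphism fixing enough vertices acts on a ball
    [mkball v0 h l] through one fixing the root and [l]. *)
Lemma act_near g b : \forall h \near g, act h^-1%g b = act g^-1%g b.
Proof.
apply/ner_nbhsP; move: (act g^-1%g b) (actVK g b) => b' <-.
elim/ballW: b' => h l.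
have [S SE] := exists_conj h [fset v0; l]%fset.
exists S => a aS; have [c cl E] := SE _ aS.
have cv : c v0 = v0 by apply: cl; rewrite !inE eqxx.
have cll : c l = l by apply: cl; rewrite !inE eqxx orbT.
have fixed : act (aut_incl a) (mkball v0 h l) = mkball v0 h l.
  by rewrite actE E -actE (mkball_aut _ cv) cll actE mulg1.
by rewrite /= invgM actM actK -{1}fixed actK.
Qed.

Lemma act_near_seq g s : \forall h \near g, {in s, forall b, act h^-1%g b = act g^-1%g b}.
Proof.
have Fg : Filter (nbhs g) := nbhs_filter g.
elim: s => [|b s IH]; first by apply/ner_nbhsP; exists fset0 => a _ c; rewrite in_nil.
apply: filterS (filterI (act_near g b) IH) => h [hb hs] c.
by rewrite inE => /orP[/eqP ->|/hs].
Qed.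

(** The term of bidegree [(p, q)]: equivariant functions on the [p]-cubes with
    values in the continuous functions of [q.+1] group elements, continued by
    zero to the cubes of other dimensions. *)
Definition bicochain p q (phi : {fset bball} -> seq bball -> gtuple q -> R) := [/\
  forall x s, size s != p -> phi x s = 0,
  forall x s, cube x s -> continuous (phi x s),
  alternating cube phi &
  forall g x s t, cube x s -> phi (act g @` x)%fset (map (act g) s) (gact g t) = phi x s t].

Lemma cob_supp p (V : zmodType) (phi : {fset bball} -> seq bball -> V) x s :
  (forall x s, size s != p -> phi x s = 0) -> size s != p.+1 -> cobd phi x s = 0.
Proof.
move=> p0 sp; rewrite /cob (asum_ext (F' := fun _ _ => 0)) ?asum0 // => a r ar.
have rp : size r != p by apply: contra sp => /eqP <-; rewrite -(perm_size ar).
by rewrite !p0 ?subr0.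
Qed.

Lemma cob_act (V : zmodType) (phi : {fset bball} -> seq bball -> V) g x s :
  cobd phi (act g @` x)%fset (map (act g) s) =
  cobd (fun x s => phi (act g @` x)%fset (map (act g) s)) x s.
Proof.
by rewrite /cob asum_map; apply: asum_ext => a r _; rewrite act_subdivide.
Qed.

Lemma cob_eval q (phi : {fset bball} -> seq bball -> gtuple q -> R) x s t :
  cobd phi x s t = cobd (fun x s => phi x s t) x s.
Proof. by rewrite /cob asum_eval. Qed.

Lemma cob_diff q (phi : {fset bball} -> seq bball -> gtuple q -> R) x s t :
  cobd (fun x s => diff_fun (phi x s)) x s t = diff_fun (cobd phi x s) t.
Proof. by rewrite cob_eval /cob diff_asum; apply: asum_ext => a r _; rewrite -diffB. Qed.

Definition is_cont q : {pred (gtuple q -> R)} := fun f => `[< continuous f >].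

Lemma is_contP q (f : gtuple q -> R) : reflect (continuous f) (f \in @is_cont q).
Proof. exact: asboolP. Qed.

Lemma is_cont_zmod q : zmod_closed (@is_cont q).
Proof.
split; first by apply/is_contP; exact: (@cst_continuous _ R 0).
move=> f h /is_contP cf /is_contP ch; apply/is_contP => x.
by apply: continuousB; [exact: cf|exact: ch].
Qed.

HB.instance Definition _ q :=
  GRing.isZmodClosed.Build (gtuple q -> R) (@is_cont q) (@is_cont_zmod q).

Lemma bicochain_cob p q (phi : {fset bball} -> seq bball -> gtuple q -> R) :
  @bicochain p q phi -> @bicochain p.+1 q (cobd phi).
Proof.
move=> [p0 pc pa pi]; split.
- by move=> x s; exact: cob_supp.
- move=> x s xs; apply/is_contP.
  apply: (cob_closed (@cube_perm d T v0) (@cube_near d T v0) (cube_far d2) xs).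
  by move=> y r yr; apply/is_contP; exact: pc.
- exact: (cob_alt (@cube_perm d T v0) (@cube_near d T v0) (cube_far d2) pa).
move=> g x s t xs; rewrite !cob_eval cob_act.
apply: (cob_ext (@cube_perm d T v0) (@cube_near d T v0) (cube_far d2) xs) => y r yr _.
exact: pi.
Qed.

Lemma gact_inv_continuous q : continuous (fun u : gtuple q => gact (u ord0)^-1%g u).
Proof.
have cp i : continuous (fun u : gtuple q => u i).
  exact: (@proj_continuous _ (fun _ : 'I_q.+1 => N)).
move=> u; have Fu : Filter (nbhs u) := nbhs_filter u; apply: cvg_ptws => i.
apply: (@continuous_comp _ _ _ (fun u : gtuple q => ((u ord0)^-1%g, u i))
  (fun p : N * N => (p.1 * p.2)%g)); last exact: mulg_continuous.
apply: (@continuous_pair (gtuple q) N N (fun u => (u ord0)^-1%g) (fun u => u i)).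
  move=> z; apply: (@continuous_comp _ _ _ (fun u : gtuple q => u ord0) (fun g : N => g^-1%g)).
    exact: cp.
  exact: invg_continuous.
exact: cp.
Qed.

(** ** Rows *)

(** A primitive of [phi] obtained from the contractibility of the cube complex is
    not equivariant; use it at tuples starting with [1] only, and extend. This
    preserves continuity since the first entry acts on cubes in a locally constant
    way. *)
Lemma row_exact p q (phi : {fset bball} -> seq bball -> gtuple q -> R) :
  @bicochain p.+1 q phi -> (forall x s, cube x s -> cobd phi x s = 0) ->
  exists psi, @bicochain p q psi /\ forall x s, cube x s -> cobd psi x s = phi x s.
Proof.
move=> [p0 pc pa pi] cp.
have [||psi [psi_alt psiE psiS]] := exact_cube d2 (S := @is_cont q) pa cp.
- by move=> x _; exact: p0.
- by move=> x s xs; apply/is_contP; exact: pc.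
pose chi x s (t : gtuple q) : R := if size s == p then
  psi (act (t ord0)^-1%g @` x)%fset (map (act (t ord0)^-1%g) s) (gact (t ord0)^-1%g t) else 0.
exists chi; split; first split.
- by move=> x s /negbTE sp; apply/funext => t; rewrite /chi sp.
- move=> x s xs; rewrite /chi; case: eqP => _; last exact: cst_continuous.
  move=> t; have /is_contP ct := psiS _ _ (cube_act (t ord0)^-1%g xs).
  pose E (u : gtuple q) : R := psi (act (t ord0)^-1%g @` x)%fset (map (act (t ord0)^-1%g) s)
    (gact (u ord0)^-1%g u).
  have cE : continuous E.
    move=> u; apply: (@continuous_comp _ _ _ (fun u : gtuple q => gact (u ord0)^-1%g u)
      (psi (act (t ord0)^-1%g @` x)%fset (map (act (t ord0)^-1%g) s))); last exact: ct.
    exact: gact_inv_continuous.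
  have Ft : Filter (nbhs t) := nbhs_filter t.
  have EE : \forall u \near t, E u = psi (act (u ord0)^-1%g @` x)%fset
      (map (act (u ord0)^-1%g) s) (gact (u ord0)^-1%g u).
    have nE : \forall u \near t, {in (x : seq bball) ++ s, forall b,
        act (u ord0)^-1%g b = act (t ord0)^-1%g b}.
      have := act_near_seq (t ord0) ((x : seq bball) ++ s).
      exact: (@proj_continuous _ (fun _ : 'I_q.+1 => N) ord0 t).
    apply: filterS nE => u uE; rewrite /E.
    have -> : map (act (u ord0)^-1%g) s = map (act (t ord0)^-1%g) s.
      by apply/eq_in_map => b bs; apply: uE; rewrite mem_cat bs orbT.
    have -> // : (act (u ord0)^-1%g @` x = act (t ord0)^-1%g @` x)%fset.
    apply/fsetP => b; apply/imfsetP/imfsetP => -[c /= cx ->]; exists c => //.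
      by apply: uE; rewrite mem_cat cx.
    by rewrite uE // mem_cat cx.
  by apply: cvg_trans (cE t); exact: near_eq_cvg.
- move=> x s1 a b s2 xs; apply/funext => t; rewrite /chi.
  have -> : size (s1 ++ [:: a, b & s2]) = size (s1 ++ [:: b, a & s2]).
    by rewrite !size_cat.
  rewrite [in RHS]/GRing.opp /=; case: eqP => _; last by rewrite oppr0.
  have := cube_act (t ord0)^-1%g xs; rewrite !map_cat /= => xs'.
  by rewrite (psi_alt _ _ _ _ _ xs').
- move=> g x s t xs; rewrite /chi size_map; case: eqP => // _.
  have -> : (gact g t ord0)^-1%g = ((t ord0)^-1 * g^-1)%g by rewrite /gact invgM.
  by rewrite -imfset_actM -map_actM -gactM mulgVK.
move=> x s xs; have [sp|sp] := eqVneq (size s) p.+1; last first.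
  rewrite p0 //; apply: cob_supp sp => {xs}x {}s sp.
  by apply/funext => t; rewrite /chi (negbTE sp).
apply/funext => t; rewrite -(pi (t ord0)^-1%g _ _ _ xs) -psiE; last exact: cube_act.
rewrite !cob_eval cob_act.
apply: (cob_ext (@cube_perm d T v0) (@cube_near d T v0) (cube_far d2) xs) => y r yr.
by rewrite sp => -[rp]; rewrite /chi rp eqxx.
Qed.

Lemma row_constant q (phi : {fset bball} -> seq bball -> gtuple q -> R) x :
  @bicochain 0 q phi -> (forall x s, cube x s -> cobd phi x s = 0) -> vert x ->
  phi x [::] = phi (std v0 1%g [fset v0]%fset) [::].
Proof.
move=> [p0 pc pa pi] cp; apply: (connected_cube d2 (f := fun x => phi x [::])).
move=> y a vy ay; have ya : cube y [:: a].
  by split=> // b; rewrite inE => /eqP ->.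
by have := cp _ _ ya; rewrite /cob /= subr0 => /eqP; rewrite subr_eq0 => /eqP.
Qed.

(** ** Columns *)

Lemma continuous_gcons q : continuous (fun p : N * gtuple q => gcons p.1 p.2).
Proof.
move=> u; have Fu : Filter (nbhs u) := nbhs_filter u; apply: cvg_ptws => i.
rewrite /gcons; case: (unlift ord0 i) => [j|]; last exact: cvg_fst.
apply: (@continuous_comp _ _ _ (fun p : N * gtuple q => p.2) (fun t : gtuple q => t j)).
  exact: cvg_snd.
exact: (@proj_continuous _ (fun _ : 'I_q.+1 => N)).
Qed.

Lemma diff_eqS q (f : gtuple q.+1 -> R) u t : (forall t, diff_fun f t = 0) ->
  f t = diff_fun (fun t' => f (gcons u t')) t.
Proof.
by move=> f0; have := f0 (gcons u t); rewrite diff_gcons => /eqP; rewrite subr_eq0 => /eqP.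
Qed.

(** The usual contraction, prepending an argument, is made equivariant by averaging
    this argument over the almost automorphisms carrying a fixed partition to
    the one at hand. *)
Lemma column_exact p q (phi : {fset bball} -> seq bball -> gtuple q.+1 -> R) :
  @bicochain p q.+1 phi -> (forall x s t, cube x s -> diff_fun (phi x s) t = 0) ->
  exists psi, @bicochain p q psi /\ forall x s t, cube x s -> diff_fun (psi x s) t = phi x s t.
Proof.
move=> [p0 pc pa pi] dp; have [mu muP] := @partition_mean d T v0 d2 R.
pose E x s t (u : N) : R := phi x s (gcons u t).
have cE2 x s : cube x s -> continuous (fun z : N * gtuple q => E x s z.2 z.1).
  move=> xs z; apply: (@continuous_comp _ _ _ (fun p : N * gtuple q => gcons p.1 p.2)
    (phi x s)); first exact: continuous_gcons.
  exact: pc.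
have cE x s t : cube x s -> continuous (E x s t).
  move=> xs u; apply: (@continuous_comp _ _ _ (fun u : N => (u, t))
    (fun z : N * gtuple q => E x s z.2 z.1)); last exact: cE2.
  by apply: (@continuous_pair N N (gtuple q)); [exact: continuous_idfun|exact: cst_continuous].
have mu0 x : vert x -> mu x (fun=> 0) = 0 by move=> /muP[].
have muN x (f : N -> R) : vert x -> continuous f -> mu x (fun u => - f u) = - mu x f.
  move=> vx cf; have [mB mc _ _] := muP x vx.
  have := mB _ _ (@cst_continuous N R 0) cf; rewrite mc sub0r => <-.
  by congr (mu x _); apply/funext => u; rewrite sub0r.
have cN (f : N -> R) : continuous f -> continuous (fun u => - f u).
  exact: continuous_neg.
have muS x (f : N -> R) n : vert x -> continuous f ->
    continuous (fun u => (-1) ^+ n * f u) /\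
    mu x (fun u => (-1) ^+ n * f u) = (-1) ^+ n * mu x f.
  move=> vx cf; rewrite -signr_odd; case: (odd n); rewrite ?expr1 ?expr0.
    have -> : (fun u => -1 * f u) = (fun u => - f u) by apply/funext => u; rewrite mulN1r.
    by rewrite mulN1r; split; [exact: cN|exact: muN].
  have -> : (fun u => 1 * f u) = f by apply/funext => u; rewrite mul1r.
  by rewrite mul1r.
have musum x (I : Type) (r : seq I) (F : I -> N -> R) : vert x ->
    (forall i, continuous (F i)) -> continuous (fun u => \sum_(i <- r) F i u) /\
    mu x (fun u => \sum_(i <- r) F i u) = \sum_(i <- r) mu x (F i).
  move=> vx cF; have [mB mc _ _] := muP x vx; elim: r => [|i r [IHc IHm]].
    rewrite big_nil (_ : (fun u => _) = (fun=> 0)); last by apply/funext => u; rewrite big_nil.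
    by split; [exact: cst_continuous|exact: mu0].
  have -> : (fun u => \sum_(j <- i :: r) F j u) = (fun u => F i u - - \sum_(j <- r) F j u).
    by apply/funext => u; rewrite big_cons opprK.
  split; first exact: (continuous_sub (cF i) (cN _ IHc)).
  by rewrite mB //; [rewrite muN // opprK IHm big_cons|exact: cN].
pose psi x s (t : gtuple q) : R :=
  if `[< cube x s >] && (size s == p) then mu x (E x s t) else 0.
have psiE x s t : cube x s -> size s == p -> psi x s t = mu x (E x s t).
  by move=> xs sp; rewrite /psi sp andbT; case: asboolP.
have psi0 x s : size s != p -> psi x s = 0.
  by move=> /negbTE sp; apply/funext => t; rewrite /psi sp andbF.
exists psi; split; first split=> //.
- move=> x s xs; have [sp|sp] := boolP (size s == p); last first.
    by rewrite psi0 //; exact: cst_continuous.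
  rewrite (_ : psi x s = (fun t => mu x (E x s t))); last first.
    by apply/funext => t; exact: psiE.
  have [_ _ _ mY] := muP x (cube_vert xs).
  by apply: (mY (gtuple q) (fun u t => E x s t u)); exact: cE2.
- move=> x s1 a b s2 xs; apply/funext => t.
  have pab : perm_eq (s1 ++ [:: a, b & s2]) (s1 ++ [:: b, a & s2]).
    by rewrite perm_cat2l perm_swap2.
  have xs' := cube_perm xs pab.
  have [sp|sp] := boolP (size (s1 ++ [:: a, b & s2]) == p); last first.
    by rewrite !psi0 ?oppr0 // -(perm_size pab).
  rewrite psiE // [in RHS]/GRing.opp /= psiE //; last by rewrite -(perm_size pab).
  rewrite -muN; [|exact: cube_vert xs|exact: cE].
  by congr (mu x _); apply/funext => u; rewrite /E (pa _ _ _ _ _ xs).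
- move=> g x s t xs; have gxs := cube_act g xs.
  have [sp|sp] := boolP (size s == p); last by rewrite !psi0 // size_map.
  rewrite !psiE ?size_map //; have [_ _ mg _] := muP x (cube_vert xs).
  rewrite mg; last exact: cE.
  by congr (mu x _); apply/funext => u; rewrite /E -gact_gcons pi.
move=> x s t xs; have [sp|sp] := boolP (size s == p); last first.
  by rewrite psi0 // p0 // /diff_fun big1 // => j _; rewrite mulr0.
have vx := cube_vert xs; have [mB mc _ _] := muP x vx.
rewrite /diff_fun (eq_bigr (fun j : 'I_q.+2 => mu x (fun u => (-1) ^+ j * E x s (face j t) u))).
  have cF (j : 'I_q.+2) : continuous (fun u => (-1) ^+ j * E x s (face j t) u).
    by apply: (muS x _ j vx _).1; exact: cE.
  rewrite -(musum x _ _ _ vx cF).2 -[RHS](mc (phi x s t)).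
  by congr (mu x _); apply/funext => u; rewrite [RHS](diff_eqS u) // => t'; exact: dp.
by move=> j _; rewrite psiE //; rewrite (muS x _ j vx _).2 //; exact: cE.
Qed.

(** ** Invariant cubical cochains *)

Lemma act_cube x y s t : cube x s -> cube y t -> size s = size t ->
  #|` x| = #|` y| -> exists g, map (act g) s = t /\ (act g @` x)%fset = y.
Proof.
move=> [vx us sx] [vy ut ty] st xy.
have enum z r : uniq r -> {subset r <= z} ->
    perm_eq (r ++ [seq b <- (z : {fset bball}) | b \notin r]) z.
  move=> ur rz; apply: uniq_perm; last 2 first.
  - exact: fset_uniq.
  - move=> b; rewrite mem_cat mem_filter.
    by have [/rz ->|] := boolP (b \in r).
  rewrite cat_uniq ur filter_uniq ?fset_uniq // andbT /=.
  by apply/hasPn => b; rewrite mem_filter => /andP[].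
have ex := enum x s us sx; have ey := enum y t ut ty.
have [|||||g] := act_transitive d2 (s := s ++ [seq b <- x | b \notin s])
  (t := t ++ [seq b <- y | b \notin t]) vx vy.
- by rewrite (perm_uniq ex) fset_uniq.
- exact: perm_mem ex.
- by rewrite (perm_uniq ey) fset_uniq.
- exact: perm_mem ey.
- by rewrite (perm_size ex) (perm_size ey).
move=> gE; exists g; split.
  have := congr1 (take (size t)) gE.
  by rewrite map_cat !take_cat size_map st ltnn subnn !take0 !cats0.
apply/fsetP => b; rewrite -(perm_mem ey) -gE; apply/imfsetP/mapP => /= -[c cx ->].
  by exists c; rewrite // (perm_mem ex).
by exists c; rewrite // -(perm_mem ex).
Qed.

Definition invcochain p (tau : {fset bball} -> seq bball -> R) := [/\
  forall x s, size s != p -> tau x s = 0, alternating cube tau &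
  forall g x s, cube x s -> tau (act g @` x)%fset (map (act g) s) = tau x s].

(** Two directions of a cube are exchanged by some almost automorphism fixing its
    other directions. *)
Lemma invcochain_eq0 p tau x s : invcochain p tau -> (1 < size s)%N -> cube x s ->
  tau x s = 0.
Proof.
move=> [_ ta ti]; case: s => [|a [|b r]] // _ xs.
have xs' : cube x [:: b, a & r] by apply: cube_perm xs _; exact: perm_swap2.
have [g [gs gx]] := act_cube xs xs' erefl erefl.
have := ti g _ _ xs; rewrite gs gx (ta _ [::] _ _ _ xs) /=.
by move=> E; lra.
Qed.

(** On edges, an invariant cochain only depends on the number of balls, and each
    subdivision adds [k = d.-1] of them. So a primitive at partitions with [n] balls
    is the sum of the values at [n - k], [n - 2 * k], and so on. *)
Lemma invcochain_exact p tau : invcochain p.+1 tau ->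
  exists tau', invcochain p tau' /\ forall x s, cube x s -> cobd tau' x s = tau x s.
Proof.
move=> It; have [t0 ta ti] := It; case: p => [|p] in It t0 *; last first.
  exists (fun _ _ => 0); split; first by split=> // y s1 a b s2 _ /=; rewrite oppr0.
  move=> x s xs; have [sp|sp] := eqVneq (size s) p.+2; last first.
    by rewrite t0 //; exact: (cob_supp (p := p.+1)).
  rewrite (invcochain_eq0 It) ?sp // /cob (asum_ext (F' := fun _ _ => 0)) ?asum0 //.
  by move=> a r _; rewrite subr0.
pose k := d.-1; have k0 : (0 < k)%N by rewrite /k; lia.
have thE n : exists c, forall x a, cube x [:: a] -> #|` x| = n -> tau x [:: a] = c.
  have [[x [a [xa xn]]]|no] := pselect (exists x a, cube x [:: a] /\ #|` x| = n).
    exists (tau x [:: a]) => y b yb yn.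
    have [g [gb gy]] := act_cube yb xa erefl (etrans yn (esym xn)).
    by rewrite -(ti g _ _ yb) gb gy.
  by exists 0 => x a xa xn; case: no; exists x, a.
have [th thP] := boolp.choice thE.
pose chi n : R := \sum_(i < n %/ k) th (n %% k + i * k)%N.
have chiD n : chi (n + k)%N = chi n + th n.
  rewrite /chi modnDr divnDr ?dvdnn // divnn k0 addn1 big_ord_recr /=.
  by rewrite addnC -divn_eq.
exists (fun x s => if s is [::] then chi #|` x| else 0); split; first split.
- by move=> x [].
- by move=> x s1 a b s2 _; case: s1 => [|? ?] /=; rewrite oppr0.
- move=> g x [|a s] //= _; congr chi; apply: card_imfset; exact: act_inj.
move=> x s xs; have [s1|s1] := eqVneq (size s) 1; last first.
  by rewrite t0 //; apply: (cob_supp (p := 0)) s1 => {xs}x [].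
case: s s1 xs => [|a [|]] // _ xa; have [vx _ _] := xa; have ax := cube_head xa.
rewrite /cob /= subr0 (card_subdivide d2 vx ax) chiD addrC addKr.
exact/esym/thP.
Qed.

(** ** The staircase *)

Lemma bicochainB p q (phi psi : {fset bball} -> seq bball -> gtuple q -> R) :
  @bicochain p q phi -> @bicochain p q psi -> @bicochain p q (fun x s t => phi x s t - psi x s t).
Proof.
move=> [p0 pc pa pi] [q0 qc qa qi]; split.
- by move=> x s sp; apply/funext => t; rewrite p0 // q0 // subr0.
- by move=> x s xs; exact: (continuous_sub (pc x s xs) (qc x s xs)).
- move=> x s1 a b s2 xs; apply/funext => t; rewrite (pa _ _ _ _ _ xs) (qa _ _ _ _ _ xs).
  by rewrite !opprfctE opprB opprK addrC.
- by move=> g x s t xs; rewrite pi // qi.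
Qed.

Lemma bicochain_diff p q (phi : {fset bball} -> seq bball -> gtuple q -> R) :
  @bicochain p q phi -> @bicochain p q.+1 (fun x s => diff_fun (phi x s)).
Proof.
move=> [p0 pc pa pi]; split.
- move=> x s sp; apply/funext => t; rewrite p0 // /diff_fun big1 // => j _.
  by rewrite mulr0.
- move=> x s xs; apply: (continuous_big (op := +%R)) => [|j _].
    exact: add_continuous.
  apply: (@mull_continuous R (gtuple q.+1)) => t.
  by apply: continuous_comp; [exact: face_continuous|exact: pc].
- move=> x s1 a b s2 xs; apply/funext => t; rewrite (pa _ _ _ _ _ xs).
  by rewrite !opprfctE /diff_fun -sumrN; apply: eq_bigr => j _; rewrite mulrN.
- by move=> g x s t xs; apply: eq_bigr => j _; rewrite gact_face pi.
Qed.

Lemma cob_sub_eval q (phi psi : {fset bball} -> seq bball -> gtuple q -> R) x s t :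
  cobd (fun x s t => phi x s t - psi x s t) x s t = cobd phi x s t - cobd psi x s t.
Proof. by rewrite !cob_eval cobB. Qed.

(** The usual chase in a bicomplex with exact rows and columns, in the form of an
    induction on [q]. It ends in the column of [invcochain]s. *)
Lemma staircase q : forall p (phi : {fset bball} -> seq bball -> gtuple q.+1 -> R),
  @bicochain p q.+1 phi -> (forall x s t, cube x s -> diff_fun (phi x s) t = 0) ->
  (forall x s, cube x s -> cobd phi x s = 0) ->
  exists psi, [/\ @bicochain p q psi,
    forall x s t, cube x s -> diff_fun (psi x s) t = phi x s t &
    forall x s, cube x s -> cobd psi x s = 0].
Proof.
have cc := cob_cob (@cube_perm d T v0) (cube_subdivideC d2).
have dc p n (psi : {fset bball} -> seq bball -> gtuple n -> R)
    (phi : {fset bball} -> seq bball -> gtuple n.+1 -> R) :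
    (forall x s t, cube x s -> diff_fun (psi x s) t = phi x s t) ->
    (forall x s, cube x s -> cobd phi x s = 0) -> @bicochain p n psi ->
    forall x s t, cube x s -> diff_fun (cobd psi x s) t = 0.
  move=> E c0 _ x s t xs; rewrite -cob_diff.
  rewrite (cob_ext (@cube_perm d T v0) (@cube_near d T v0) (cube_far d2) (psi := phi) xs).
    by rewrite c0.
  by move=> y r yr _; apply/funext => t'; exact: E.
elim: q => [|q IH] p phi bphi dphi cphi; have [psi [bpsi dpsi]] := column_exact bphi dphi;
    have bc := bicochain_cob bpsi; have dcpsi := dc _ _ _ _ dpsi cphi bpsi.
  have [c0 c1 ca ci] := bc.
  pose e : gtuple 0 := fun=> 1%g.
  pose tau x s := cobd psi x s e.
  have tauE x s t : cube x s -> cobd psi x s t = tau x s.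
    by move=> xs; apply: diff_fun0_eq0 => t'; exact: dcpsi.
  have Itau : invcochain p.+1 tau.
    split.
    - by move=> x s sp; rewrite /tau c0.
    - by move=> x s1 a b s2 xs; rewrite /tau (ca _ _ _ _ _ xs).
    - by move=> g x s xs; rewrite -(tauE _ _ (gact g e)) ?ci //; exact: cube_act.
  have [tau' [[u0 ua ui] tau'E]] := invcochain_exact Itau.
  pose xi x s (t : gtuple 0) := tau' x s.
  have bxi : @bicochain p 0 xi.
    split.
    - by move=> x s sp; apply/funext => t; rewrite /xi u0.
    - by move=> x s xs; exact: cst_continuous.
    - by move=> x s1 a b s2 xs; apply/funext => t; rewrite opprfctE /xi (ua _ _ _ _ _ xs).
    - by move=> g x s t xs; rewrite /xi ui.
  exists (fun x s t => psi x s t - xi x s t); split; first exact: bicochainB.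
    by move=> x s t xs; rewrite diffB dpsi // diff_fun0 subrr subr0.
  move=> x s xs; apply/funext => t.
  by rewrite cob_sub_eval tauE // [X in _ - X]cob_eval tau'E // subrr.
have [chi [bchi dchi cchi]] := IH _ _ bc dcpsi (cc _ psi).
have [xi [bxi cxi]] := row_exact bchi cchi.
exists (fun x s t => psi x s t - diff_fun (xi x s) t); split.
- by apply: bicochainB => //; exact: bicochain_diff.
- by move=> x s t xs; rewrite diffB dpsi // diff_diff_fun subr0.
move=> x s xs; apply/funext => t.
by rewrite cob_sub_eval cob_diff cxi // dchi // subrr.
Qed.

Lemma cohomology_eq0 q (c : continuous_cohomology N R q.+1) : c = 0.
Proof.
have [z ->] := cohomology_class_surj c.
apply/eqP; rewrite cohomology_class_eq0; apply/asboolP.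
have /is_cochainP[zc zi] := cochainP z.
have dz t : diff_fun z t = 0.
  have /eqP dz := cocycleP z.
  by have := congr1 (fun f : cochain N R q.+2 => f t) dz.
pose phi (x : {fset bball}) (s : seq bball) : gtuple q.+1 -> R := if s is [::] then z else 0.
have bphi : @bicochain 0 q.+1 phi.
  split.
  - by move=> x [].
  - move=> x [|a s] _ //=; exact: (@cst_continuous _ R 0).
  - by move=> x s1 a b s2 _; case: s1 => [|? ?] /=; rewrite oppr0.
  - by move=> g x [|a s] t _ //=.
have dphi x s t : cube x s -> diff_fun (phi x s) t = 0.
  case: s => [|a s] _ /=; first exact: dz.
  by rewrite /diff_fun big1 // => j _; rewrite mulr0.
have cphi x s : cube x s -> cobd phi x s = 0.
  have [p0 _ _ _] := bphi; move: s => [|a [|b s]] xs; first by [].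
    by rewrite /cob /= subrr subr0.
  by rewrite (@cob_supp 0 _ phi x [:: a, b & s] p0).
have [psi [bpsi dpsi cpsi]] := staircase bphi dphi cphi.
have [_ pc _ pi] := bpsi.
pose x0 := std v0 1%g [fset v0]%fset.
have vx0 : vert x0 by apply: vert_std; exact: ideal1.
have hC : psi x0 [::] \in @is_cochain N R q.
  apply/is_cochainP; split; first exact: pc (cube0 vx0).
  move=> g t; rewrite -(pi g^-1%g _ _ _ (cube0 vx0)) -gactM mulVg gact1 /=.
  by rewrite (row_constant bpsi cpsi (vert_act g^-1%g vx0)).
exists (Cochain hC); apply: cochain_eq => t /=.
exact: (dpsi x0 [::] t (cube0 vx0)).
Qed.

End Bicomplex.

Theorem corollary1p4 (d : nat) (hd : (2 <= d)%N) (T : regular_tree d)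
  (R : realType) (i : nat) (hi : (0 < i)%N) :
  forall c : continuous_cohomology (neretin T) R i, c = 0%R.
Proof.
have [v0] := tree_inhabited T.
by case: i hi => // q _ c; exact: (cohomology_eq0 v0 hd).
Qed.
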